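(* Let $p$ be an odd prime and $A \subseteq \mathbb{F}_p$ a set with $|A|\ge2$. Then $$\mathsf{D}^\times (A) - \frac{|A|^8}{p} \ll (\log |A|)^2 |A|^5 (\mathsf{E}^{+} (A))^{1/2}.$$ Moreover, for all $k\ge 2$, $$\mathsf{D}^\times_k (A) - \frac{|A|^{4k}}{p} \ll (\log |A|)^4 |A|^{4k-2-2^{-k+2}}\, \mathsf{E}^+ (A)^{1/2^{k-1}}.$$ Generally, for any non-negative, not identically zero function $\alpha$ on $\mathbb{F}_p$ and $\beta=A$ (the indicator function of $A$), and $k\ge2$, $$\mathsf{D}^\times_k (\alpha, \beta) - \frac{\|\alpha\|^{2k}_1 \| \beta \|^{2k}_1}{p} \ll L^8 (\| \alpha\|_1 \| \beta \|_1)^{2k-2} (\| \alpha\|_2 \| \beta \|_2)^{2-2^{-k+2}}\, \mathsf{E}^+ (\alpha,\beta)^{1/2^{k-1}},$$ where $L := \log (\|\alpha\|_1 \|\beta\|_1 |A| / (\|\alpha\|_2 \|\beta\|_2 ))$.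
   Context: $\mathsf{D}^\times_k(A)$ is the number of tuples $(a_1,\dots,a_{2k},a'_1,\dots,a'_{2k})\in A^{4k}$ with $(a_1-a_2)(a_3-a_4)\cdots(a_{2k-1}-a_{2k})=(a'_1-a'_2)\cdots(a'_{2k-1}-a'_{2k})$, and $\mathsf{D}^\times(A)=\mathsf{D}^\times_2(A)$. For functions $\alpha,\beta\ge0$, $\mathsf{D}^\times_k(\alpha,\beta)=\sum \prod_{i=1}^k\alpha(x_i)\beta(y_i)\alpha(x'_i)\beta(y'_i)$, the sum over all $x_i,y_i,x'_i,y'_i\in\mathbb{F}_p$ with $\prod_{i=1}^k(x_i-y_i)=\prod_{i=1}^k(x'_i-y'_i)$. $\mathsf{E}^+(A)$ is the number of $(a_1,\dots,a_4)\in A^4$ with $a_1+a_2=a_3+a_4$; $\mathsf{E}^+(\alpha,\beta)=\sum_x\big(\sum_y\alpha(y)\beta(x-y)\big)^2$. $\|\cdot\|_1,\|\cdot\|_2$ are unnormalized norms; logarithms base $2$; $\ll$ up to an absolute constant.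
   Formalization: In the second and third bounds the implied constant may depend on k (not on p, A or α); a constant uniform in k is impossible, as A = F_p with k → ∞ and p large shows. *)

(* Defs.v *)
From HB Require Import structures.
From mathcomp Require Import all_boot all_order all_algebra.
From mathcomp Require Import all_reals exp.

Set Implicit Arguments.
Unset Strict Implicit.
Unset Printing Implicit Defensive.

Import Order.TTheory GRing.Theory Num.Theory.
Local Open Scope ring_scope.

Definition log2 (R : realType) (x : R) : R := ln x / ln 2.

Definition indic (R : realType) (F : finFieldType) (A : {set F}) : F -> R :=
  fun x => (x \in A)%:R.

Definition norm1 (R : realType) (F : finFieldType) (f : F -> R) : R :=
  \sum_x `|f x|.

Definition norm2 (R : realType) (F : finFieldType) (f : F -> R) : R :=
  Num.sqrt (\sum_x `|f x| ^+ 2).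

(* A tuple (a_1, ..., a_2k, a'_1, ..., a'_2k) of A^(4k) is stored as
   (a, b, a', b') with a i and b i (i < k) its entries a_(2i+1) and a_(2i+2),
   and likewise for the primed half. *)
Definition Dtimes (F : finFieldType) (k : nat) (A : {set F}) : nat :=
  #|[set t : {ffun 'I_k -> F} * {ffun 'I_k -> F} *
             {ffun 'I_k -> F} * {ffun 'I_k -> F} |
      let: (a, b, a', b') := t in
      [forall i, [&& a i \in A, b i \in A, a' i \in A & b' i \in A]] &&
      (\prod_i (a i - b i) == \prod_i (a' i - b' i))]|.

Definition DtimesF (R : realType) (F : finFieldType) (k : nat)
    (alpha beta : F -> R) : R :=
  \sum_(x : {ffun 'I_k -> F}) \sum_(y : {ffun 'I_k -> F})
  \sum_(x' : {ffun 'I_k -> F})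
  \sum_(y' : {ffun 'I_k -> F} |
        \prod_i (x i - y i) == \prod_i (x' i - y' i))
    \prod_i (alpha (x i) * beta (y i) * alpha (x' i) * beta (y' i)).

Definition Eplus (F : finFieldType) (A : {set F}) : nat :=
  #|[set t : F * F * F * F | let: (a1, a2, a3, a4) := t in
      [&& a1 \in A, a2 \in A, a3 \in A, a4 \in A & a1 + a2 == a3 + a4]]|.

Definition EplusF (R : realType) (F : finFieldType) (alpha beta : F -> R) : R :=
  \sum_x (\sum_y alpha y * beta (x - y)) ^+ 2.

(* Main.v *)
(* Let r(z) count, with weights, the representations z = b - a, and let N_k be
   the k-fold multiplicative convolution of r on the nonzero residues. Up to the
   contribution of the zero products, D_k is the square of the l^2 norm of N_k, and
   the main term is the contribution of the mean of N_k, so one has to bound the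
   variance V_k of N_k. Since V_1 <= E^+, everything reduces to an estimate of
   V_(k+1) in terms of the square root of V_k, hence to bounding the l^2 norm of the
   convolution of a mean-zero function with r. A dyadic decomposition replaces the
   two functions by indicators of sets X and B; the norm then counts solutions of
   x (b - a) = x' (b' - a') with x, x' in X, a, a' in A and b, b' in B. Spectral
   and trivial bounds settle the cases where the sets are large or of very
   different sizes, and in the remaining range the count is O((|X||A||B|)^(3/2)).

   This last bound is a special case of Rudnev's point-plane theorem. After a
   generic change of coordinates over F_p(theta), the triples (b, x', a') and
   (x, a, b') become two families of lines in three-space, each lying in one plane
   of a pencil (y = const for the red lines, z = const for the blue ones), and the
   solutions are the meeting pairs. If too many pairs met, a sub-configuration in
   which every line meets many others would lie on a surface Q = 0 of low degree.
   Take Q irreducible. Either the second-order contact polynomial of Q is not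
   divisible by Q, and a resultant bounds the number of lines so that one concludes
   by induction; or Q is ruled in its slices, and then all the lines of the
   configuration meet each other, which the original equation excludes. *)

Require Import Defs.
From HB Require Import structures.
From mathcomp Require Import all_boot all_order all_algebra.
From mathcomp Require Import all_reals exp.
From mathcomp Require Import perm polyXY fraction boolp.
From mathcomp Require Import zify ring lra.

Set Implicit Arguments.
Unset Strict Implicit.
Unset Printing Implicit Defensive.

Import Order.TTheory GRing.Theory Num.Theory.
Local Open Scope ring_scope.

(** * Prime factorizations in polynomial rings *)

Section Divisibility.
Variable R : idomainType.
Implicit Types a b c p : R.

(** Two obstacles shape the geometric part. Lines of one colour must lie in pairwise distinct
    planes, but there may be far more triples than elements of [F]; hence the rational function
    field, which still has characteristic [p]. And contact arguments divide by integers up to the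
    degree, so they need degrees below [p]. The parameter [m] of the incidence count, of order
    [(|X||A||B|)^(1/2)], controls these degrees; once it reaches [p], the spectral bound is equally
    good. Since each red line lies in a plane [y = const], contact is needed only inside planar
    slices: one explicit differential polynomial suffices, and order two already forces a whole line
    into the slice. The logarithms come from the dyadic decompositions, each costing the square of
    the number of levels in a squared norm: one decomposition if [alpha] is an indicator, two in
    general. The recursion for the variances takes a square root at each stage, so a constant [c]
    stabilizes at [c^2] whatever [k] is. This gives the exponents 4 and 8, and 2 for the single
    stage of the first bound. *)

Definition divides a b : Prop := exists c, b = c * a.

Definition prime_elt p : Prop :=
  [/\ p != 0, p \isn't a GRing.unit &
      forall a b, divides p (a * b) -> divides p a \/ divides p b].

(** Factors are prime rather than irreducible, so uniqueness is built in, and the property passes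
    from a ring to its polynomial ring. It is meant for three nested polynomial rings over a
    field. *)
Definition has_prime_factorizations : Prop :=
  forall a, a != 0 -> exists u (s : seq R),
    [/\ u \is a GRing.unit, {in s, forall p, prime_elt p} & a = u * \prod_(p <- s) p].

Lemma divides_refl a : divides a a.
Proof. by exists 1; rewrite mul1r. Qed.

Lemma divides0 a : divides a 0.
Proof. by exists 0; rewrite mul0r. Qed.

Lemma divides_mull a b c : divides a b -> divides a (c * b).
Proof. by case=> d ->; exists (c * d); rewrite mulrA. Qed.

Lemma divides_mulr a b c : divides a b -> divides a (b * c).
Proof. by rewrite mulrC; apply: divides_mull. Qed.

Lemma dividesD a b c : divides a b -> divides a c -> divides a (b + c).
Proof. by case=> d -> [e ->]; exists (d + e); rewrite mulrDl. Qed.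

Lemma dividesB a b c : divides a b -> divides a c -> divides a (b - c).
Proof. by case=> d -> [e ->]; exists (d - e); rewrite mulrBl. Qed.

(** If [q = c * p] with both prime, then [q] divides [c], which would make [p] a unit, or [p], which
    makes [c] one; so [p] and [q] are associate. *)
Lemma prime_divides_prod p u (s : seq R) : prime_elt p -> u \is a GRing.unit ->
    {in s, forall q, prime_elt q} -> divides p (u * \prod_(q <- s) q) ->
  exists q t v, [/\ perm_eq s (q :: t), v \is a GRing.unit & q = v * p].
Proof.
move=> pp uu; case: (pp) => p0 pnu pP.
have pnd1 v : v \is a GRing.unit -> ~ divides p v.
  by move=> uv [c hc]; move: uv; rewrite hc unitrM (negbTE pnu) andbF.
move=> hs /pP[/(pnd1 _ uu)//|].
elim: s hs => [|q s IHs] hs; first by rewrite big_nil => /pnd1; rewrite unitr1 => /(_ isT).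
rewrite big_cons => /pP[[c hc]|/IHs].
  exists q, s, c; split=> //.
  have [q0 qnu qP] : prime_elt q by apply: hs; rewrite mem_head.
  have [|[d hd]|[d hd]] := qP c p; first by rewrite -hc; apply: divides_refl.
    move: q0; rewrite hc hd => q0; exfalso; move: pnu; rewrite -unitrN.
    have : d * q * p = q by rewrite -hd -hc.
    rewrite mulrAC -{2}[q]mul1r => /mulIf h; rewrite unitrN => /negP[].
    apply/unitrPr; exists d; rewrite mulrC; apply: h.
    by apply: contraNneq q0 => q00; rewrite -hd -hc q00.
  have h1 : c * d = 1.
    by apply: (mulIf q0); rewrite -mulrA -hd -hc mul1r.
  by apply/unitrPr; exists d.
case=> [x xs|q' [t [v [h1 h2 h3]]]]; first by apply: hs; rewrite inE xs orbT.
exists q', (q :: t), v; split=> //.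
apply: perm_trans (_ : perm_eq (q :: q' :: t) _); first by rewrite perm_cons.
by rewrite -(cat1s q) -(cat1s q') perm_catCA.
Qed.

End Divisibility.

Section PolyFactorization.
Variable R : idomainType.
Hypothesis facR : has_prime_factorizations R.
Implicit Types f g h : {poly R}.

Lemma divides_polyC (c : R) f :
  divides c%:P f <-> forall i, divides c f`_i.
Proof.
split=> [[g ->] i|h]; first by exists g`_i; rewrite coefMC.
elim/poly_ind: f h => [|f a IH] h; first exact: divides0.
have /IH[g ->] : forall i, divides c f`_i.
  by move=> i; have := h i.+1; rewrite coefD coefMX coefC addr0.
have := h 0%N; rewrite coefD coefMX coefC add0r => -[b ->].
by exists (g * 'X + b%:P); rewrite mulrDl mulrAC polyCM.
Qed.

(** Gauss's lemma. Since [c] divides the product of the two constant terms, it divides one of them;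
    that term is subtracted and a factor ['X] removed. *)
Lemma prime_polyC (c : R) : prime_elt c -> prime_elt c%:P.
Proof.
case=> c0 cnu cP; split; rewrite ?polyC_eq0 //.
  apply: contra cnu; rewrite poly_unitE coefC => /andP[_].
  by rewrite eqxx.
move=> f g.
elim/poly_ind: f g => [|f a IHf] g; first by move=> _; left; exact: divides0.
elim/poly_ind: g => [|g b IHg]; first by move=> _; right; exact: divides0.
move=> /divides_polyC hfg.
have h0 := hfg 0%N; rewrite coef0M !coefD !coefMX !coefC !add0r in h0.
have /divides_polyC {}hfg := hfg.
have caseC (x : R) : divides c x -> divides c%:P x%:P.
  by case=> d ->; exists d%:P; rewrite polyCM.
have delX (h : {poly R}) : divides c%:P (h * 'X) -> divides c%:P h.
  move=> /divides_polyC hh; apply/divides_polyC => i.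
  by have := hh i.+1; rewrite coefMX.
have [ha|hb] := cP _ _ h0.
  have : divides c%:P (f * (g * 'X + b%:P)).
    apply: delX; have -> : f * (g * 'X + b%:P) * 'X =
      (f * 'X + a%:P) * (g * 'X + b%:P) - a%:P * (g * 'X + b%:P).
      by rewrite -mulrBl addrK -!mulrA [_ * 'X]mulrC.
    by apply: dividesB => //; apply/divides_mulr/caseC.
  case/IHf=> h; [left|by right].
  by apply: dividesD; [exact: divides_mulr | exact: caseC].
have : divides c%:P ((f * 'X + a%:P) * g).
  apply: delX; have -> : (f * 'X + a%:P) * g * 'X =
      (f * 'X + a%:P) * (g * 'X + b%:P) - (f * 'X + a%:P) * b%:P.
      by rewrite -mulrBr addrK mulrA.
  by apply: dividesB => //; apply/divides_mull/caseC.
case/IHg=> h; [by left|right].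
by apply: dividesD; [exact: divides_mulr | exact: caseC].
Qed.

Definition primitive f := forall c : R, prime_elt c -> ~ divides c%:P f.

(** A prime constant taken out of [f] is also taken out of its leading coefficient, whose number of
    prime factors is the induction measure. *)
Lemma content_decomposition f : f != 0 -> exists (s : seq R) g,
  [/\ {in s, forall p, prime_elt p}, primitive g & f = (\prod_(p <- s) p)%:P * g].
Proof.
move=> f0; have l0 : lead_coef f != 0 by rewrite lead_coef_eq0.
have [u [s [uu hs hl]]] := facR l0.
move: {2}(size s) (leqnn (size s)) => n; elim: n f u s f0 l0 uu hs hl => [|n IHn] f u s f0 l0 uu hs hl hn.
  exists [::], f; rewrite big_nil mul1r; split=> // c pc /divides_polyC /(_ (size f).-1).
  rewrite -/(lead_coef f) hl; move: hn; rewrite leqn0 => /nilP ->; rewrite big_nil mulr1.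
  by case: (pc) => _ cnu _ [d hd]; move: uu; rewrite hd unitrM (negbTE cnu) andbF.
have [pf|/existsNP[c /not_implyP[pc /contrapT [g hg]]]] := EM (primitive f).
  by exists [::], f; rewrite big_nil mul1r.
have g0 : g != 0 by apply: contraNneq f0 => g0; rewrite hg g0 mul0r.
have lg : lead_coef f = lead_coef g * c by rewrite hg lead_coefM lead_coefC.
have [|q [t [v [h1 h2 h3]]]] := prime_divides_prod pc uu hs.
  by rewrite -hl lg; exists (lead_coef g).
have c0 : c != 0 by case: pc.
have [|||||t' [k [k1 k2 k3]]] := IHn g (u * v) t g0; rewrite ?lead_coef_eq0 ?unitrM ?uu ?h2 //.
- by move=> x xt; apply: hs; rewrite (perm_mem h1) inE xt orbT.
- apply: (mulIf c0); rewrite -lg hl (perm_big _ h1) big_cons /= h3.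
  by rewrite -!mulrA; congr (_ * (_ * _)); rewrite mulrC.
- by move: hn; rewrite (perm_size h1).
exists (c :: t'), k; split=> //.
- by move=> x; rewrite inE => /predU1P[-> //|/k1].
- by rewrite big_cons hg k3 polyCM mulrC mulrA.
Qed.

(** The primes of [c] are cancelled one by one from [g] or from [h], since they stay prime as
    constant polynomials. A factorization up to constants becomes a genuine one, with the same
    degrees. *)
Lemma primitive_clear_denom c f g h : c != 0 -> primitive f ->
    c%:P * f = g * h -> exists g' h',
  [/\ f = g' * h', size g' = size g & size h' = size h].
Proof.
move=> c0 pf; have [u [s [uu hs ->]]] := facR c0.
elim: s hs g h => [|q s IHs] hs g h.
  rewrite big_nil mulr1 => e; exists (u^-1 *: g), h; split=> //.
    by rewrite -scalerAl -e mul_polyC scalerA mulVr // scale1r.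
  by rewrite size_scale // invr_eq0; apply: contraTneq uu => ->; rewrite unitr0.
have pq : prime_elt q by apply: hs; rewrite mem_head.
have q0 : q%:P != 0 by rewrite polyC_eq0; case: pq.
rewrite big_cons mulrCA polyCM -mulrA => e.
have {}IHs := IHs (fun x xs => hs x (mem_behead (s := q :: s) xs)).
have : divides q%:P (g * h) by exists ((u * \prod_(p <- s) p)%:P * f); rewrite -e mulrC.
have sq (k : {poly R}) : size (k * q%:P) = size k.
  by rewrite mulrC mul_polyC size_scale //; case: pq.
case: (prime_polyC pq) => _ _ /[apply] -[[k hk]|[k hk]]; subst.
  rewrite sq; apply: IHs; apply: (mulfI q0); rewrite e; ring.
rewrite sq; apply: IHs; apply: (mulfI q0); rewrite e; ring.
Qed.

(** A prime of the denominator cannot divide the primitive [f], so it cancels from the cofactor: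
    divisibility over the fraction field descends to the ring. *)
Lemma primitive_dvdp f g : primitive f -> (1 < size f)%N -> f %| g -> divides f g.
Proof.
move=> pf f1 /Pdiv.WeakIdomain.dvdpP[[c k]] /= c0.
rewrite -mul_polyC; have [u [s [uu hs ->]]] := facR c0.
elim: s hs k => [|q s IHs] hs k.
  rewrite big_nil mulr1 => e; exists (u^-1 *: k).
  by rewrite -scalerAl -e mul_polyC scalerA mulVr // scale1r.
have pq : prime_elt q by apply: hs; rewrite mem_head.
have q0 : q%:P != 0 by rewrite polyC_eq0; case: pq.
rewrite big_cons mulrCA polyCM -mulrA => e.
have : divides q%:P (k * f) by exists ((u * \prod_(p <- s) p)%:P * g); rewrite -e mulrC.
case: (prime_polyC pq) => _ _ /[apply] -[[l hl]|]; last by move=> /(pf _ pq).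
apply: (IHs (fun x xs => hs x (mem_behead (s := q :: s) xs)) l).
by apply: (mulfI q0); rewrite e hl; ring.
Qed.

(** Once the content is split off, a primitive [g] either splits into factors of smaller degree or
    is prime. In the latter case its gcd with [a] is constant, and [g] divides [b], or it is [g] up
    to constants, and [g] divides [a]. *)
Lemma poly_prime_factorizations : has_prime_factorizations {poly R}.
Proof.
move=> f; move: {2}(size f) (leqnn (size f)) => n.
elim: n f => [|n IHn] f hn f0; first by move: hn; rewrite leqn0 size_poly_eq0 (negbTE f0).
have [s [g [hs pg fE]]] := content_decomposition f0.
have g0 : g != 0 by apply: contraNneq f0 => g0; rewrite fE g0 mulr0.
have pi0 : \prod_(p <- s) p != 0.
  by apply: contraNneq f0 => h; rewrite fE h polyC0 mul0r.
have sg : size g = size f by rewrite fE mul_polyC size_scale.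
suff [u [t [uu ht gE]]] : exists u (t : seq {poly R}),
    [/\ u \is a GRing.unit, {in t, forall p, prime_elt p} & g = u * \prod_(p <- t) p].
  exists u, ([seq p%:P | p <- s] ++ t); split=> //.
    by move=> x; rewrite mem_cat => /orP[/mapP[y /hs ys ->]|/ht //]; exact: prime_polyC.
  by rewrite big_cat /= big_map fE gE mulrCA; congr (_ * (_ * _)); rewrite rmorph_prod.
have [sg1|sg1] := leqP (size g) 1.
  have := size1_polyC sg1; set c := g`_0 => gc; have c0 : c != 0.
    by rewrite -polyC_eq0 -gc.
  have [u [[|q t] [uu ht cE]]] := facR c0.
    exists u%:P, [::]; split=> //.
      by rewrite poly_unitE size_polyC coefC uu andbT (contraTneq _ uu) // => ->; rewrite unitr0.
    by rewrite big_nil mulr1 gc cE big_nil mulr1.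
  (* A primitive constant has no prime factor, so it is a unit. *)
  exfalso; apply: (pg q); first by apply: ht; rewrite mem_head.
  by exists (u * \prod_(p <- t) p)%:P; rewrite -polyCM gc cE big_cons; congr _%:P; ring.
have [[g1 [g2 [gE h1 h2]]]|irr] := EM (exists g1 g2, [/\ g = g1 * g2, (1 < size g1)%N & (1 < size g2)%N]).
  have g10 : g1 != 0 by rewrite -size_poly_gt0 ltnW.
  have g20 : g2 != 0 by rewrite -size_poly_gt0 ltnW.
  have sz : size g = (size g1 + size g2).-1 by rewrite gE size_mul.
  have [||u1 [t1 [uu1 ht1 e1]]] := IHn g1 => //; first by move: hn sz; rewrite sg; lia.
  have [||u2 [t2 [uu2 ht2 e2]]] := IHn g2 => //; first by move: hn sz; rewrite sg; lia.
  exists (u1 * u2), (t1 ++ t2); split; first by rewrite unitrM uu1.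
    by move=> x; rewrite mem_cat => /orP[/ht1|/ht2].
  by rewrite big_cat gE {1}e1 {1}e2 /= mulrACA.
exists 1, [:: g]; rewrite unitr1; split=> //; last by rewrite mul1r big_seq1.
move=> x; rewrite inE => /eqP ->; split=> //.
  by rewrite poly_unitE; apply: contraTN sg1 => /andP[/eqP ->].
move=> a b hab.
have : gcdp g a %| g by apply: dvdp_gcdl.
move=> /Pdiv.WeakIdomain.dvdpP[[c k]] /= c0; rewrite -mul_polyC => e.
have [g' [h' [e1 e2 e3]]] := primitive_clear_denom c0 pg e.
have gcd0 : gcdp g a != 0 by rewrite gcdp_eq0 (negbTE g0).
have [d1|d1] := leqP (size (gcdp g a)) 1.
  right; apply: primitive_dvdp => //.
  rewrite -(@Gauss_dvdpr _ _ a); last first.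
    by rewrite coprimep_def eqn_leq d1 size_poly_gt0.
  by case: hab => l ->; rewrite dvdp_mull.
left; apply: primitive_dvdp => //.
apply: dvdp_trans (dvdp_gcdr g a).
apply/Pdiv.WeakIdomain.dvdpP.
have k0 : k != 0.
  by apply: contraNneq g0 => k0; move/eqP: e; rewrite k0 mul0r mulf_eq0 polyC_eq0 (negbTE c0).
have k1 : size k = 1%N.
  apply/eqP; rewrite eqn_leq size_poly_gt0 k0 andbT leqNgt; apply/negP => k1.
  by apply: irr; exists g', h'; rewrite e2 e3.
have [l l0 kl] : exists2 l, l != 0 & k = l%:P by apply/size_poly1P; rewrite k1.
by exists (l, c%:P) => //=; rewrite e kl mul_polyC.
Qed.

End PolyFactorization.

Lemma field_prime_factorizations (K : fieldType) : has_prime_factorizations K.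
Proof. by move=> a a0; exists a, [::]; rewrite unitfE big_nil mulr1. Qed.

(** * Lines and surfaces in three-space *)

Section Subst3.
Variables (K : fieldType) (B : comNzRingType) (i : {rmorphism {poly K} -> B}).
Variables (z t : B).

Definition subst3 (Q : {poly {poly {poly K}}}) : B :=
  (map_poly (fun q : {poly {poly K}} => (map_poly i q).[z]) Q).[t].

HB.instance Definition _ := GRing.RMorphism.copy subst3
  (horner_eval t \o map_poly (horner_eval z \o map_poly i)).

Lemma subst3C c : subst3 c%:P = (map_poly i c).[z].
Proof. by rewrite /subst3 (map_polyC (horner_eval z \o map_poly i)) /= hornerC. Qed.

Lemma subst3CC c : subst3 c%:P%:P = i c.
Proof. by rewrite subst3C map_polyC hornerC. Qed.

Lemma subst3_z : subst3 'X%:P = z.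
Proof. by rewrite subst3C map_polyX hornerX. Qed.

Lemma subst3_t : subst3 'X = t.
Proof. by rewrite /subst3 (map_polyX (horner_eval z \o map_poly i)) hornerX. Qed.

(** Restrictions to lines, evaluations at points and expansions along a direction are all instances
    of [subst3]; this uniqueness identifies their composites. *)
Lemma subst3_uniq (f : {rmorphism {poly {poly {poly K}}} -> B}) :
  (forall c, f c%:P%:P = i c) -> f 'X%:P = z -> f 'X = t -> f =1 subst3.
Proof.
move=> fc fz ft Q; elim/poly_ind: Q => [|Q q IHQ]; first by rewrite !rmorph0.
rewrite !rmorphD !rmorphM /= {}IHQ ft subst3_t; congr (_ + _).
elim/poly_ind: q => [|q c IHq]; first by rewrite !rmorph0.
by rewrite polyCD polyCM !rmorphD !rmorphM /= {}IHq fz subst3_z fc subst3CC.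
Qed.

(** The chain rule: [map_poly (@deriv _)] is the partial derivative in the middle variable, and the
    innermost variable is constant for [d]. *)
Lemma subst3_derivation (d : {additive B -> B}) :
    (forall x y, d (x * y) = d x * y + x * d y) -> (forall c, d (i c) = 0) ->
  forall Q, d (subst3 Q) =
    subst3 Q^`() * d t + subst3 (map_poly (@deriv _) Q) * d z.
Proof.
move=> dM dc.
have dz (q : {poly {poly K}}) : d (subst3 q%:P) = subst3 q^`()%:P * d z.
  elim/poly_ind: q => [|q c IHq]; first by rewrite deriv0 !rmorph0 raddf0 mul0r.
  rewrite derivD derivM derivX derivC addr0 mulr1.
  rewrite !polyCD !polyCM !rmorphD !rmorphM /= raddfD dM IHq subst3_z subst3CC dc.
  ring.
elim/poly_ind => [|Q q IHQ]; first by rewrite deriv0 map_poly0 !rmorph0 raddf0 !mul0r addr0.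
have -> : map_poly (@deriv {poly K}) (Q * 'X + q%:P) =
    map_poly (@deriv _) Q * 'X + q^`()%:P.
  apply/polyP => -[|k]; rewrite !(coef_map_id0 _ _ (raddf0 _)) ?deriv0 //;
    rewrite !coefD !coefMX !coefC /= ?(coef_map_id0 _ _ (raddf0 _)) ?deriv0 ?add0r ?addr0 //.
rewrite derivD derivM derivX derivC addr0 mulr1.
rewrite !rmorphD !rmorphM /= subst3_t raddfD dM IHQ dz.
ring.
Qed.

End Subst3.

Lemma subst3_polyX (K : fieldType) (S : comNzRingType) (f : {rmorphism {poly K} -> S}) T Q :
  subst3 (polyC \o f) 'X T Q = (map_poly (map_poly f) Q).[T].
Proof.
rewrite /subst3; congr _.[_]; apply: eq_map_poly => r.
by rewrite (map_poly_comp (polyC : S -> {poly S})) -/(comp_poly 'X _) comp_polyXr.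
Qed.

Section Degrees.
Variable K : fieldType.
Local Notation P := {poly {poly {poly K}}}.
Implicit Types Q F : P.

Definition swap_y (Q : P) : P := swapXY (map_poly swapXY Q).

HB.instance Definition _ := GRing.RMorphism.copy swap_y (swapXY \o map_poly swapXY).

Lemma coef_swap_y Q k j l : (swap_y Q)`_l`_k`_j = Q`_k`_j`_l.
Proof. by rewrite /swap_y coef_swapXY coef_map /= coef_swapXY. Qed.

Lemma swap_y_eq0 Q : (swap_y Q == 0) = (Q == 0).
Proof.
apply/eqP/eqP => [h|->]; last by rewrite rmorph0.
apply/polyP => k; apply/polyP => j; apply/polyP => l.
by rewrite -coef_swap_y h !coef0.
Qed.

(** Bounding each partial degree separately is inherited by factors, behaves well under products,
    derivatives and resultants, and leaves [e.+1 ^ 3] free coefficients for interpolation. *)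
Definition box e Q := [&& size Q <= e.+1, size (swapXY Q) <= e.+1
                        & size (swap_y Q) <= e.+1]%N.

Lemma boxP e Q : reflect (forall k j l, (e < maxn k (maxn j l))%N -> Q`_k`_j`_l = 0)
  (box e Q).
Proof.
apply: (iffP and3P) => [[h1 h2 h3] k j l|h].
  rewrite !leq_max => /or3P[hk|hj|hl].
  - by rewrite [Q`_k]nth_default ?coef0 // (leq_trans h1).
  - by rewrite -[Q`_k`_j]coef_swapXY [(swapXY Q)`_j]nth_default ?coef0 // (leq_trans h2).
  by rewrite -coef_swap_y [(swap_y Q)`_l]nth_default ?coef0 // (leq_trans h3).
split; apply/leq_sizeP => n hn; apply/polyP => i; apply/polyP => j; rewrite !coef0.
- by apply: h; rewrite leq_max hn.
- by rewrite coef_swapXY; apply: h; rewrite !leq_max hn orbT.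
by rewrite coef_swap_y; apply: h; rewrite !leq_max hn !orbT.
Qed.

Lemma boxD e Q F : box e Q -> box e F -> box e (Q + F).
Proof. by move=> /boxP hQ /boxP hF; apply/boxP => k j l h; rewrite !coefD hQ ?hF ?addr0. Qed.

Lemma boxN e Q : box e Q -> box e (- Q).
Proof. by move=> /boxP hQ; apply/boxP => k j l h; rewrite !coefN hQ ?oppr0. Qed.

Lemma boxMn e Q n : box e Q -> box e (Q *+ n).
Proof. by move=> /boxP hQ; apply/boxP => k j l h; rewrite !coefMn hQ ?mul0rn. Qed.

Lemma boxM e f Q F : box e Q -> box f F -> box (e + f) (Q * F).
Proof.
have szM (A : nzRingType) (p q : {poly A}) : (size p <= e.+1 -> size q <= f.+1 ->
    size (p * q)%R <= (e + f).+1)%N.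
  move=> hp hq; apply: leq_trans (size_polyMleq _ _) _.
  by move: (leq_add hp hq); rewrite addSn addnS; case: (_ + _)%N.
move=> /and3P[h1 h2 h3] /and3P[k1 k2 k3].
by apply/and3P; rewrite !rmorphM /=; split; apply: szM.
Qed.

Lemma box_deriv e Q : box e Q -> box e Q^`().
Proof.
move=> /boxP h; apply/boxP => k j l hh; rewrite coef_deriv !coefMn h ?mul0rn //.
by move: hh; lia.
Qed.

Lemma coef_dz Q k : (map_poly (@deriv {poly K}) Q)`_k = (Q`_k)^`().
Proof. by rewrite coef_map_id0 ?deriv0. Qed.

Lemma box_dz e Q : box e Q -> box e (map_poly (@deriv {poly K}) Q).
Proof.
move=> /boxP h; apply/boxP => k j l hh; rewrite coef_dz coef_deriv !coefMn h ?mul0rn //.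
by move: hh; lia.
Qed.

(** The sum of the partial degrees bounds the degree of the restriction to any red or blue line. It
    is additive on products, so it can be shared out among prime factors. *)
Definition deg3 Q := ((size Q).-1 + (size (swapXY Q)).-1 + (size (swap_y Q)).-1)%N.

Lemma deg3M Q F : Q != 0 -> F != 0 -> deg3 (Q * F) = (deg3 Q + deg3 F)%N.
Proof.
move=> Q0 F0.
have szM (A : idomainType) (p q : {poly A}) : p != 0 -> q != 0 ->
    (size (p * q)).-1 = ((size p).-1 + (size q).-1)%N.
  move=> p0 q0; rewrite size_mul //.
  by move: p0 q0; rewrite -!size_poly_gt0; lia.
rewrite /deg3 !rmorphM /= !szM ?swap_y_eq0 ?swapXY_eq0 //.
by move: (_.-1) (_.-1) (_.-1) (_.-1) (_.-1) (_.-1) => *; lia.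
Qed.

Lemma deg3_box e Q : box e Q -> (deg3 Q <= 3 * e)%N.
Proof.
case/and3P; rewrite /deg3 -![(_ <= e.+1)%N]ltnS; move: (size _) (size _) (size _) => a b c.
lia.
Qed.

Lemma box_divides e Q F : divides Q F -> F != 0 -> box e F -> box e Q.
Proof.
move=> [G ->]; rewrite mulf_eq0 => /norP[G0 Q0] /and3P.
have szM (A : idomainType) (p q : {poly A}) : p != 0 -> q != 0 ->
    (size (p * q)%R <= e.+1 -> size q <= e.+1)%N.
  by move=> p0 q0; apply: leq_trans; rewrite size_mul //; move: p0 q0; rewrite -!size_poly_gt0; lia.
rewrite !rmorphM /= => -[h1 h2 h3].
by apply/and3P; split; [apply: szM h1|apply: szM h2|apply: szM h3];
  rewrite ?swap_y_eq0 ?swapXY_eq0.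
Qed.

Lemma size_horner_le (A : nzRingType) (U : {poly {poly A}}) (l : {poly A}) n :
  (forall k, (size (U`_k)%R <= n)%N) -> (size l <= 2)%N ->
  (size (U.[l])%R <= n + (size U).-1)%N.
Proof.
move=> hU hl; rewrite horner_coef; apply: leq_trans (size_sum _ _ _) _.
apply/bigmax_leqP => k _; apply: leq_trans (size_polyMleq _ _) _.
have h1 : (size (l ^+ k) <= k.+1)%N.
  apply: leq_trans (size_poly_exp_leq _ _) _.
  by rewrite ltnS -[leqRHS]mul1n leq_mul2r -subn1 leq_subLR hl orbT.
apply: leq_trans (_ : _ <= (n + k.+1).-1)%N _.
  by rewrite -!subn1 leq_sub2r // leq_add.
by rewrite addnS leq_add2l -ltnS (leq_trans (ltn_ord k)) ?leqSpred.
Qed.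

End Degrees.

Lemma size_mul_gt (A : idomainType) (p q : {poly A}) :
  p != 0 -> (1 < size q)%N -> (size p < size (p * q)%R)%N.
Proof.
move=> p0 q1; have q0 : q != 0 by rewrite -size_poly_gt0 ltnW.
by rewrite size_mul //; move: p0 q1; rewrite -size_poly_gt0; lia.
Qed.

Section Lines.
Variable K : fieldType.
Local Notation P := {poly {poly {poly K}}}.
Implicit Types (Q F : P) (W : {poly {poly K}}).

(* Variables: t outermost, then z, then y.  A red line is
   {y = be, t = a + b z}, a blue one is {z = de, t = c + e y}. *)
Definition red_res (be a b : K) : P -> {poly K} :=
  subst3 (polyC \o horner_eval be) 'X (a%:P + b%:P * 'X).

Definition blue_res (de c e : K) : P -> {poly K} :=
  subst3 idfun de%:P (c%:P + e%:P * 'X).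

HB.instance Definition _ be a b := GRing.RMorphism.copy (red_res be a b)
  (subst3 (polyC \o horner_eval be) 'X (a%:P + b%:P * 'X)).
HB.instance Definition _ de c e := GRing.RMorphism.copy (blue_res de c e)
  (subst3 idfun de%:P (c%:P + e%:P * 'X)).

Lemma size_line (a b : K) : (size (a%:P + b%:P * 'X)%R <= 2)%N.
Proof.
rewrite addrC mul_polyC; apply: leq_trans (size_polyD _ _) _.
rewrite geq_max; apply/andP; split; last exact: leq_trans (size_polyC_leq1 _) _.
by apply: leq_trans (size_scale_leq _ _) _; rewrite size_polyX.
Qed.

Lemma size_red_res be a b Q : (size (red_res be a b Q) <= (deg3 Q).+1)%N.
Proof.
have [->|Q0] := eqVneq Q 0; first by rewrite rmorph0 size_poly0.
rewrite /red_res /subst3.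
set U := map_poly _ _; have UE k : U`_k = map_poly (horner_eval be) Q`_k.
  rewrite coef_map_id0 ?map_poly0 ?horner0 //.
  by rewrite (map_poly_comp (polyC : K -> {poly K})) /= -/(comp_poly 'X _) comp_polyXr.
apply: leq_trans (_ : _ <= size (swapXY Q) + (size U).-1)%N _.
  apply: size_horner_le (size_line a b) => k; rewrite UE.
  by apply: leq_trans (size_poly _ _) _; rewrite -sizeYE max_size_coefXY.
have : (size U <= size Q)%N by exact: size_poly.
have : (0 < size (swapXY Q))%N by rewrite size_poly_gt0 swapXY_eq0.
by rewrite /deg3; lia.
Qed.

Lemma size_blue_res de c e Q : (size (blue_res de c e Q) <= (deg3 Q).+1)%N.
Proof.
have [->|Q0] := eqVneq Q 0; first by rewrite rmorph0 size_poly0.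
rewrite /blue_res /subst3.
set U := map_poly _ _; have UE k : U`_k = (Q`_k).[de%:P].
  by rewrite coef_map_id0 ?map_poly0 ?horner0 // map_poly_id.
apply: leq_trans (_ : _ <= size (swap_y Q) + (size U).-1)%N _.
  apply: size_horner_le (size_line c e) => k; rewrite UE.
  apply: leq_trans (max_size_evalC _ _) _; apply/bigmax_leqP => j _.
  apply/leq_sizeP => l hl; rewrite -coef_swap_y [(swap_y Q)`_l]nth_default //.
  by rewrite !coef0.
have : (size U <= size Q)%N by exact: size_poly.
have : (0 < size (swap_y Q))%N by rewrite size_poly_gt0 swap_y_eq0.
by rewrite /deg3; lia.
Qed.

(** Both sides are the value of [Q] at the common point of the two lines. *)
Lemma red_blue_meet be a b de c e Q : a + b * de = c + e * be ->
  (red_res be a b Q).[de] = (blue_res de c e Q).[be].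
Proof.
move=> h.
have := subst3_uniq (i := horner_eval be) (z := de) (t := a + b * de)
  (f := horner_eval de \o red_res be a b).
have := subst3_uniq (i := horner_eval be) (z := de) (t := a + b * de)
  (f := horner_eval be \o blue_res de c e).
move=> h1 h2.
have -> : (red_res be a b Q).[de] = subst3 (horner_eval be) de (a + b * de) Q.
  apply: h2 => [p||] /=; rewrite /red_res /horner_eval.
  - by rewrite subst3CC /= hornerC.
  - by rewrite subst3_z hornerX.
  by rewrite subst3_t !hornerE.
symmetry; apply: h1 => [p||] /=; rewrite /blue_res /horner_eval.
- by rewrite subst3CC.
- by rewrite subst3_z hornerC.
by rewrite subst3_t !hornerE h.
Qed.

Lemma poly_many_roots (A : idomainType) (I : finType) (S : {set I}) (f : I -> A) (p : {poly A}) :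
  {in S &, injective f} -> {in S, forall i, root p (f i)} ->
  (size p <= #|S|)%N -> p = 0.
Proof.
move=> fi fr hp; apply: (@roots_geq_poly_eq0 _ _ [seq f i | i <- enum S]).
- by apply/allP => x /mapP[i]; rewrite mem_enum => /fr ? ->.
- by rewrite map_inj_in_uniq ?enum_uniq // => i j; rewrite !mem_enum; apply: fi.
by rewrite size_map -cardE.
Qed.

Lemma red_res_polyC be a b W : red_res be a b W%:P = map_poly (horner_eval be) W.
Proof.
by rewrite /red_res subst3C (map_poly_comp (polyC : K -> {poly K})) /= -/(comp_poly 'X _) comp_polyXr.
Qed.

Lemma blue_res_polyC de c e W : blue_res de c e W%:P = W.[de%:P].
Proof. by rewrite /blue_res subst3C map_poly_id. Qed.

Section Families.
Variables (I J : finType) (be a b : I -> K) (de c e : J -> K).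
Hypotheses (be_inj : injective be) (de_inj : injective de).
Variables (I1 : {set I}) (J1 : {set J}).

Definition vanishes Q := {in I1, forall i, red_res (be i) (a i) (b i) Q = 0} /\
                         {in J1, forall j, blue_res (de j) (c j) (e j) Q = 0}.

(** A surface not involving [t] that contains a red line contains its whole plane [y = be i], and
    these planes are distinct; likewise for blue lines. *)
Lemma vanishes_polyC d W : vanishes W%:P -> W != 0 -> box d W%:P ->
  (#|I1| <= d)%N /\ (#|J1| <= d)%N.
Proof.
move=> [h1 h2] W0 /boxP hb.
have dW k l : (d < maxn k l)%N -> W`_k`_l = 0.
  by move=> h; have := hb 0%N k l; rewrite coefC; apply; rewrite max0n.
split; rewrite leqNgt; apply: contra W0 => hd; apply/eqP.
  apply/eqP; rewrite -swapXY_eq0; apply/eqP.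
  apply: (@poly_many_roots _ _ I1 (fun i => (be i)%:P)).
  - by move=> i j _ _ /polyC_inj /be_inj.
  - move=> i iI; rewrite /root horner_swapXY; apply/eqP.
    by have := h1 i iI; rewrite red_res_polyC.
  apply: leq_trans hd; apply/leq_sizeP => l hl; apply/polyP => k.
  by rewrite coef_swapXY dW ?coef0 // leq_max hl orbT.
apply: (@poly_many_roots _ _ J1 (fun j => (de j)%:P)).
- by move=> i j _ _ /polyC_inj /de_inj.
- by move=> j jJ; rewrite /root; have := h2 j jJ; rewrite blue_res_polyC => ->.
apply: leq_trans hd; apply/leq_sizeP => l hl; apply/polyP => k.
by rewrite dW ?coef0 // leq_max hl.
Qed.

Lemma size_det (A : comNzRingType) n d (M : 'M[{poly A}]_n) :
  (forall i j, (size (M i j) <= d.+1)%N) -> (size (\det M) <= (n * d).+1)%N.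
Proof.
move=> hM; apply: leq_trans (size_sum _ _ _) _; apply/bigmax_leqP => s _.
rewrite -signr_odd; have sgn (x : {poly A}) (bb : bool) : size ((-1) ^+ bb * x)%R = size x.
  by case: bb; rewrite ?expr1 ?expr0 ?mulN1r ?mul1r ?size_polyN.
rewrite sgn; apply: leq_trans (size_poly_prod_leq _ _) _.
rewrite card_ord; have : (\sum_(i < n) size (M i (s i)) <= n * d.+1)%N.
  rewrite -[n in (n * _)%N]card_ord -sum_nat_const; exact: leq_sum.
by rewrite mulnS => h; rewrite leq_subLR addnS ltnS; apply: h.
Qed.

(** The Sylvester matrix has order at most [d + f], and its entries have degree at most [maxn d f]
    in each of [z] and [y]. *)
Lemma box_resultant d f Q F : box d Q -> box f F ->
  box ((d + f) * maxn d f) (resultant Q F)%:P.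
Proof.
move=> /boxP hQ /boxP hF.
set W := resultant Q F; set D := maxn d f.
have hN : (((size F).-1 + (size Q).-1) * D <= (d + f) * D)%N.
  rewrite leq_mul2r; apply/orP; right; rewrite addnC; apply: leq_add.
    rewrite -subn1 leq_subLR add1n; apply/leq_sizeP => k hk; apply/polyP => j; apply/polyP => l.
    by rewrite hQ ?coef0 // leq_max hk.
  rewrite -subn1 leq_subLR add1n; apply/leq_sizeP => k hk; apply/polyP => j; apply/polyP => l.
  by rewrite hF ?coef0 // leq_max hk.
have coefS i j k l : (D < maxn k l)%N -> (Sylvester_mx Q F i j)`_k`_l = 0.
  rewrite /D gtn_max => /andP[hd hf]; rewrite Sylvester_mxE /=.
  by case: split => i'; rewrite coefMn coefMn ?hQ ?hF ?mul0rn // leq_max ?hd ?hf orbT.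
have hz : (size W <= ((d + f) * D).+1)%N.
  apply: leq_trans (_ : _ <= (((size F).-1 + (size Q).-1) * D).+1)%N _ => //.
  apply: size_det => i j; apply/leq_sizeP => k hk; apply/polyP => l.
  by rewrite coef0 coefS // leq_max hk.
have hy : (size (swapXY W) <= ((d + f) * D).+1)%N.
  apply: leq_trans (_ : _ <= (((size F).-1 + (size Q).-1) * D).+1)%N _ => //.
  rewrite /W /resultant -det_map_mx; apply: size_det => i j; rewrite mxE.
  apply/leq_sizeP => k hk; apply/polyP => l.
  by rewrite coef0 coef_swapXY coefS // leq_max hk orbT.
apply/boxP => k j l; case: k => [|k]; last by rewrite coefC !coef0.
rewrite max0n coefC /= leq_max => /orP[h|h].
  by rewrite [W`_j]nth_default ?coef0 // (leq_trans hz).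
by rewrite -[W`_j`_l]coef_swapXY [(swapXY W)`_l]nth_default ?coef0 // (leq_trans hy).
Qed.

(** The resultant in [t] is a combination of [Q] and [F], so it vanishes on the lines common to both
    surfaces. It is nonzero and free of [t], hence contains few lines. *)
Lemma vanishes_coprime d f Q F : vanishes Q -> vanishes F -> coprimep Q F ->
  Q != 0 -> F != 0 -> box d Q -> box f F ->
  (#|I1| <= (d + f) * maxn d f)%N /\ (#|J1| <= (d + f) * maxn d f)%N.
Proof.
move=> vQ vF cop Q0 F0 bQ bF.
have le1 (x : nat) : (x <= d -> x <= (d + f) * maxn d f)%N.
  by move: (maxn _ _) (leq_maxl d f) (leq_maxr d f) => m; nia.
have le2 (x : nat) : (x <= f -> x <= (d + f) * maxn d f)%N.
  by move: (maxn _ _) (leq_maxl d f) (leq_maxr d f) => m; nia.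
(* The resultant lies in the ideal when both degrees in [t] are positive; otherwise [Q] or [F] is
   itself free of [t]. *)
have [Q1|Q1] := leqP (size Q) 1.
  move: vQ Q0 bQ; rewrite (size1_polyC Q1) polyC_eq0 => /vanishes_polyC h /h {}h /h[h1 h2].
  by split; apply: le1.
have [F1|F1] := leqP (size F) 1.
  move: vF F0 bF; rewrite (size1_polyC F1) polyC_eq0 => /vanishes_polyC h /h {}h /h[h1 h2].
  by split; apply: le2.
apply: vanishes_polyC (box_resultant bQ bF); last first.
  by rewrite resultant_eq0 -leqNgt leq_eqVlt -coprimep_def cop.
have [[u v] /= _ ->] := resultant_in_ideal Q1 F1.
case: vQ vF => [r1 b1] [r2 b2]; split=> i ii; rewrite rmorphD !rmorphM /=.
  by rewrite r1 // r2 // !mulr0 addr0.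
by rewrite b1 // b2 // !mulr0 addr0.
Qed.

End Families.

(** A gcd of positive degree in [t] divides [Q] up to a factor free of [t], so by primality it is a
    multiple of [Q]. Then [Q] divides [F] up to such a factor, and no nonzero polynomial free of [t]
    is a multiple of [Q]. *)
Lemma prime_coprime Q F : prime_elt Q -> (1 < size Q)%N -> ~ divides Q F -> coprimep Q F.
Proof.
move=> [Q0 Qnu QP] Q1 ndiv; rewrite coprimep_def eqn_leq size_poly_gt0 gcdp_eq0 (negbTE Q0) andbT.
rewrite leqNgt; apply/negP => g1; apply: ndiv.
have noC (k : {poly {poly K}}) : k != 0 -> ~ divides Q k%:P.
  move=> k0 [G hG].
  have G0 : G != 0 by apply: contraNneq k0 => G0; rewrite -polyC_eq0 hG G0 mul0r.
  by have := size_mul_gt G0 Q1; rewrite -hG size_polyC k0 ltnS leqn0 size_poly_eq0 (negbTE G0).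
have /Pdiv.WeakIdomain.dvdpP[[k H] /= k0] := dvdp_gcdl Q F; rewrite -mul_polyC => e.
have [|hH|[G hG]] := QP H (gcdp Q F); first by exists k%:P.
  exfalso; case: hH => G hG.
  have h0 : gcdp Q F != 0 by rewrite gcdp_eq0 (negbTE Q0).
  have k0' : k%:P != 0 :> P by rewrite polyC_eq0.
  have H0 : H != 0.
    apply: contraNneq (_ : k%:P * Q != 0) => [H0|]; first by rewrite e H0 mul0r.
    by rewrite mulf_neq0.
  have G0 : G != 0 by apply: contraNneq H0 => G0; rewrite hG G0 mul0r.
  have kG : k%:P = G * gcdp Q F.
    by apply: (mulIf Q0); rewrite e hG mulrAC.
  by have := size_mul_gt G0 g1; rewrite -kG size_polyC k0 ltnS leqn0 size_poly_eq0 (negbTE G0).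
have /Pdiv.WeakIdomain.dvdpP[[k' H'] /= k0'] := dvdp_gcdr Q F; rewrite -mul_polyC => e'.
have [|/noC|] := QP k'%:P F; first by rewrite e' hG; exists (H' * G); rewrite mulrA.
  by move=> /(_ k0').
by [].
Qed.

End Lines.

(** * Surfaces through given lines *)

Section Interpolation.
Variable K : fieldType.
Local Notation P := {poly {poly {poly K}}}.

Lemma underdetermined_system (U W : finType) (M : U -> W -> K) : (#|W| < #|U|)%N ->
  exists2 v : U -> K, (exists u, v u != 0) & forall w, \sum_u v u * M u w = 0.
Proof.
move=> hc; pose A := \matrix_(i < #|U|, j < #|W|) M (enum_val i) (enum_val j).
have : kermx A != 0.
  rewrite kermx_eq0 -row_leq_rank -ltnNge; apply: leq_ltn_trans hc; exact: rank_leq_col.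
case/rowV0Pn => x /sub_kermxP hx x0.
exists (fun u => x 0 (enum_rank u)).
  have /rV0Pn[i hi] := x0; by exists (enum_val i); rewrite enum_valK.
move=> w; have := congr1 (fun B : 'rV_(#|W|) => B 0 (enum_rank w)) hx.
rewrite !mxE => h; rewrite -[RHS]h (reindex (@enum_val U predT)) /=; last first.
  by exists enum_rank => y _; [rewrite enum_valK|rewrite enum_rankK].
by apply: eq_bigr => i _; rewrite mxE enum_valK enum_rankK.
Qed.

(** There are [d.+1 ^ 3] monomials, and containing a line imposes at most [(3 * d).+1] linear
    conditions, one for each coefficient of the restriction. *)
Lemma interpolation (I : finType) (be a b : I -> K) (S : {set I}) (d : nat) :
  (#|S| * (3 * d).+1 < d.+1 ^ 3)%N ->
  exists Q : P, [/\ Q != 0, box d Q & {in S, forall i, red_res (be i) (a i) (b i) Q = 0}].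
Proof.
move=> hc; pose U := ('I_d.+1 * 'I_d.+1 * 'I_d.+1)%type.
pose W := ({i | i \in S} * 'I_(3 * d).+1)%type.
pose mon (u : U) : P := 'X^(u.1.1) * ('X^(u.1.2) * ('X^(u.2))%:P)%:P.
pose M (u : U) (w : W) := (red_res (be (val w.1)) (a (val w.1)) (b (val w.1)) (mon u))`_(w.2).
have [|v [u0 vu0] hv] := underdetermined_system (U := U) (W := W) M.
  rewrite !card_prod !card_ord card_sig; move: hc; rewrite !expnS expn0 muln1 -mulnA.
  by rewrite (eq_card (B := mem S)).
pose Q : P := \sum_u (v u)%:P%:P%:P * mon u.
have QE k j l : Q`_k`_j`_l = \sum_u v u * ((u.1.1 == k :> nat) && (u.1.2 == j :> nat) && (u.2 == l :> nat))%:R.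
  rewrite /Q !coef_sum; apply: eq_bigr => u _.
  rewrite /mon !coefCM coefXnM; congr (_ * _).
  rewrite coefC subn_eq0; case: ltngtP => //=; rewrite ?coef0 //= coefXnM coefC subn_eq0.
  by move=> _; case: ltngtP => //=; rewrite ?coef0 //= coefXn eq_sym => _.
have bQ : box d Q.
  apply/boxP => k j l h; rewrite QE big1 // => -[[u1 u2] u3] _ /=.
  case: eqP => [e1|]; rewrite ?mulr0 //; case: eqP => [e2|]; rewrite ?mulr0 //.
  case: eqP => [e3|]; rewrite ?mulr0 //.
  by exfalso; move: h (ltn_ord u1) (ltn_ord u2) (ltn_ord u3); rewrite e1 e2 e3; lia.
exists Q; split=> //.
  apply/eqP => Q0; have := QE u0.1.1 u0.1.2 u0.2; rewrite Q0 !coef0 (bigD1 u0) //=.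
  rewrite !eqxx mulr1 big1 ?addr0 => [h|]; first by move: vu0; rewrite -h eqxx.
  move=> u /negbTE hu; case: eqP => [e1|]; rewrite ?mulr0 //; case: eqP => [e2|]; rewrite ?mulr0 //.
  case: eqP => [e3|]; rewrite ?mulr0 //; move: hu.
  move: u u0 e1 e2 e3 {vu0} => [[u1 u2] u3] [[w1 w2] w3] /= /val_inj -> /val_inj -> /val_inj ->.
  by rewrite eqxx.
move=> i iS; apply/polyP => n; rewrite coef0.
have [nd|nd] := ltnP n (3 * d).+1; last first.
  rewrite nth_default //; apply: leq_trans (size_red_res _ _ _ _) _.
  by apply: leq_trans nd; rewrite ltnS; apply: deg3_box.
rewrite -[RHS](hv (exist _ i iS, Ordinal nd)).
rewrite /Q rmorph_sum coef_sum; apply: eq_bigr => u _.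
by rewrite /M rmorphM /= /red_res subst3CC /= /horner_eval hornerC coefCM.
Qed.

End Interpolation.

Lemma map_poly_derivation (A : comNzRingType) (V : {additive A -> A}) :
    (forall x y, V (x * y) = V x * y + x * V y) ->
  forall p q : {poly A}, map_poly V (p * q) = map_poly V p * q + p * map_poly V q.
Proof.
move=> VM p q; apply/polyP => n; rewrite coefD !coefM coef_map /= coefM raddf_sum -big_split /=.
by apply: eq_bigr => i _; rewrite VM !coef_map.
Qed.

(** * Surfaces ruled in their slices *)

Section Slide.
Variables (K : fieldType) (A : comNzRingType) (i : {rmorphism {poly K} -> A}).
Local Notation P := {poly {poly {poly K}}}.
Local Notation "Q ^t" := (deriv Q) (at level 2, format "Q ^t").
Local Notation "Q ^z" := (map_poly (@deriv {poly K}) Q) (at level 2, format "Q ^z").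
Variables z t u v : A.

(* The point (t, z) is moved along the direction (- v, u). *)
Definition slide : P -> {poly A} :=
  subst3 (polyC \o i) (z%:P + u%:P * 'X) (t%:P - v%:P * 'X).

HB.instance Definition _ := GRing.RMorphism.copy slide
  (subst3 (polyC \o i) (z%:P + u%:P * 'X) (t%:P - v%:P * 'X)).

Lemma slide_deriv F : (slide F)^`() = slide F^z * u%:P - slide F^t * v%:P.
Proof.
have := @subst3_derivation _ _ (polyC \o i : {rmorphism {poly K} -> {poly A}})
  (z%:P + u%:P * 'X) (t%:P - v%:P * 'X) (@deriv _) (@derivM _) (fun c => derivC _) F.
rewrite /= derivB derivD !derivC !derivM !derivC !derivX !mul0r !add0r !mulr1 => ->.
by rewrite mulrN addrC.
Qed.

(** [V] moves the base point in the very direction of the slide, so it acts like the derivative in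
    the slide parameter, up to a change of speed and to the rotation of the direction, measured by
    [u * V v - v * V u]. *)
Lemma slide_derivation (V : {additive A -> A}) F :
    (forall x y, V (x * y) = V x * y + x * V y) -> (forall c, V (i c) = 0) ->
    V z = u -> V t = - v ->
  u%:P * map_poly V (slide F) =
  (u%:P + (V u)%:P * 'X) * (slide F)^`() - (u * V v - v * V u)%:P * 'X * slide F^t.
Proof.
move=> VM Vi Vz Vt.
have hc (c : {poly K}) : map_poly V ((polyC \o i) c : {poly A}) = 0.
  by rewrite /= map_polyC /= Vi polyC0.
have := @subst3_derivation _ _ (polyC \o i : {rmorphism {poly K} -> {poly A}})
  (z%:P + u%:P * 'X) (t%:P - v%:P * 'X) (map_poly V) (map_poly_derivation VM) hc F.
rewrite -/(slide _) -/(slide F^t) -/(slide F^z) => ->.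
have mapX (G : A) : map_poly V (G%:P * 'X) = (V G)%:P * 'X.
  apply/polyP => k; rewrite coef_map_id0 ?raddf0 // !coefMX !coefC.
  by case: k => [|[|k]] /=; rewrite ?raddf0.
rewrite !raddfD /= !raddfN /= !mapX !map_polyC /= Vz Vt slide_deriv.
ring.
Qed.

(** Where the rotation term vanishes, this is a recursion that produces each Taylor coefficient from
    the preceding one and its derivative. *)
Lemma slide_derivation_coef (V : {additive A -> A}) F k :
    (forall x y, V (x * y) = V x * y + x * V y) -> (forall c, V (i c) = 0) ->
    V z = u -> V t = - v -> exists r,
  k.+1%:R * (u * (slide F)`_k.+1) =
  u * V (slide F)`_k - V u * (k%:R * (slide F)`_k) + (u * V v - v * V u) * r.
Proof.
move=> VM Vi Vz Vt; exists ('X * slide F^t)`_k.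
have := congr1 (fun p : {poly A} => p`_k) (slide_derivation F VM Vi Vz Vt).
rewrite /= coefB mulrDl coefD -!mulrA !coefCM coef_map coef_deriv /=.
have -> : ('X * (slide F)^`())`_k = k%:R * (slide F)`_k.
  by rewrite coefXM; case: (k) => [|k'] /=; rewrite ?mul0r // coef_deriv mulr_natl.
by move=> ->; rewrite -mulr_natl; ring.
Qed.

Lemma slide0 F : (slide F)`_0 = subst3 i z t F.
Proof.
rewrite -horner_coef0.
have := @subst3_uniq K A i z t (horner_eval 0 \o slide).
move=> /(_ _ _ _ F) /= <-; rewrite ?/horner_eval //= /slide.
- by move=> c; rewrite subst3CC /= hornerC.
- by rewrite subst3_z !hornerE.
by rewrite subst3_t !hornerE ?mulr0 ?oppr0 ?subr0 ?addr0.
Qed.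

Lemma map_slide_horner (B : comNzRingType) (g : {rmorphism A -> B}) s
    (i' : {rmorphism {poly K} -> B}) z' t' F :
    (forall c, g (i c) = i' c) -> g z + g u * s = z' -> g t - g v * s = t' ->
  (map_poly g (slide F)).[s] = subst3 i' z' t' F.
Proof.
move=> gi gz gt.
have := @subst3_uniq K B i' z' t' (horner_eval s \o map_poly g \o slide).
move=> /(_ _ _ _ F) /= <-; rewrite ?/horner_eval //= /slide.
- by move=> c; rewrite subst3CC /= map_polyC hornerC; apply: gi.
- by rewrite subst3_z rmorphD rmorphM /= !map_polyC map_polyX !hornerE gz.
by rewrite subst3_t rmorphB rmorphM /= !map_polyC map_polyX !hornerE gt.
Qed.

Lemma size_slide d F : box d F -> (size (slide F) <= (2 * d).+1)%N.
Proof.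
have szl (G H : A) : (size (G%:P + H%:P * 'X)%R <= 2)%N.
  rewrite addrC mul_polyC; apply: leq_trans (size_polyD _ _) _.
  rewrite geq_max; apply/andP; split; last exact: leq_trans (size_polyC_leq1 _) _.
  by apply: leq_trans (size_scale_leq _ _) _; rewrite size_polyX.
move=> /and3P[h1 h2 _]; rewrite /slide /subst3.
set U := map_poly _ _; have UE k : U`_k = (map_poly (polyC \o i) F`_k).[z%:P + u%:P * 'X].
  by rewrite coef_map_id0 ?map_poly0 ?horner0.
have hU k : (size (U`_k)%R <= d.+1)%N.
  rewrite UE; apply: leq_trans (_ : 1 + d <= _)%N; last by rewrite add1n.
  apply: leq_trans (size_horner_le (n := 1) _ (szl _ _)) _.
    by move=> j; rewrite coef_map_id0 ?size_polyC_leq1 //= !rmorph0.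
  rewrite leq_add2l -subn1 leq_subLR add1n; apply: leq_trans (size_poly _ _) _.
  by apply: leq_trans h2; rewrite -sizeYE max_size_coefXY.
have -> : t%:P - v%:P * 'X = t%:P + (- v)%:P * 'X :> {poly A} by rewrite polyCN mulNr.
apply: leq_trans (size_horner_le hU (szl _ _)) _.
rewrite mul2n -addnn -addSn leq_add2l -subn1 leq_subLR add1n; apply: leq_trans h1.
exact: size_poly.
Qed.

End Slide.

(** * Second-order contact *)

Section Flecnodes.
Variable K : fieldType.
Local Notation P := {poly {poly {poly K}}}.
Implicit Types Q F : P.
Local Notation "Q ^t" := (deriv Q) (at level 2, format "Q ^t").
Local Notation "Q ^z" := (map_poly (@deriv {poly K}) Q) (at level 2, format "Q ^z").

Lemma dzt Q : Q^t^z = Q^z^t.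
Proof.
by apply/polyP => k; rewrite coef_dz !coef_deriv coef_dz derivMn.
Qed.

(* Second-order contact of the surface Q = 0 with the direction
   (dt, dz) = (- Q_z, Q_t) in its slices y = const. *)
Definition flec Q : P :=
  Q^t^t * Q^z ^+ 2 - (Q^t * Q^z * Q^t^z) *+ 2 + Q^t ^+ 2 * Q^z^z.

Lemma box_flec d Q : box d Q -> box (3 * d) (flec Q).
Proof.
move=> h; have h3 : (3 * d = d + (d + d))%N by lia.
have ht := box_deriv h; have hz := box_dz h.
rewrite /flec h3; apply: boxD; first apply: boxD.
- by rewrite expr2; apply: boxM; [exact: box_deriv|exact: boxM].
- by apply/boxN/boxMn; rewrite -mulrA; apply: boxM => //; apply: boxM => //; exact: box_dz.
by rewrite mulrC expr2; apply: boxM; [exact: box_dz|exact: boxM].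
Qed.

Lemma red_res_deriv be a b Q : (red_res be a b Q)^`() =
  red_res be a b Q^t * b%:P + red_res be a b Q^z.
Proof.
have := @subst3_derivation _ _ (polyC \o horner_eval be : {rmorphism {poly K} -> {poly K}}) 'X
  (a%:P + b%:P * 'X) (@deriv K) (@derivM _) (fun c => derivC _) Q.
by rewrite /= derivX mulr1 derivD derivC add0r derivM derivC mul0r add0r derivX mulr1.
Qed.

(** Differentiating twice along the line gives [Q_z = - b Q_t] and expresses [Q_zz] through [Q_tt]
    and [Q_tz]; the contact polynomial then cancels identically. *)
Lemma flec_red be a b Q : red_res be a b Q = 0 -> red_res be a b (flec Q) = 0.
Proof.
move=> h; have := red_res_deriv be a b Q; rewrite h deriv0 => e1.
have ez : red_res be a b Q^z = - (red_res be a b Q^t * b%:P).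
  by apply/eqP; rewrite -addr_eq0 addrC -e1.
have e2 := red_res_deriv be a b Q^z; have e3 := red_res_deriv be a b Q^t.
have : (red_res be a b Q^z)^`() = - ((red_res be a b Q^t)^`() * b%:P).
  by rewrite ez derivN derivM derivC mulr0 addr0.
rewrite e2 e3 -dzt => e4.
rewrite /flec !(rmorphD, rmorphN, rmorphMn, rmorphM, rmorphXn) /= ez.
have -> : red_res be a b Q^z^z = - (red_res be a b Q^t^t * b%:P + red_res be a b Q^t^z) * b%:P
   - red_res be a b Q^t^z * b%:P by rewrite mulNr -e4; ring.
ring.
Qed.

Lemma dzM Q F : (Q * F)^z = Q^z * F + Q * F^z.
Proof. exact: map_poly_derivation (@derivM _) _ _. Qed.

(** The vector field [Q_t d/dz - Q_z d/dt], tangent to the level curves of [Q] in each slice: it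
    annihilates [Q] and all polynomials in [y] alone. *)
Definition along Q F : P := Q^t * F^z - Q^z * F^t.

Lemma along_is_zmod_morphism Q : zmod_morphism (along Q).
Proof. by move=> F G; rewrite /along raddfB derivB /=; ring. Qed.

HB.instance Definition _ Q :=
  GRing.isZmodMorphism.Build P P (along Q) (along_is_zmod_morphism Q).

Lemma alongM Q F G : along Q (F * G) = along Q F * G + F * along Q G.
Proof. by rewrite /along dzM derivM; ring. Qed.

Lemma dzX : map_poly (@deriv {poly K}) 'X = 0.
Proof. by apply/polyP => k; rewrite coef_dz coefX coef0; case: eqP; rewrite ?deriv0 // -polyC1 derivC. Qed.

Lemma dzC (q : {poly {poly K}}) : (q%:P)^z = (q^`())%:P :> P.
Proof. by apply/polyP => -[|k]; rewrite coef_dz !coefC ?deriv0. Qed.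

Lemma alongCC Q (c : {poly K}) : along Q c%:P%:P = 0.
Proof. by rewrite /along dzC !derivC polyC0; ring. Qed.

Lemma along_z Q : along Q 'X%:P = Q^t.
Proof. by rewrite /along dzC derivC derivX polyC1; ring. Qed.

Lemma along_t Q : along Q 'X = - Q^z.
Proof. by rewrite /along dzX derivX; ring. Qed.

(** The Taylor expansion of [Q] at a generic point, in the tangent direction of its level curve
    inside the slice. *)
Definition surface_slide Q : {poly P} :=
  slide (polyC \o polyC : {rmorphism {poly K} -> P}) 'X%:P 'X Q^t Q^z Q.

(** The contact polynomial is exactly the rotation term of the direction field carried along
    itself. *)
Lemma flecE Q : flec Q = Q^t * along Q Q^z - Q^z * along Q Q^t.
Proof. by rewrite /flec /along dzt; ring. Qed.

Lemma surface_slide0 Q : (surface_slide Q)`_0 = Q.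
Proof.
rewrite /surface_slide slide0; symmetry.
exact: (@subst3_uniq K P (polyC \o polyC : {rmorphism {poly K} -> P}) 'X%:P 'X
  (idfun : {rmorphism P -> P}) (fun=> erefl) erefl erefl Q).
Qed.

Lemma size_surface_slide d Q : box d Q -> (size (surface_slide Q) <= (2 * d).+1)%N.
Proof. exact: size_slide. Qed.

(** Modulo [Q] the rotation term vanishes, and [along Q] preserves multiples of [Q]. The recursion
    then shows that [Q] divides [k.+1] times [Q_t] times the next coefficient, and being prime it
    divides that coefficient. The whole tangent line thus lies in the slice. *)
Lemma divides_slide d Q : prime_elt Q -> box d Q -> ~ divides Q Q^t -> divides Q (flec Q) ->
  (forall k, (0 < k <= 2 * d)%N -> k%:R != 0 :> K) -> forall k, divides Q (surface_slide Q)`_k.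
Proof.
move=> pQ bQ nQt dF chK; elim=> [|k IHk]; first by rewrite surface_slide0; exact: divides_refl.
(* The expansion has degree at most [2 * d], so only integers up to [2 * d] have to be
   invertible. *)
have [kd|kd] := leqP k.+1 (2 * d); last first.
  by rewrite nth_default; [exact: divides0|apply: leq_trans (size_surface_slide bQ) _].
have dV : divides Q (along Q (surface_slide Q)`_k).
  case: IHk => G ->; rewrite alongM {2}/along; apply: dividesD.
    by apply: divides_mull; exact: divides_refl.
  by rewrite mulrC [Q^z * _]mulrC subrr mul0r; exact: divides0.
have [||||r] := @slide_derivation_coef _ _ (polyC \o polyC : {rmorphism {poly K} -> P})
  'X%:P 'X Q^t Q^z (along Q) Q k.
- exact: alongM.
- exact: alongCC.
- exact: along_z.
- exact: along_t.
rewrite -/(surface_slide Q) -flecE => e.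
have : divides Q (k.+1%:R * (Q^t * (surface_slide Q)`_k.+1)).
  rewrite e; apply: dividesD; first apply: dividesB.
  - exact: divides_mull.
  - by do 2!apply: divides_mull.
  exact: divides_mulr.
have kP : k.+1%:R = (k.+1%:R : K)%:P%:P%:P :> P by rewrite !rmorph_nat.
have ku : (k.+1%:R : P) \is a GRing.unit.
  rewrite kP poly_unitE size_polyC coefC /= !polyC_eq0 chK //=.
  rewrite poly_unitE size_polyC coefC /= !polyC_eq0 chK //=.
  by rewrite poly_unitE size_polyC coefC /= chK //= unitfE chK.
case: (pQ) => _ _ QP /QP[[G hG]|/QP[//|//]].
by exfalso; case: pQ => _ + _; case/negP; move: ku; rewrite hG unitrM => /andP[].
Qed.

End Flecnodes.

Lemma line_param (E : fieldType) (x y : E) : x != 0 ->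
  y%:P + x%:P * (x^-1%:P * ('X - y%:P)) = 'X.
Proof. by move=> x0; rewrite mulrA -polyCM divff // mul1r addrC subrK. Qed.

Lemma horner_line (E : fieldType) (a s y x : E) :
  (a%:P - s%:P * ('X - y%:P)).[x] = a - s * (x - y).
Proof. by rewrite hornerD hornerN hornerM !hornerC hornerXsubC. Qed.

Lemma line_opp (E : fieldType) (a s : E) (p : {poly E}) :
  a%:P + (- s)%:P * p = a%:P - s%:P * p.
Proof. by rewrite polyCN mulNr. Qed.

Lemma line_slope (E : fieldType) (k y y' a a' s : E) :
  k * (y' - y) = 1 -> a - s * (y' - y) = a' -> k * (a' - a) = - s.
Proof. by move=> h <-; rewrite addrAC subrr add0r mulrN mulrCA h mulr1. Qed.

Section Ruled.
Variable K : fieldType.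
Local Notation P := {poly {poly {poly K}}}.
Implicit Types Q F : P.
Local Notation "Q ^t" := (deriv Q) (at level 2, format "Q ^t").
Local Notation "Q ^z" := (map_poly (@deriv {poly K}) Q) (at level 2, format "Q ^z").
Local Notation E := {fraction {poly K}}.
Local Notation fr := (@tofrac {poly K}).

(** The points of a blue line are parametrized by [y], and all coefficients of the expansion vanish
    at them. Over the field of functions of [y], the slice tangent, written as [t] in terms of [z]
    with slope [- Q_z / Q_t], is therefore a root of [Q]. *)
Lemma blue_slice_line Q de c e (q : {rmorphism P -> {poly K}} := blue_res de c e) :
    (forall k, divides Q (surface_slide Q)`_k) -> q Q = 0 -> q Q^t != 0 ->
  (map_poly (map_poly fr) Q).[(fr (c%:P + e%:P * 'X))%:P
     - (fr (q Q^z) / fr (q Q^t))%:P * ('X - (fr de%:P)%:P)] = 0.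
Proof.
move=> dS q0 qt0.
have ft0 : fr (q Q^t) != 0 by rewrite tofrac_eq0.
pose g : {rmorphism P -> {poly E}} := polyC \o (fr \o q).
have gE a : g a = (fr (q a))%:P by [].
have hS : map_poly g (surface_slide Q) = 0.
  apply/polyP => k; rewrite coef_map coef0; case: (dS k) => G ->.
  by rewrite [LHS]gE [q _]rmorphM q0 mulr0 !rmorph0.
(* The slide parameter at which the [z]-coordinate equals the variable ['X]. *)
pose s : {poly E} := (fr (q Q^t))^-1%:P * ('X - (fr de%:P)%:P).
set T := _ - _.
have gz : g 'X%:P = (fr de%:P)%:P by rewrite gE; congr (fr _)%:P; exact: subst3_z.
have gt : g 'X = (fr (c%:P + e%:P * 'X))%:P by rewrite gE; congr (fr _)%:P; exact: subst3_t.
have gc a : g a%:P%:P = (fr a)%:P by rewrite gE; congr (fr _)%:P; exact: subst3CC.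
have hz : g 'X%:P + g Q^t * s = 'X.
  by rewrite gz (gE Q^t); exact: line_param.
have hT : g 'X - g Q^z * s = T.
  by rewrite gt (gE Q^z) /T /s polyCM -mulrA.
have e0 : (map_poly g (surface_slide Q)).[s] = subst3 (polyC \o fr) 'X T Q.
  have := @map_slide_horner K P (polyC \o polyC : {rmorphism {poly K} -> P}) 'X%:P 'X Q^t Q^z
    {poly E} g s (polyC \o fr : {rmorphism {poly K} -> {poly E}}) 'X T Q gc hz hT.
  by [].
transitivity (subst3 (polyC \o fr) 'X T Q); first by rewrite subst3_polyX.
transitivity (map_poly g (surface_slide Q)).[s]; first by [].
rewrite hS.
exact: horner0.
Qed.

Section Families.
Variables (J : finType) (de c e : J -> K).
Hypothesis de_inj : injective de.

(** Each blue line yields a root of [Q], whose degree in [t] is at most [d], so two blue lines yield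
    the same root. This slice line joins two points polynomial in [y] whose [z]-coordinates differ
    by a nonzero constant; its slope is therefore polynomial in [y], and the root has no
    denominators. *)
Lemma shared_slice_line d Q (J2 : {set J}) :
    Q != 0 -> box d Q -> (forall k, divides Q (surface_slide Q)`_k) ->
    {in J2, forall j, blue_res (de j) (c j) (e j) Q = 0} ->
    {in J2, forall j, blue_res (de j) (c j) (e j) Q^t != 0} -> (d < #|J2|)%N ->
  exists tau : {poly {poly K}}, root Q tau.
Proof.
move=> Q0 bQ dS hQ hQt dJ.
pose l j : {poly K} := (c j)%:P + (e j)%:P * 'X.
pose sg j := fr (blue_res (de j) (c j) (e j) Q^z) / fr (blue_res (de j) (c j) (e j) Q^t).
pose T j := (fr (l j))%:P - (sg j)%:P * ('X - (fr (de j)%:P)%:P).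
have Tde j : (T j).[fr (de j)%:P] = fr (l j).
  by rewrite /T horner_line subrr mulr0 subr0.
set QE := map_poly (map_poly fr) Q.
have QE0 : QE != 0.
  by rewrite map_poly_eq0_id0 // map_poly_eq0_id0 ?lead_coef_eq0 // tofrac_eq0 !lead_coef_eq0.
have rT : {in J2, forall j, root QE (T j)}.
  by move=> j jJ; apply/eqP/blue_slice_line => //; [exact: hQ|exact: hQt].
have [/dinjectiveP inj|] := boolP (dinjectiveb T (mem J2)).
  move/eqP: QE0; case; apply: poly_many_roots inj rT _; apply: leq_trans dJ.
  by apply: leq_trans (size_poly _ _) _; case/and3P: bQ.
case/dinjectivePn => j jJ [j' /andP[nj jJ'] Tj].
have dj0 : de j' - de j != 0 by rewrite subr_eq0; apply: contra nj => /eqP/de_inj ->.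
pose tau : {poly {poly K}} := (l j)%:P + ((de j' - de j)^-1%:P * (l j' - l j))%:P * ('X - (de j)%:P%:P).
exists tau.
have sgE : fr ((de j' - de j)^-1%:P * (l j' - l j)) = - sg j.
  rewrite rmorphM rmorphB; apply: (@line_slope _ _ (fr (de j)%:P) (fr (de j')%:P)).
    by rewrite -rmorphB -polyCB -rmorphM -polyCM mulVf // polyC1 rmorph1.
  by have := Tde j'; rewrite -Tj /T horner_line.
have mT : map_poly fr tau = T j.
  rewrite /tau rmorphD rmorphM /= rmorphB /= map_polyX !map_polyC /= sgE.
  exact: line_opp.
apply/eqP; apply: (@map_inj_poly _ _ fr).
- by move=> x y /eqP; rewrite tofrac_eq => /eqP.
- by rewrite rmorph0.
transitivity QE.[map_poly fr tau]; first by rewrite /QE horner_map.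
by rewrite mT rmorph0; apply/eqP; exact: rT.
Qed.

End Families.
End Ruled.

Lemma rmorph_unit_neq0 (A : idomainType) (B : idomainType) (f : {rmorphism A -> B}) u :
  u \is a GRing.unit -> f u != 0.
Proof.
move=> uu; apply: contraTneq (oner_neq0 B) => f0.
by rewrite -(rmorph1 f) -(mulrV uu) rmorphM f0 mul0r eqxx.
Qed.

(** Here [x] counts the blue lines, [N] all lines, and [d] is about the degree that interpolation
    requires: [18 = 2 * 9] comes from [m <= 2 * (M - 3 * d)] and [(3 * d).+1 <= 3 * d.+1]. The first
    two conclusions reflect [36 * 864 = 18 * 1728] and [36 * 864 = 18 ^ 2 * 96]. *)
Lemma degree_arith (N x m M : nat) (d := (18 * x %/ m)%N) :
    (0 < m <= M)%N -> (0 < N)%N -> (x <= N)%N -> (36 * 864 * N <= m ^ 2)%N ->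
  [/\ (1728 * d <= m)%N, (96 * d ^ 2 <= N)%N &
      ((3 * d).+1 ^ 2 * x < d.+1 ^ 3 * (M - 3 * d))%N].
Proof.
move=> /andP[m0 mM] N0 xN hN.
have hd : (d * m <= 18 * x)%N by exact: leq_divM.
have hd' : (18 * x < d.+1 * m)%N by rewrite ltn_ceil.
have h1 : (1728 * d <= m)%N.
  by clear -hd xN hN m0; rewrite -(leq_pmul2r m0); nia.
split=> //.
  rewrite -(leq_pmul2r N0) -(@leq_pmul2l 324) //; clear -hd xN hN; nia.
have : (m <= 2 * (M - 3 * d))%N by clear -h1 mM; lia.
clear -hd'; move: (M - 3 * d)%N => y hy.
apply: leq_ltn_trans (_ : (d.+1 ^ 2 * (9 * x) < _)%N).
  by rewrite [leqRHS]mulnCA mulnA leq_mul2r; apply/orP; right; nia.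
rewrite (expnSr _ 2) -mulnA ltn_mul2l expn_gt0 /=.
by nia.
Qed.

(** * The incidence bound *)

Section Configurations.
Variables (K : fieldType) (I J : finType) (be a b : I -> K) (de c e : J -> K).
Hypotheses (be_inj : injective be) (de_inj : injective de).
Local Notation P := {poly {poly {poly K}}}.
Implicit Types Q : P.

Definition meets i j := a i + b i * de j == c j + e j * be i.
Definition nbJ (J1 : {set J}) i := [set j in J1 | meets i j].
Definition nbI (I1 : {set I}) j := [set i in I1 | meets i j].
Local Notation red i := (red_res (be i) (a i) (b i)).
Local Notation blue j := (blue_res (de j) (c j) (e j)).
Local Notation vanishes := (vanishes be a b de c e).

Definition config m (I1 : {set I}) (J1 : {set J}) := [/\ (0 < #|I1| + #|J1|)%N,
  {in I1, forall i, (m <= #|nbJ J1 i|)%N} & {in J1, forall j, (m <= #|nbI I1 j|)%N}].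

(** The blue lines meet the red one at points with distinct [z = de j], which are more roots than
    the degree of the restriction allows. *)
Lemma red_vanish Q i (T : {set J}) : {in T, forall j, meets i j /\ blue j Q = 0} ->
  (deg3 Q < #|T|)%N -> red i Q = 0.
Proof.
move=> h hT; apply: (@poly_many_roots _ _ T de).
- by move=> x y _ _; exact: de_inj.
- by move=> j /h[/eqP m0 b0]; rewrite /root (red_blue_meet _ m0) b0 horner0.
exact: leq_trans (size_red_res _ _ _ _) hT.
Qed.

Lemma blue_vanish Q j (S : {set I}) : {in S, forall i, meets i j /\ red i Q = 0} ->
  (deg3 Q < #|S|)%N -> blue j Q = 0.
Proof.
move=> h hT; apply: (@poly_many_roots _ _ S be).
- by move=> x y _ _; exact: be_inj.
- by move=> i /h[/eqP m0 b0]; rewrite /root -(red_blue_meet _ m0) b0 horner0.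
exact: leq_trans (size_blue_res _ _ _ _) hT.
Qed.

Lemma config_nonempty m I1 J1 : config m I1 J1 -> (0 < m)%N ->
  (exists i, i \in I1) /\ (exists j, j \in J1).
Proof.
case; rewrite addn_gt0 => /orP[] /card_gt0P[x xI] hI hJ m0.
  by split; [exists x|have := leq_trans m0 (hI x xI) => /card_gt0P[j]; rewrite inE => /andP[jJ _]; exists j].
by split; [have := leq_trans m0 (hJ x xI) => /card_gt0P[j]; rewrite inE => /andP[jJ _]; exists j|exists x].
Qed.

Lemma configW m m' I1 J1 : (m' <= m)%N -> config m I1 J1 -> config m' I1 J1.
Proof.
by move=> mm [h1 h2 h3]; split=> // x xI; apply: leq_trans mm _; [exact: h2|exact: h3].
Qed.

(** If a prime factor [q] does not vanish on every line, the lines on it are discarded. Any other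
    line meets at most [deg3 q] of these, and the remaining factors vanish on what is left. As
    [deg3] is additive, each line loses at most [deg3 Q] incidences in all. *)
Lemma prime_component m Q I1 J1 : Q != 0 -> vanishes I1 J1 Q ->
    config (m + deg3 Q) I1 J1 ->
  exists Q' (I2 : {set I}) (J2 : {set J}), [/\ prime_elt Q', divides Q' Q, I2 \subset I1 /\ J2 \subset J1,
    vanishes I2 J2 Q' & config m I2 J2].
Proof.
move=> Q0; have facP : has_prime_factorizations P.
  by do 3!apply: poly_prime_factorizations; exact: field_prime_factorizations.
have [u [s [uu hs QE]]] := facP Q Q0.
elim: s Q hs Q0 QE I1 J1 => [|q s IHs] Q hs Q0 QE I1 J1 [vI vJ] cf.
  exfalso; move: QE; rewrite big_nil mulr1 => Qu; subst u.
  case: cf; rewrite addn_gt0 => /orP[] /card_gt0P[x xI] _ _.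
    by case/eqP: (rmorph_unit_neq0 (red_res (be x) (a x) (b x) : {rmorphism P -> {poly K}}) uu); exact: vI.
  by case/eqP: (rmorph_unit_neq0 (blue_res (de x) (c x) (e x) : {rmorphism P -> {poly K}}) uu); exact: vJ.
have pq : prime_elt q by apply: hs; rewrite mem_head.
pose Q1 := u * \prod_(p <- s) p.
have QE1 : Q = q * Q1 by rewrite QE big_cons mulrCA.
have q0 : q != 0 by case: pq.
have Q10 : Q1 != 0 by apply: contraNneq Q0 => h; rewrite QE1 h mulr0.
have dE : deg3 Q = (deg3 q + deg3 Q1)%N by rewrite QE1 deg3M.
pose I2 := [set i in I1 | red i q == 0]; pose J2 := [set j in J1 | blue j q == 0].
have [h0|h0] := posnP (#|I1 :\: I2| + #|J1 :\: J2|).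
  move/eqP: h0; rewrite addn_eq0 !cards_eq0 !setD_eq0 => /andP[/subsetP s1 /subsetP s2].
  exists q, I1, J1; split=> //.
  - by exists Q1; rewrite QE1 mulrC.
  - by split=> x xI; [have := s1 x xI|have := s2 x xI]; rewrite inE => /andP[_ /eqP].
  by apply: configW cf; exact: leq_addr.
have [|||Q' [I3 [J3 [h1 h2 [h3 h3'] h4 h5]]]] := IHs Q1 _ Q10 erefl (I1 :\: I2) (J1 :\: J2).
- by move=> x xs; apply: hs; rewrite inE xs orbT.
- split=> x; rewrite !inE => /andP[+ xI]; rewrite xI /= => /negbTE nq.
    by have := vI x xI; rewrite QE1 rmorphM /= => /eqP; rewrite mulf_eq0 nq => /eqP.
  by have := vJ x xI; rewrite QE1 rmorphM /= => /eqP; rewrite mulf_eq0 nq => /eqP.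
- case: cf => _ cI cJ; split=> // x; rewrite !inE => /andP[+ xI]; rewrite xI /= => nq.
    have : (#|nbJ J2 x| <= deg3 q)%N.
      rewrite leqNgt; apply: contra nq => /(red_vanish _) ->; rewrite ?eqxx // => j.
      by rewrite !inE => /andP[/andP[_ /eqP]].
    have : (#|nbJ J1 x| <= #|nbJ (J1 :\: J2) x| + #|nbJ J2 x|)%N.
      apply: leq_trans (leq_card_setU _ _).1; apply: subset_leq_card; apply/subsetP => j.
      by rewrite !inE => /andP[-> ->]; case: (blue j q == 0).
    move=> h h'; rewrite -(leq_add2r (deg3 q)) -addnA [(deg3 Q1 + _)%N]addnC -dE.
    by apply: leq_trans (cI x xI) (leq_trans h _); rewrite leq_add2l.
  have : (#|nbI I2 x| <= deg3 q)%N.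
    rewrite leqNgt; apply: contra nq => /(blue_vanish _) ->; rewrite ?eqxx // => j.
    by rewrite !inE => /andP[/andP[_ /eqP]].
  have : (#|nbI I1 x| <= #|nbI (I1 :\: I2) x| + #|nbI I2 x|)%N.
    apply: leq_trans (leq_card_setU _ _).1; apply: subset_leq_card; apply/subsetP => j.
    by rewrite !inE => /andP[-> ->]; case: (red j q == 0).
  move=> h h'; rewrite -(leq_add2r (deg3 q)) -addnA [(deg3 Q1 + _)%N]addnC -dE.
  by apply: leq_trans (cJ x xI) (leq_trans h _); rewrite leq_add2l.
exists Q', I3, J3; split=> //.
- by rewrite QE1; exact: divides_mull.
- by split; [apply: subset_trans h3 _|apply: subset_trans h3' _]; exact: subsetDl.
Qed.

(* The seed S is chosen greedily: a red line outside the forced zero set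
   brings at least m - 3d new incidences with blue lines met few times by S. *)
Lemma low_degree_surface m d I1 J1 : config m I1 J1 -> (3 * d < m)%N ->
    ((3 * d).+1 ^ 2 * #|J1| < d.+1 ^ 3 * (m - 3 * d))%N ->
  exists Q, [/\ Q != 0, box d Q & vanishes I1 J1 Q].
Proof.
move=> [_ cI cJ]; set D := (3 * d)%N => Dm hb.
pose Phi (S : {set I}) := (\sum_(j in J1) minn #|nbI S j| D.+1)%N.
pose good (S : {set I}) := (S \subset I1) && (#|S| * (m - D) <= Phi S)%N.
have g0 : good set0 by rewrite /good sub0set cards0 mul0n.
case: (@arg_maxnP _ set0 good (fun S => #|S|) g0) => S /andP[SI hS] maxS.
have PhiD : (Phi S <= D.+1 * #|J1|)%N.
  apply: leq_trans (_ : (\sum_(j in J1) D.+1 <= _)%N); last by rewrite sum_nat_const mulnC.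
  by apply: leq_sum => j _; exact: geq_minr.
have [|Q [Q0 bQ vS]] := @interpolation K I be a b S d.
  rewrite -/D; have mD : (0 < m - D)%N by rewrite subn_gt0.
  rewrite -(ltn_pmul2r mD); apply: leq_ltn_trans hb.
  by rewrite mulnAC mulnC -mulnn -mulnA leq_mul2l (leq_trans hS PhiD) orbT.
exists Q; split=> //.
have dQ : (deg3 Q <= D)%N by exact: deg3_box.
pose J' := [set j in J1 | (D < #|nbI S j|)%N].
have vJ' : {in J', forall j, blue j Q = 0}.
  move=> j; rewrite inE => /andP[_ hj]; apply: (@blue_vanish _ _ (nbI S j)).
    by move=> i; rewrite inE => /andP[iS ->]; split=> //; exact: vS.
  exact: leq_ltn_trans hj.
have vI : {in I1, forall i, red i Q = 0}.
  move=> i iI; have [iS|iS] := boolP (i \in S); first exact: vS.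
  apply: (@red_vanish _ _ (nbJ J' i)).
    by move=> j; rewrite inE => /andP[jS ->]; split=> //; exact: vJ'.
  apply: leq_ltn_trans dQ _; rewrite ltnNge; apply/negP => few.
  have := maxS (i |: S); rewrite /= cardsU1 iS add1n ltnn => mx; suff /mx : good (i |: S) by [].
  rewrite /good subUset sub1set iI SI /= cardsU1 iS add1n mulSn.
  have nb1 j : #|nbI (i |: S) j| = (meets i j + #|nbI S j|)%N.
    have [mij|mij] := boolP (meets i j).
      have -> : nbI (i |: S) j = i |: nbI S j.
        by apply/setP => x; rewrite !inE; case: eqP => [->|].
      by rewrite cardsU1 inE (negbTE iS).
    rewrite add0n; apply: eq_card => x; rewrite !inE; case: eqP => [->|//].
    by rewrite (negbTE mij) (negbTE iS).
  apply: leq_trans (_ : #|nbJ (J1 :\: J') i| + Phi S <= _)%N; last first.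
    rewrite /Phi -sum1_card big_mkcond [X in (_ + X)%N]big_mkcond -big_split /=.
    rewrite [leqRHS]big_mkcond /=; apply: leq_sum => j _; rewrite nb1 !inE.
    case: (j \in J1) => //=; rewrite -leqNgt; case: (meets i j) => /=; rewrite ?andbF ?andbT //.
    by move: (#|_|) => x; case: (leqP x D) => h /=; lia.
  rewrite leq_add //.
  have : (#|nbJ J1 i| <= #|nbJ (J1 :\: J') i| + #|nbJ J' i|)%N.
    apply: leq_trans (leq_card_setU _ _).1; apply: subset_leq_card; apply/subsetP => j.
    by rewrite !inE => /andP[-> ->]; case: (D < _)%N.
  move=> h; rewrite leq_subLR; apply: leq_trans (cI i iI) (leq_trans h _).
  by rewrite addnC leq_add2r.
split=> // j jJ; apply: (@blue_vanish _ _ (nbI I1 j)).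
  by move=> i; rewrite inE => /andP[iS ->]; split=> //; exact: vI.
by apply: leq_ltn_trans dQ _; apply: leq_trans Dm _; exact: cJ.
Qed.

(** A red line off the surface meets at most [deg3 Q] of the blue lines on it, hence many others. If
    every red line were on the surface, so would be every blue one, each meeting many red lines. *)
Lemma many_nondegenerate_blue m Q I1 J1 : config m I1 J1 ->
    ~ vanishes I1 J1 Q -> (2 * deg3 Q < m)%N ->
  (m - deg3 Q <= #|[set j in J1 | blue j Q != 0%R]|)%N.
Proof.
move=> [_ cI cJ] nv dm.
have redcase i : i \in I1 -> red i Q != 0 -> (m - deg3 Q <= #|[set j in J1 | blue j Q != 0%R]|)%N.
  move=> iI ri; pose B := nbJ J1 i :&: [set j | blue j Q == 0].
  rewrite leq_subLR; apply: leq_trans (cI i iI) _.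
  apply: (@leq_trans (#|B| + #|[set j in J1 | blue j Q != 0%R]|)).
    apply: leq_trans (leq_card_setU _ _).1; apply: subset_leq_card; apply/subsetP => j.
    by rewrite !inE => /andP[-> ->]; case: (blue j Q == 0).
  rewrite leq_add2r leqNgt; apply: contra ri => h; apply/eqP; apply: red_vanish h => j.
  by rewrite !inE => /andP[/andP[_ ->] /eqP].
have [[i /andP[iI ri]]|noI] := EM (exists i, (i \in I1) && (red i Q != 0)); first exact: redcase ri.
have vI : {in I1, forall i, red i Q = 0}.
  by move=> i iI; apply/eqP/negPn/negP => ri; apply: noI; exists i; rewrite iI.
exfalso; apply: nv; split=> // j jJ; apply: (@blue_vanish _ _ (nbI I1 j)).
  by move=> i; rewrite inE => /andP[iI ->]; split=> //; exact: vI.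
by apply: leq_trans (cJ j jJ); apply: leq_ltn_trans dm; rewrite mul2n -addnn leq_addr.
Qed.

Lemma deriv_eq0 M Q : (forall k, (0 < k <= M)%N -> k%:R != 0 :> K) ->
  (size Q <= M.+1)%N -> Q^`() = 0 -> (size Q <= 1)%N.
Proof.
move=> chK sQ dQ; apply/leq_sizeP => -[//|k] _.
have [kM|kM] := leqP k.+1 M; last by rewrite nth_default // (leq_trans sQ).
have := congr1 (fun p : P => p`_k) dQ; rewrite /= coef_deriv coef0 -mulr_natl => /eqP.
rewrite mulf_eq0 => /orP[|/eqP //].
have -> : k.+1%:R = (k.+1%:R : K)%:P%:P :> {poly {poly K}} by rewrite !rmorph_nat.
by rewrite !polyC_eq0 (negbTE (chK _ _)).
Qed.

(** The prime [Q] divides one of the factors of [Q = G * ('X - tau%:P)], and the degree of [G] is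
    too small. *)
Lemma root_divides Q tau : prime_elt Q -> root Q tau -> divides Q ('X - tau%:P).
Proof.
move=> pQ /factor_theorem[G QE]; have [Q0 _ QP] := pQ.
case: (QP G ('X - tau%:P)) => //; first by rewrite -QE; exact: divides_refl.
case=> H GE; have H0 : H != 0.
  by apply: contraNneq Q0 => H0; rewrite QE GE H0 !mul0r.
exfalso; have := size_mul_gt (mulf_neq0 H0 Q0) (_ : 1 < size ('X - tau%:P)%R)%N.
rewrite size_XsubC => /(_ isT); rewrite -GE -QE GE ltnNge mulrC; apply/negP; rewrite negbK.
by rewrite size_mul // -subn1 leq_subRL ?addn_gt0 ?size_poly_gt0 ?Q0 // addnC leq_add2l size_poly_gt0.
Qed.

(** On the graph [t = tau] a point is determined by [z] and [y], and both lines pass over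
    [(de j, be i)]. *)
Lemma vanishes_graph I1 J1 tau : vanishes I1 J1 ('X - tau%:P) ->
  {in I1 & J1, forall i j, meets i j}.
Proof.
move=> [vI vJ] i j /vI hi /vJ hj; apply/eqP.
have e1 : red i ('X - tau%:P) = (a i)%:P + (b i)%:P * 'X - map_poly (horner_eval (be i)) tau.
  rewrite -(red_res_polyC (be i) (a i) (b i)).
  rewrite (rmorphB (red_res (be i) (a i) (b i) : {rmorphism P -> {poly K}})).
  by congr (_ - _); exact: subst3_t.
have e2 : blue j ('X - tau%:P) = (c j)%:P + (e j)%:P * 'X - tau.[(de j)%:P].
  rewrite -(blue_res_polyC (de j) (c j) (e j)).
  rewrite (rmorphB (blue_res (de j) (c j) (e j) : {rmorphism P -> {poly K}})).
  by congr (_ - _); exact: subst3_t.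
have line (x y : K) (p : {poly K}) z : x%:P + y%:P * 'X - p = 0 -> x + y * z = p.[z].
  by move=> /eqP; rewrite subr_eq0 => /eqP <-; rewrite !hornerE.
rewrite (line _ _ _ (de j) (etrans (esym e1) hi)) (line _ _ _ (be i) (etrans (esym e2) hj)).
by rewrite -[RHS]/(horner_eval (be i) _) -horner_map /= /horner_eval hornerC.
Qed.

(** Only [m] is spent in the induction, on incidences lost when a component is selected; the surplus
    [kap] is kept intact and finally bounds both sides of the biclique from below. In the
    alternatives with few lines, [12 * d ^ 2 = (d + 3 * d) * (3 * d)] is the resultant bound for [Q]
    and its contact polynomial. *)
Lemma config_biclique M kap m (I1 : {set I}) (J1 : {set J}) :
    (forall k, (0 < k <= M)%N -> k%:R != 0 :> K) -> (0 < m <= M)%N ->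
    (36 * 864 * (#|I1| + #|J1|) <= m ^ 2)%N -> config (kap + m) I1 J1 ->
  exists (I2 : {set I}) (J2 : {set J}), [/\ I2 \subset I1, J2 \subset J1,
    (kap <= #|I2|)%N, (kap <= #|J2|)%N & {in I2 & J2, forall i j, meets i j}].
Proof.
move=> chK; move: {2}(_ + _)%N (leqnn (#|I1| + #|J1|)) => n.
elim: n I1 J1 m => [|n IHn] I1 J1 m hn /andP[m0 mM] hm cf.
  by case: cf; rewrite ltnNge hn.
have N0 : (0 < #|I1| + #|J1|)%N by case: cf.
have mk : (0 < m <= kap + m)%N by rewrite m0 leq_addl.
have := degree_arith mk N0 (leq_addl _ _) hm.
set d := (_ %/ _)%N => -[d1 d2 d3].
have [|Q0 [Q0n bQ0 vQ0]] := low_degree_surface cf _ d3; first by clear -d1 m0; lia.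
have dQ0 : (deg3 Q0 <= 3 * d)%N by exact: deg3_box.
set m' := (m - 3 * d)%N.
have m'0 : (0 < m')%N by rewrite /m'; lia.
have [|Q [I2 [J2 [pQ dQ [sI sJ] vQ cf2]]]] := @prime_component (kap + m') _ _ _ Q0n vQ0.
  by apply: configW cf; rewrite /m' -addnA leq_add2l; lia.
have bQ := box_divides dQ Q0n bQ0.
have [[i2 i2I] [j2 j2J]] := config_nonempty cf2 (ltn_addl kap m'0).
have nI2 : (kap + m' <= #|I2|)%N.
  case: cf2 => _ _ /(_ j2 j2J) /leq_trans; apply; apply: subset_leq_card.
  by apply/subsetP => i; rewrite inE => /andP[].
have nJ2 : (kap + m' <= #|J2|)%N.
  case: cf2 => _ /(_ i2 i2I) /leq_trans + _; apply; apply: subset_leq_card.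
  by apply/subsetP => i; rewrite inE => /andP[].
(* At most [24 * d ^ 2] lines remain, a quarter of the original number, while [m'] is at least half
   of [m]; so the quadratic condition linking them is inherited. *)
have few : (#|I2| <= 12 * d ^ 2)%N -> (#|J2| <= 12 * d ^ 2)%N ->
  exists (I2 : {set I}) (J2 : {set J}), [/\ I2 \subset I1, J2 \subset J1,
    (kap <= #|I2|)%N, (kap <= #|J2|)%N & {in I2 & J2, forall i j, meets i j}].
  move=> h1 h2; have h3 : (#|I2| + #|J2| <= 24 * d ^ 2)%N by clear -h1 h2; lia.
  have [||||I3 [J3 [s1 s2 s3 s4 s5]]] := IHn I2 J2 m'; last first.
    by exists I3, J3; split=> //; [exact: subset_trans sI|exact: subset_trans sJ].
  - exact: cf2.
  - clear -h3 d1 d2 hm; rewrite /m'; apply: leq_trans (leq_mul (leqnn _) h3) _.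
    have : (m <= 2 * (m - 3 * d))%N by lia.
    by nia.
  - by rewrite m'0 /m' (leq_trans (leq_subr _ _)).
  by clear -h3 d2 hn N0; lia.
have Qn : Q != 0 by case: pQ.
have sQ : (size Q <= d.+1)%N by case/and3P: bQ.
have Q1 : (1 < size Q)%N.
  rewrite ltnNge; apply/negP => /size1_polyC QE; move: vQ Qn bQ; rewrite QE polyC_eq0.
  move=> /(vanishes_polyC be_inj de_inj) h /h {}h /h[h1 _].
  by move: (leq_trans nI2 h1) d1 m0; rewrite /m'; clear; lia.
have Qt0 : Q^`() != 0.
  apply: contraTneq Q1 => Qt; rewrite -leqNgt; apply: (deriv_eq0 chK) Qt.
  by apply: leq_trans sQ _; rewrite ltnS; apply: leq_trans mM; clear -d1; lia.
have nQt : ~ divides Q Q^`().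
  case=> G GE; have G0 : G != 0 by apply: contraNneq Qt0 => G0; rewrite GE G0 mul0r.
  have := lt_size_deriv Qn; rewrite GE ltnNge mulrC size_mul // -subn1.
  by rewrite leq_subRL ?addn_gt0 ?size_poly_gt0 ?Qn // addnC leq_add2l size_poly_gt0 G0.
have bQt : box d Q^`() by exact: box_deriv.
have [vt|nvt] := EM (vanishes I2 J2 Q^`()).
  have := vanishes_coprime be_inj de_inj vQ vt (prime_coprime pQ Q1 nQt) Qn Qt0 bQ bQt.
  by rewrite maxnn => -[h1 h2]; apply: few; [move: h1|move: h2]; clear; nia.
have dQt : (deg3 Q^`() <= 3 * d)%N by exact: deg3_box.
have nd := many_nondegenerate_blue cf2 nvt _.
have bF := box_flec bQ.
have dF : (deg3 (flec Q) <= 9 * d)%N by apply: leq_trans (deg3_box bF) _; rewrite mulnA.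
have vF : vanishes I2 J2 (flec Q).
  case: vQ => vI vJ; have vFI : {in I2, forall i, red i (flec Q) = 0}.
    by move=> i /vI; exact: flec_red.
  split=> // j jJ; apply: (@blue_vanish _ _ (nbI I2 j)).
    by move=> i; rewrite inE => /andP[iI ->]; split=> //; exact: vFI.
  case: cf2 => _ _ /(_ j jJ); apply: leq_trans; apply: leq_ltn_trans dF _.
  by rewrite /m'; clear -d1 m0; lia.
have [dvF|ndvF] := EM (divides Q (flec Q)); last first.
  have F0 : flec Q != 0 by apply: contra_not_neq ndvF => ->; exact: divides0.
  have := vanishes_coprime be_inj de_inj vQ vF (prime_coprime pQ Q1 ndvF) Qn F0 bQ bF.
  rewrite (maxn_idPr _); last by clear; lia.
  by move=> [h1 h2]; apply: few; [move: h1|move: h2]; clear; nia.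
have dS := divides_slide pQ bQ nQt dvF _.
have [||||tau tauP] := @shared_slice_line K J de c e de_inj d Q [set j in J2 | blue j Q^`() != 0] Qn bQ.
- by apply: dS => k /andP[k0 kd]; apply: chK; rewrite k0 /=; move: kd mM d1; clear; lia.
- by move=> j; rewrite inE => /andP[jJ _]; case: vQ => _; exact.
- by move=> j; rewrite inE => /andP[].
- apply: leq_trans (nd _); first by move: dQt d1 m0; rewrite /m'; clear; lia.
  by move: dQt d1 m0; rewrite /m'; clear; lia.
exists I2, J2; split=> //.
- exact: leq_trans (leq_addr _ _) nI2.
- exact: leq_trans (leq_addr _ _) nJ2.
apply: (@vanishes_graph _ _ tau).
case: (root_divides pQ tauP) => G ->; case: vQ => vI vJ.
by split=> x xI; rewrite rmorphM /= ?vI ?vJ // mulr0.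
Qed.

End Configurations.

Section Pruning.
Variables (K : fieldType) (I J : finType) (be a b : I -> K) (de c e : J -> K).
Local Notation nbJ := (nbJ be a b de c e).
Local Notation nbI := (nbI be a b de c e).
Local Notation config := (config be a b de c e).
Local Notation meets := (meets be a b de c e).

(** Lines meeting fewer than [m] others are deleted as long as there are any. Each deletion destroys
    fewer than [m] incidences, so the incidences outlast the lines. *)
Lemma prune m (I1 : {set I}) (J1 : {set J}) :
    ((#|I1| + #|J1|) * m < \sum_(i in I1) #|nbJ J1 i|)%N ->
  exists (I2 : {set I}) (J2 : {set J}), [/\ I2 \subset I1, J2 \subset J1 & config m I2 J2].
Proof.
have dbl (I3 : {set I}) (J3 : {set J}) :
    (\sum_(i in I3) #|nbJ J3 i| = \sum_(j in J3) #|nbI I3 j|)%N.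
  transitivity (\sum_(i in I3) \sum_(j in J3) meets i j)%N.
    apply: eq_bigr => i _; rewrite -sum1_card big_mkcond [RHS]big_mkcond.
    by apply: eq_bigr => j _; rewrite inE; case: (j \in J3) => //=; case: ifP.
  rewrite exchange_big; apply: eq_bigr => j _; rewrite -sum1_card big_mkcond [RHS]big_mkcond.
  by apply: eq_bigr => i _; rewrite inE; case: (i \in I3) => //=; case: ifP.
move: {2}(_ + _)%N (leqnn (#|I1| + #|J1|)) => n.
elim: n I1 J1 => [|n IHn] I1 J1 hn hE.
  move: hn hE; rewrite leqn0 addn_eq0 cards_eq0 => /andP[/eqP -> _].
  by rewrite big_set0 ltn0.
have [[i /andP[iI fewi]]|hI] := EM (exists i, (i \in I1) && (#|nbJ J1 i| < m)%N).
  have cI := cardsD1 i I1; rewrite iI add1n in cI.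
  have [||I2 [J2 [s1 s2 cf]]] := IHn (I1 :\ i) J1.
  - by move: hn; rewrite cI addSn ltnS.
  - move: hE; rewrite (big_setD1 i) //= cI addSn mulSn.
    by move: (\sum_(_ in _) _)%N (_ * m)%N fewi; clear; lia.
  by exists I2, J2; split=> //; apply: subset_trans s1 (subD1set _ _).
have [[j /andP[jJ fewj]]|hJ] := EM (exists j, (j \in J1) && (#|nbI I1 j| < m)%N).
  have cJ := cardsD1 j J1; rewrite jJ add1n in cJ.
  have [||I2 [J2 [s1 s2 cf]]] := IHn I1 (J1 :\ j).
  - by move: hn; rewrite cJ addnS ltnS.
  - move: hE; rewrite !dbl (big_setD1 j) //= cJ addnS mulSn.
    by move: (\sum_(_ in _) _)%N (_ * m)%N fewj; clear; lia.
  by exists I2, J2; split=> //; apply: subset_trans s2 (subD1set _ _).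
exists I1, J1; split=> //; split.
- rewrite lt0n; apply: contraTneq hE => h0.
  move/eqP: h0; rewrite addn_eq0 cards_eq0 => /andP[/eqP -> _].
  by rewrite big_set0 ltn0.
- by move=> i iI; rewrite leqNgt; apply/negP => h; apply: hI; exists i; rewrite iI.
by move=> j jJ; rewrite leqNgt; apply/negP => h; apply: hJ; exists j; rewrite jJ.
Qed.

Lemma card_edges (I1 : {set I}) (J1 : {set J}) :
  #|[set w : I * J | [&& w.1 \in I1, w.2 \in J1 & meets w.1 w.2]]| =
  (\sum_(i in I1) #|nbJ J1 i|)%N.
Proof.
transitivity (\sum_i \sum_j [&& i \in I1, j \in J1 & meets i j])%N.
  rewrite pair_bigA /= -sum1_card big_mkcond; apply: eq_bigr => w _; rewrite inE.
  by case: [&& _, _ & _].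
rewrite [RHS]big_mkcond; apply: eq_bigr => i _; case: (i \in I1) => /=; last exact: big1.
by rewrite -sum1_card [RHS]big_mkcond; apply: eq_bigr => j _; rewrite inE; case: (_ && _).
Qed.

End Pruning.

(** * The multiplicative equation as an incidence problem *)

Lemma rmorph_combination (A B : comNzRingType) (f : {rmorphism A -> B}) p q r s t u v w :
  f (p * q + r * s - t * u - v * w) = f p * f q + f r * f s - f t * f u - f v * f w.
Proof. by rewrite !rmorphB rmorphD !rmorphM. Qed.

Section GenericCoordinates.
Variable F : fieldType.
Local Notation K := {fraction {poly F}}.
Implicit Types b x y : F.

(* A plane in which all the lines of one colour become distinguishable is chosen
   generically, with transcendental coefficients. *)
Definition genW1 x y : {poly F} := 1 + x%:P * 'X + y%:P * 'X^2.
Definition genW3 b x y : {poly F} := b%:P + x%:P * 'X^3 + y%:P * 'X^6.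
Definition genH0 b x y : {poly F} := - b%:P + y%:P * 'X - x%:P * 'X^3.
Definition genH2 x y : {poly F} := 1 + y%:P * 'X^2 - x%:P * 'X^6.

Definition red_be b x y : K := tofrac (genW3 b x y) / tofrac (genW1 x y).
Definition red_a x y : K := tofrac x%:P / tofrac (genW1 x y).
Definition red_b x y : K := tofrac y%:P / tofrac (genW1 x y).
Definition blue_de b x y : K := tofrac (genH2 x y) / tofrac (genH0 b x y).
Definition blue_c b x y : K := tofrac y%:P / tofrac (genH0 b x y).
Definition blue_e b x y : K := tofrac (- x%:P) / tofrac (genH0 b x y).

Lemma genW1_neq0 x y : tofrac (genW1 x y) != 0.
Proof.
rewrite tofrac_eq0; apply/eqP => /(congr1 (fun p : {poly F} => p`_0)).
by rewrite /genW1 !coefD !coefCM !coefXn coefX coef1 coef0 !mulr0 !addr0 => /eqP; rewrite oner_eq0.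
Qed.

Lemma genH0_neq0 b x y : x != 0 -> tofrac (genH0 b x y) != 0.
Proof.
move=> x0; rewrite tofrac_eq0; apply: contraNneq x0 => /(congr1 (fun p : {poly F} => p`_3)).
rewrite /genH0 !coefD !coefN !coefCM !coefXn coefX coefC coef0 /= mulr0 mulr1 oppr0 !add0r => /eqP.
by rewrite oppr_eq0.
Qed.

Lemma frac_eq (A : fieldType) (u v u' v' : A) : v != 0 -> v' != 0 ->
  (u / v == u' / v') = (u * v' == u' * v).
Proof. by move=> v0 v0'; rewrite eqr_div. Qed.

(** The exponents 0, 1, 2 of [genW1] and 0, 3, 6 of [genW3] have nine distinct sums, so the
    coefficients 0, 3 and 6 of the product are exactly the parameters of [genW3]. *)
Lemma red_be_inj b x y b' x' y' : red_be b x y = red_be b' x' y' ->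
  [/\ b = b', x = x' & y = y'].
Proof.
move=> /eqP; rewrite /red_be frac_eq ?genW1_neq0 // -!rmorphM tofrac_eq => /eqP h.
have hc k := congr1 (fun p : {poly F} => p`_k) h.
have E (b1 x1 y1 x2 y2 : F) : genW3 b1 x1 y1 * genW1 x2 y2 =
  b1%:P + (b1 * x2)%:P * 'X + (b1 * y2)%:P * 'X^2 + x1%:P * 'X^3 + (x1 * x2)%:P * 'X^4 +
  (x1 * y2 )%:P * 'X^5 + y1%:P * 'X^6 + (y1 * x2)%:P * 'X^7 + (y1 * y2)%:P * 'X^8.
  by rewrite /genW3 /genW1; ring.
have := hc 0%N; have := hc 3%N; have := hc 6%N; rewrite !E !coefD !coefCM !coefXn !coefX !coefC /=.
by rewrite !(mulr0, mulr1, addr0, add0r).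
Qed.

(** Coefficients 0 and 1 determine [b] and [y]; coefficient 3 is [- x] plus a product of the two
    values of [y], which is the same on both sides. *)
Lemma blue_de_inj b x y b' x' y' : x != 0 -> x' != 0 ->
  blue_de b x y = blue_de b' x' y' -> [/\ b = b', x = x' & y = y'].
Proof.
move=> x0 x0' /eqP; rewrite /blue_de frac_eq ?genH0_neq0 // -!rmorphM tofrac_eq => /eqP h.
have hc k := congr1 (fun p : {poly F} => p`_k) h.
have E (b1 x1 y1 x2 y2 : F) : genH2 x2 y2 * genH0 b1 x1 y1 =
  (- b1)%:P + y1%:P * 'X + (- (y2 * b1))%:P * 'X^2 + (- x1 + y1 * y2)%:P * 'X^3 +
  (- (y2 * x1))%:P * 'X^5 + (x2 * b1)%:P * 'X^6 + (- (x2 * y1))%:P * 'X^7 + (x2 * x1)%:P * 'X^9.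
  by rewrite /genH2 /genH0 !polyCN !polyCD !polyCN !polyCM; ring.
have := hc 0%N; have := hc 1%N; have := hc 3%N; rewrite !E !coefD !coefCM !coefXn !coefX !coefC /=.
rewrite !(mulr0, mulr1, addr0, add0r) => e3 e1 e0.
split; [exact/esym/oppr_inj| |exact/esym].
by move: e3; rewrite e1 => /addIr/oppr_inj.
Qed.

(** [genH0] and [genH2] are built so that, once denominators are cleared, all positive powers of the
    transcendental variable cancel and an equation over [F] remains. *)
Lemma generic_meets b x y b' x' y' : x' != 0 ->
  (red_a x y + red_b x y * blue_de b' x' y' ==
   blue_c b' x' y' + blue_e b' x' y' * red_be b x y) = (x' * b - y' == x * b' - y).
Proof.
move=> x0; rewrite /red_a /red_b /blue_de /blue_c /blue_e /red_be.
have w0 := genW1_neq0 x y; have h0 := genH0_neq0 b' y' x0.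
have E (A : fieldType) (w w3 h h2 p q r s : A) : w != 0 -> h != 0 ->
    (p / w + q / w * (h2 / h) == r / h + s / h * (w3 / w)) =
    (p * h + q * h2 - r * w - s * w3 == 0).
  move=> wn hn; rewrite -subr_eq0.
  have -> : p / w + q / w * (h2 / h) - (r / h + s / h * (w3 / w)) =
     (p * h + q * h2 - r * w - s * w3) / (w * h) by field; rewrite hn wn.
  by rewrite mulf_eq0 invr_eq0 mulf_eq0 (negbTE wn) (negbTE hn) !orbF.
apply: etrans (E _ _ _ _ _ _ _ _ _ w0 h0) _.
set z : {poly F} := x%:P * genH0 b' x' y' + y%:P * genH2 x' y' - y'%:P * genW1 x y -
    (- x'%:P) * genW3 b x y.
have zE : z = (x' * b - y' - (x * b' - y))%:P.
  by rewrite /z /genH0 /genH2 /genW1 /genW3 !polyCB !polyCM; ring.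
transitivity (z == 0); last by rewrite zE polyC_eq0 subr_eq0.
rewrite -(tofrac_eq0 z); congr (_ == 0); symmetry.
exact: (rmorph_combination (@tofrac {poly F})).
Qed.

End GenericCoordinates.

Section IncidenceBound.
Variable F : finFieldType.
Variables X A B : {set F}.
Hypothesis X0 : 0 \notin X.

(* x (b - a) = x' (b' - a'), the unknowns being split into a red triple (b, x', a')
   and a blue triple (x, a, b'). *)
Definition solutions : {set (F * F * F) * (F * F * F)} :=
  [set w | let: ((b, x', a'), (x, a, b')) := w in
    [&& b \in B, x' \in X, a' \in A, x \in X, a \in A, b' \in B & x * (b - a) == x' * (b' - a')]].

Local Notation T := {u : F * F * F | u.1.2 != 0}.
Local Notation V := {u : F * F * F | u.1.1 != 0}.

Let be (u : T) := let: (b, x, a) := val u in red_be b x (x * a).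
Let ra (u : T) := let: (b, x, a) := val u in red_a x (x * a).
Let rb (u : T) := let: (b, x, a) := val u in red_b x (x * a).
Let de (v : V) := let: (x, a, b) := val v in blue_de b x (x * a).
Let bc (v : V) := let: (x, a, b) := val v in blue_c b x (x * a).
Let bee (v : V) := let: (x, a, b) := val v in blue_e b x (x * a).

Let be_inj : injective be.
Proof.
move=> [[[b x] a] /= x0] [[[b' x'] a'] /= x0']; rewrite /be /= => /red_be_inj[eb ex ey].
by apply: val_inj; subst; move: ey => /(mulfI x0') ->.
Qed.

Let de_inj : injective de.
Proof.
move=> [[[x a] b] /= x0] [[[x' a'] b'] /= x0']; rewrite /de /= => /(blue_de_inj x0 x0')[eb ex ey].
by apply: val_inj; subst; move: ey => /(mulfI x0') ->.
Qed.

Let meetsE (u : T) (v : V) : meets be ra rb de bc bee u v =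
  ((val v).1.1 * ((val u).1.1 - (val v).1.2) == (val u).1.2 * ((val v).2 - (val u).2)).
Proof.
move: u v => [[[b x'] a'] /= x0'] [[[x a] b'] /= x0].
by rewrite /meets /be /ra /rb /de /bc /bee /= generic_meets // !mulrBr.
Qed.

(* Two distinct triples (x, a, b') cut out a line in the variables (b, x', x'a'),
   on which b or x' is injective. *)
Lemma no_biclique (I2 : {set T}) (J2 : {set V}) :
    {in I2, forall u : T, (val u).1.1 \in B /\ (val u).1.2 \in X} ->
    {in I2 & J2, forall u v, meets be ra rb de bc bee u v} -> (1 < #|J2|)%N ->
  (#|I2| <= #|X| + #|B|)%N.
Proof.
move=> hI hm /card_gt1P[[[[x1 a1] b1] /= x10] [[[[x2 a2] b2] /= x20] [v1J v2J v12]]].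
have m1 u : u \in I2 -> x1 * ((val u).1.1 - a1) = (val u).1.2 * (b1 - (val u).2).
  by move=> uI; have := hm _ _ uI v1J; rewrite meetsE /= => /eqP.
have m2 u : u \in I2 -> x2 * ((val u).1.1 - a2) = (val u).1.2 * (b2 - (val u).2).
  by move=> uI; have := hm _ _ uI v2J; rewrite meetsE /= => /eqP.
have red_eq (u v : T) : u \in I2 -> v \in I2 -> (val u).1.1 = (val v).1.1 ->
    (val u).1.2 = (val v).1.2 -> u = v.
  move=> uI vI; have := m1 u uI; have := m1 v vI.
  move: u v uI vI => [[[b x] a] /= x0] [[[b' x'] a'] /= x0'] _ _ e1 e2 eb ex; apply: val_inj => /=.
  by subst; move: e1; rewrite e2 => /(mulfI x0')/addrI/oppr_inj ->.
have [x12|x12] := eqVneq x1 x2; last first.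
  apply: leq_trans (leq_addr _ _); rewrite -(@card_in_imset _ _ (fun u : T => (val u).1.2) I2).
    by apply: subset_leq_card; apply/subsetP => _ /imsetP[u uI ->]; case: (hI u uI).
  move=> u v uI vI /= ex; apply: red_eq => //.
  have := m1 u uI; have := m1 v vI; have := m2 u uI; have := m2 v vI; rewrite ex => e1 e2 e3 e4.
  have x12' : x1 - x2 != 0 by rewrite subr_eq0.
  apply: (mulfI x12'); apply/eqP; rewrite -subr_eq0; apply/eqP.
  have -> : (x1 - x2) * (val u).1.1 - (x1 - x2) * (val v).1.1 =
    x1 * ((val u).1.1 - a1) - x1 * ((val v).1.1 - a1) - (x2 * ((val u).1.1 - a2) - x2 * ((val v).1.1 - a2)) by ring.
  by rewrite e1 e2 e3 e4; ring.
apply: leq_trans (leq_addl _ _); rewrite -(@card_in_imset _ _ (fun u : T => (val u).1.1) I2).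
  by apply: subset_leq_card; apply/subsetP => _ /imsetP[u uI ->]; case: (hI u uI).
move=> u v uI vI /= ex; apply: red_eq => //; subst x2.
have := m1 u uI; have := m1 v vI; have := m2 u uI; have := m2 v vI => e1 e2 e3 e4.
have d u' : u' \in I2 -> (val u').1.2 * (b1 - b2) = x1 * (a2 - a1).
  move=> uI'; transitivity (x1 * ((val u').1.1 - a1) - x1 * ((val u').1.1 - a2)); last by ring.
  by rewrite m1 // m2 //; ring.
have b12 : b1 - b2 != 0.
  rewrite subr_eq0; apply: contra v12 => /eqP b12; apply/eqP/val_inj => /=; subst b2.
  have := d u uI; rewrite subrr mulr0 => /esym/eqP; rewrite mulf_eq0 (negbTE x10) /= subr_eq0.
  by move=> /eqP ->.
by apply: (mulIf b12); rewrite !d.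
Qed.

Let I1 : {set T} := [set u | [&& (val u).1.1 \in B, (val u).1.2 \in X & (val u).2 \in A]].
Let J1 : {set V} := [set v | [&& (val v).1.1 \in X, (val v).1.2 \in A & (val v).2 \in B]].

Let card_I1 : (#|I1| <= #|X| * #|A| * #|B|)%N.
Proof.
rewrite -(card_imset _ (@val_inj _ _ _)).
apply: (@leq_trans #|setX (setX B X) A|).
  apply: subset_leq_card; apply/subsetP => _ /imsetP[[[[b x] a] x0] + ->].
  by rewrite !inE /= => /and3P[-> -> ->].
by rewrite !cardsX; clear; nia.
Qed.

Let card_J1 : (#|J1| <= #|X| * #|A| * #|B|)%N.
Proof.
rewrite -(card_imset _ (@val_inj _ _ _)).
apply: (@leq_trans #|setX (setX X A) B|).
  apply: subset_leq_card; apply/subsetP => _ /imsetP[[[[b x] a] x0] + ->].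
  by rewrite !inE /= => /and3P[-> -> ->].
by rewrite !cardsX.
Qed.

Let card_solutions :
  #|solutions| = (\sum_(u in I1) #|nbJ be ra rb de bc bee J1 u|)%N.
Proof.
pose P (u : T) (v : V) := [&& u \in I1, v \in J1 & meets be ra rb de bc bee u v].
transitivity #|[set w : T * V | P w.1 w.2]|.
  rewrite -(card_imset (f := fun w : T * V => (val w.1, val w.2))); last first.
    by move=> [u v] [u' v'] /= [/val_inj -> /val_inj ->].
  apply: eq_card => -[[[b x'] a'] [[x a] b']]; apply/idP/imsetP.
    rewrite inE => /and5P[bB xX aA xX' /and3P[aA' bB' e]].
    have x0' : x' != 0 by apply: contraNneq X0 => <-.
    have x0 : x != 0 by apply: contraNneq X0 => <-.
    pose u : T := exist _ (b, x', a') x0'; pose v : V := exist _ (x, a, b') x0.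
    by exists (u, v); rewrite ?inE //= /P !inE meetsE /= bB xX aA xX' aA' bB' e.
  case=> [[[[[b1 x1] a1] /= x10] [[[x2 a2] b2] /= x20]]]; rewrite !inE /P !inE meetsE /=.
  move=> /and3P[/and3P[h1 h2 h3] /and3P[h4 h5 h6] h7] [-> -> -> -> -> ->].
  by rewrite h1 h2 h3 h4 h5 h6 h7.
exact: card_edges.
Qed.

(** With more solutions, pruning would leave a configuration containing a biclique with at least
    [|X| + |B| + 2] lines of each colour. The summand 2 provides both a second blue line and the
    excess of red lines that contradict [no_biclique]. *)
Lemma card_solutions_le p m : p \in [pchar F] -> (0 < m < p)%N ->
    (36 * 864 * (2 * (#|X| * #|A| * #|B|)) <= m ^ 2)%N ->
  (#|solutions| <= 2 * (#|X| * #|A| * #|B|) * (#|X| + #|B| + 2 + m))%N.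
Proof.
move=> pF /andP[m0 mp] hm; set n0 := (#|X| * #|A| * #|B|)%N.
rewrite leqNgt; apply/negP => hN.
set kap := (#|X| + #|B| + 2)%N in hN *.
have hIJ : (#|I1| + #|J1| <= 2 * n0)%N by rewrite mul2n -addnn leq_add.
have [|I2 [J2 [sI sJ cf]]] := @prune _ _ _ be ra rb de bc bee (kap + m) I1 J1.
  by rewrite -card_solutions; apply: leq_ltn_trans hN; rewrite leq_mul2r hIJ orbT.
(* The hypothesis [m < p] makes the integers up to [m] invertible, as the contact argument
   requires. *)
have chK k : (0 < k <= m)%N -> k%:R != 0 :> {fraction {poly F}}.
  move=> /andP[k0 km]; rewrite -(rmorph_nat (@tofrac {poly F})) tofrac_eq0.
  rewrite -polyC_natr polyC_eq0 -(dvdn_pcharf pF); apply/negP => /dvdn_leq.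
  by move=> /(_ k0); rewrite leqNgt (leq_ltn_trans km mp).
have [||I3 [J3 [s1 s2 k1 k2 hm3]]] := config_biclique be_inj de_inj chK (m := m) _ _ cf.
- by rewrite m0 leqnn.
- apply: leq_trans hm; rewrite leq_mul2l (leq_trans _ hIJ) ?orbT //.
  by rewrite leq_add // subset_leq_card.
have : (#|I3| <= #|X| + #|B|)%N.
  apply: no_biclique hm3 _.
    move=> u /(subsetP s1)/(subsetP sI); rewrite inE => /and3P[h1 h2 _]; by split.
  by apply: leq_trans k2; rewrite /kap addn2.
by rewrite leqNgt; apply/negP; rewrite negbK; apply: leq_trans k1; rewrite /kap addn2.
Qed.

End IncidenceBound.

(** * Multiplicative convolutions *)

Section CauchySchwarz.
Variable R : rcfType.

Lemma cauchy_schwarz (I : finType) (P : pred I) (f g : I -> R) :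
  (\sum_(i | P i) f i * g i) ^+ 2 <= (\sum_(i | P i) f i ^+ 2) * (\sum_(i | P i) g i ^+ 2).
Proof.
set a := \sum_(i | P i) f i ^+ 2; set b := \sum_(i | P i) f i * g i.
set c := \sum_(i | P i) g i ^+ 2.
have h x : 0 <= a * x ^+ 2 - 2 * b * x + c.
  have -> : a * x ^+ 2 - 2 * b * x + c = \sum_(i | P i) (f i * x - g i) ^+ 2.
    rewrite /a /b /c mulr_suml [2 * _]mulr_sumr mulr_suml -sumrB -big_split /=.
    by apply: eq_bigr => i _; ring.
  by apply: sumr_ge0 => i _; exact: sqr_ge0.
have a0 : 0 <= a by apply: sumr_ge0 => i _; exact: sqr_ge0.
have [az|anz] := eqVneq a 0.
  have b0 : b = 0.
    apply/eqP; rewrite /b big1 // => i Pi.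
    have := psumr_eq0P (fun i _ => sqr_ge0 (f i)) az; move=> /(_ i Pi)/eqP.
    by rewrite sqrf_eq0 => /eqP ->; rewrite mul0r.
  by rewrite b0 az expr0n mul0r.
have ap : 0 < a by rewrite lt_neqAle eq_sym anz.
have := h (b / a); have -> : a * (b / a) ^+ 2 - 2 * b * (b / a) + c = (a * c - b ^+ 2) / a by field.
by rewrite pmulr_lge0 ?invr_gt0 // subr_ge0.
Qed.

Lemma weighted_cauchy_schwarz (I : finType) (P : pred I) (w f : I -> R) :
  (\sum_(i | P i) w i * f i) ^+ 2 <=
  (\sum_(i | P i) `|w i|) * (\sum_(i | P i) `|w i| * f i ^+ 2).
Proof.
pose s i := Num.sqrt `|w i|; have sE i : s i ^+ 2 = `|w i| by rewrite sqr_sqrtr.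
pose g i := Num.sg (w i) * s i * f i.
have := cauchy_schwarz P s g.
have -> : \sum_(i | P i) s i * g i = \sum_(i | P i) w i * f i.
  apply: eq_bigr => i _; rewrite /g {2}[w i]numEsg -sE; ring.
under [X in _ <= X * _ -> _]eq_bigr do rewrite sE.
move=> /le_trans; apply; apply: ler_wpM2l; first by apply: sumr_ge0 => i _.
apply: ler_sum => i _; rewrite /g !exprMn sE -mulrA ler_piMl //; first by apply: mulr_ge0 => //; exact: sqr_ge0.
by rewrite sqr_sg; case: (_ != _); rewrite ?ler01.
Qed.

Lemma sqr_sum_le (n : nat) (f : 'I_n -> R) : (\sum_i f i) ^+ 2 <= n%:R * \sum_i f i ^+ 2.
Proof.
have := cauchy_schwarz xpredT (fun=> 1) f.
under eq_bigr do rewrite mul1r; under [X in _ <= X * _ -> _]eq_bigr do rewrite expr1n.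
by rewrite sumr_const card_ord.
Qed.

End CauchySchwarz.

Section Convolution.
Variables (R : rcfType) (F : finFieldType).
Implicit Types (w r al bt : F -> R) (x y z l : F).

Definition conv w r l := \sum_(x | x != 0) w x * r (l / x).
Definition diffconv al bt z := \sum_b al b * bt (b - z).
Definition nz1 w := \sum_(x | x != 0) `|w x|.
Definition nz2 w := \sum_(x | x != 0) w x ^+ 2.
Definition center w x := w x - (\sum_(x | x != 0) w x) / (#|F|.-1)%:R.

Lemma nz1_ge0 w : 0 <= nz1 w. Proof. exact: sumr_ge0. Qed.
Lemma nz2_ge0 w : 0 <= nz2 w. Proof. by apply: sumr_ge0 => x _; exact: sqr_ge0. Qed.

Lemma sum_units_divl (g : F -> R) x : x != 0 ->
  \sum_(l | l != 0) g (l / x) = \sum_(l | l != 0) g l.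
Proof.
move=> x0; rewrite (reindex (fun l => l * x)) /=; last first.
  by exists (fun l => l / x) => y _ /=; [rewrite mulfK|rewrite mulfVK].
by apply: eq_big => [l|l _]; rewrite ?mulf_eq0 ?negb_or ?x0 ?andbT ?mulfK.
Qed.

Lemma convC w r l : l != 0 -> conv w r l = conv r w l.
Proof.
move=> l0; rewrite /conv (reindex_onto (fun x => l / x) (fun x => l / x)) /=; last first.
  by move=> x x0; rewrite invf_div mulrC mulfVK.
apply: eq_big => [x|x _]; last by rewrite invf_div [in r _]mulrCA mulfV // mulr1 [RHS]mulrC.
have [->|x0] := eqVneq x 0; first by rewrite invr0 mulr0 eqxx.
by rewrite invf_div mulrCA mulfV // mulr1 eqxx mulf_neq0 ?invr_eq0.
Qed.

Lemma young1 w r : nz2 (conv w r) <= nz1 w ^+ 2 * nz2 r.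
Proof.
apply: le_trans (_ : \sum_(l | l != 0) nz1 w * (\sum_(x | x != 0) `|w x| * r (l / x) ^+ 2) <= _).
  by apply: ler_sum => l _; exact: weighted_cauchy_schwarz.
rewrite -mulr_sumr exchange_big /= expr2 -mulrA ler_wpM2l ?nz1_ge0 //.
rewrite mulr_suml; apply: ler_sum => x x0; rewrite -mulr_sumr.
by rewrite (sum_units_divl (fun z => r z ^+ 2)).
Qed.

Lemma young2 w r : nz2 (conv w r) <= nz2 w * nz1 r ^+ 2.
Proof.
rewrite mulrC; apply: le_trans (young1 r w); rewrite /nz2 le_eqVlt.
by apply/orP; left; apply/eqP/eq_bigr => l l0; rewrite convC.
Qed.

Lemma sum_conv w r : \sum_(l | l != 0) conv w r l =
  (\sum_(x | x != 0) w x) * \sum_(x | x != 0) r x.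
Proof.
rewrite exchange_big /= mulr_suml; apply: eq_bigr => x x0.
by rewrite -mulr_sumr (sum_units_divl r).
Qed.

Lemma card_units : (\sum_(x : F | x != 0) 1 = (#|F|.-1)%:R :> R) * (0 < (#|F|.-1)%:R :> R).
Proof.
have c : #|[pred x : F | x != 0]| = #|F|.-1.
  by rewrite -(cardC1 0); apply: eq_card => x; rewrite !inE.
split; first by rewrite sumr_const c.
rewrite ltr0n -c; apply/card_gt0P; exists 1; rewrite inE; exact: oner_neq0.
Qed.

Lemma sum_center w : \sum_(x | x != 0) center w x = 0.
Proof.
rewrite sumrB; set S := \sum_(x | x != 0) w x; have [c c0] := card_units.
have -> : \sum_(x : F | x != 0) S / (#|F|.-1)%:R = S / (#|F|.-1)%:R * \sum_(x : F | x != 0) 1.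
  by rewrite mulr_sumr; apply: eq_bigr => x _; rewrite mulr1.
by rewrite c mulfVK ?subrr // gt_eqF.
Qed.

Lemma nz2_center w : nz2 (center w) <= nz2 w.
Proof.
have [c c0] := card_units.
set m := (\sum_(x | x != 0) w x) / (#|F|.-1)%:R.
have -> : nz2 w = nz2 (center w) + m ^+ 2 * (#|F|.-1)%:R.
  rewrite -c mulr_sumr /nz2.
  transitivity (\sum_(x | x != 0) (center w x ^+ 2 + m ^+ 2 * 1 + 2 * m * center w x)).
    by apply: eq_bigr => x _; rewrite /center -/m; ring.
  by rewrite !big_split /= -!mulr_sumr sum_center mulr0 addr0.
by rewrite lerDl mulr_ge0 ?sqr_ge0 ?ltW.
Qed.

(** Convolution with [r] sends constants on the nonzero residues to constants, so it commutes with
    the removal of the mean. *)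
Lemma conv_center w r l : l != 0 -> conv (center w) r l = center (conv w r) l.
Proof.
move=> l0; rewrite /center sum_conv /conv.
have -> : \sum_(x | x != 0) r x = \sum_(x | x != 0) r (l / x).
  rewrite (reindex_onto (fun x => l / x) (fun x => l / x)) /=; last first.
    by move=> x x0; rewrite invf_div mulrC mulfVK.
  apply: eq_bigl => x; have [->|x0] := eqVneq x 0; first by rewrite invr0 mulr0 eqxx.
  by rewrite invf_div mulrCA mulfV // mulr1 eqxx mulf_neq0 ?invr_eq0.
rewrite mulrAC mulr_sumr -sumrB; apply: eq_bigr => x _; ring.
Qed.

Lemma nz2_eq w w' : (forall x, x != 0 -> w x = w' x) -> nz2 w = nz2 w'.
Proof. by move=> h; apply: eq_bigr => x /h ->. Qed.

Lemma nz2_conv_center w r : nz2 (conv (center w) r) <= nz2 (conv w r).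
Proof. by rewrite (@nz2_eq _ (center (conv w r))) ?nz2_center // => l; exact: conv_center. Qed.

(* (l, a) |-> (a + l / x, a + l / x') is a bijection of F x F when x <> x'. *)
Lemma two_lines_sum al x x' : x != 0 -> x' != 0 -> x != x' ->
  \sum_l \sum_a al (a + l / x) * al (a + l / x') = (\sum_a al a) ^+ 2.
Proof.
move=> x0 x0' xx'; rewrite pair_bigA /= expr2 mulr_suml.
under [RHS]eq_bigr do rewrite mulr_sumr; rewrite pair_bigA /=.
have d0 : x^-1 - x'^-1 != 0 by rewrite subr_eq0 (inj_eq invr_inj).
rewrite [RHS](reindex (fun w : F * F => (w.2 + w.1 / x, w.2 + w.1 / x'))) //=.
exists (fun w : F * F => ((w.1 - w.2) / (x^-1 - x'^-1), w.1 - (w.1 - w.2) / (x^-1 - x'^-1) / x)).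
  move=> [l a] _ /=; have -> : (a + l / x - (a + l / x')) / (x^-1 - x'^-1) = l.
    by apply: (mulIf d0); rewrite mulfVK //; ring.
  by rewrite addrK.
move=> [u v] _ /=; congr pair; first by rewrite subrK.
have -> : u - (u - v) / (x^-1 - x'^-1) / x + (u - v) / (x^-1 - x'^-1) / x' =
  u - (u - v) / (x^-1 - x'^-1) * (x^-1 - x'^-1) by ring.
by rewrite mulfVK //; ring.
Qed.

(** Cauchy-Schwarz in [a] leaves the second moment of [g]. Its off-diagonal correlations [k x x']
    all equal [S1], so the zero mean of [w] turns their total into [- nz2 w * S1], and the diagonal
    gives the bound. *)
Lemma spectral w al bt : \sum_(x | x != 0) w x = 0 ->
  nz2 (conv w (diffconv al bt)) <=
  #|F|%:R * nz2 w * (\sum_a al a ^+ 2) * (\sum_a bt a ^+ 2).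
Proof.
move=> w0; pose g l a := \sum_(x | x != 0) w x * al (a + l / x).
have cE l : conv w (diffconv al bt) l = \sum_a bt a * g l a.
  rewrite /conv /diffconv /g; under [RHS]eq_bigr do rewrite mulr_sumr.
  rewrite exchange_big /=; apply: eq_bigr => x _; rewrite mulr_sumr.
  rewrite (reindex (fun a => a + l / x)) /=; last first.
    by exists (fun a => a - l / x) => y _ /=; [rewrite addrK|rewrite subrK].
  by apply: eq_bigr => a _; rewrite addrK; ring.
apply: le_trans (_ : (\sum_a bt a ^+ 2) * (\sum_l \sum_a g l a ^+ 2) <= _).
  rewrite mulr_sumr /nz2 [leRHS](bigID (fun l => l != 0)) /=.
  apply: le_trans (_ : _ <= \sum_(l | l != 0) (\sum_a bt a ^+ 2) * (\sum_a g l a ^+ 2)) _.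
    by apply: ler_sum => l _; rewrite cE; exact: cauchy_schwarz.
  rewrite lerDl; apply: sumr_ge0 => l _; apply: mulr_ge0; apply: sumr_ge0 => a _; exact: sqr_ge0.
rewrite mulrC ler_wpM2r //; first by apply: sumr_ge0 => a _; exact: sqr_ge0.
pose k x x' := \sum_l \sum_a al (a + l / x) * al (a + l / x').
have -> : \sum_l \sum_a g l a ^+ 2 = \sum_(x | x != 0) \sum_(x' | x' != 0) w x * w x' * k x x'.
  rewrite /g; under eq_bigr => l _ do under eq_bigr => a _ do rewrite expr2 mulr_suml.
  under eq_bigr => l _ do (rewrite exchange_big /=; under eq_bigr => x _ do
    under eq_bigr => a _ do rewrite mulr_sumr).
  rewrite exchange_big /=; apply: eq_bigr => x _.
  under eq_bigr => l _ do rewrite exchange_big /=.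
  rewrite exchange_big /=; apply: eq_bigr => x' _; rewrite /k mulr_sumr.
  apply: eq_bigr => l _; rewrite mulr_sumr; apply: eq_bigr => a _; ring.
set S1 := (\sum_a al a) ^+ 2; set S2 := \sum_a al a ^+ 2.
have kE x : x != 0 -> k x x = #|F|%:R * S2.
  move=> x0; rewrite /k; transitivity (\sum_(l : F) S2); last by rewrite big_const iter_addr_0 mulr_natl.
  apply: eq_bigr => l _; rewrite /S2 (reindex (fun a => a - l / x)) /=; last first.
    by exists (fun a => a + l / x) => y _ /=; [rewrite subrK|rewrite addrK].
  by apply: eq_bigr => a _; rewrite subrK expr2.
have rowE x : x != 0 -> \sum_(x' | x' != 0) w x * w x' * k x x' =
    w x ^+ 2 * (#|F|%:R * S2) - w x ^+ 2 * S1.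
  move=> x0; rewrite (bigD1 x) //= kE // expr2; congr (_ + _).
  transitivity (w x * (\sum_(x' | (x' != 0) && (x' != x)) w x') * S1).
    rewrite mulr_sumr mulr_suml; apply: eq_bigr => x' /andP[x0' xx'].
    by rewrite /k two_lines_sum // eq_sym.
  have := w0; rewrite (bigD1 x) //= => /eqP; rewrite addr_eq0 eq_sym => /eqP.
  by move=> /(canRL (@opprK _)) ->; ring.
rewrite (eq_bigr _ rowE) sumrB -!mulr_suml -/(nz2 w).
have : 0 <= nz2 w * S1 by rewrite mulr_ge0 ?nz2_ge0 ?sqr_ge0.
by move: (nz2 w * S1) => t t0; rewrite lerBlDr mulrCA mulrA lerDl.
Qed.

End Convolution.

(** * The convolution of two functions of one dyadic level *)

Section Pieces.
Variables (R : realType) (F : finFieldType).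
Implicit Types (w al bt : F -> R).

Lemma nz1_diffconv al bt : nz1 (diffconv al bt) <= (\sum_b `|al b|) * (\sum_b `|bt b|).
Proof.
apply: le_trans (_ : \sum_z \sum_b `|al b| * `|bt (b - z)| <= _).
  rewrite [leRHS](bigID (fun z => z != 0)) /=.
  apply: le_trans (_ : _ <= \sum_(z | z != 0) \sum_b `|al b| * `|bt (b - z)|) _.
    apply: ler_sum => z _; apply: le_trans (ler_norm_sum _ _ _) _.
    by apply: ler_sum => b _; rewrite normrM.
  by rewrite lerDl; do 2!apply: sumr_ge0 => ? _; rewrite mulr_ge0.
rewrite exchange_big /= mulr_suml; apply: ler_sum => b _; rewrite -mulr_sumr ler_wpM2l //.
rewrite (reindex (fun z => b - z)) /=; last by exists (fun z => b - z) => z _ /=; rewrite opprB addrC subrK.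
by apply: ler_sum => z _; rewrite opprB addrC subrK.
Qed.

Lemma nz2_diffconv al bt :
  nz2 (diffconv al bt) <= (\sum_b `|bt b|) ^+ 2 * (\sum_b al b ^+ 2).
Proof.
have rE z : diffconv al bt z = \sum_c bt c * al (c + z).
  rewrite /diffconv (reindex (fun c => c + z)) /=; last first.
    by exists (fun c => c - z) => c _ /=; [rewrite addrK|rewrite subrK].
  by apply: eq_bigr => c _; rewrite addrK mulrC.
apply: le_trans (_ : \sum_z (\sum_c `|bt c|) * (\sum_c `|bt c| * al (c + z) ^+ 2) <= _).
  rewrite /nz2 [leRHS](bigID (fun z => z != 0)) /=.
  apply: le_trans (_ : _ <= \sum_(z | z != 0) (\sum_c `|bt c|) * (\sum_c `|bt c| * al (c + z) ^+ 2)) _.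
    by apply: ler_sum => z _; rewrite rE; exact: weighted_cauchy_schwarz.
  rewrite lerDl; apply: sumr_ge0 => z _; apply: mulr_ge0; first exact: sumr_ge0.
  by apply: sumr_ge0 => c _; apply: mulr_ge0 => //; exact: sqr_ge0.
rewrite -mulr_sumr expr2 -mulrA ler_wpM2l ?sumr_ge0 // exchange_big /= mulr_suml.
apply: ler_sum => c _; rewrite -mulr_sumr ler_wpM2l //.
rewrite [leRHS](reindex (fun z => c + z)) //=.
by exists (fun z => z - c) => z _ /=; rewrite ?(addrC c) ?addrK ?subrK.
Qed.

Lemma sum_indicator (X : {set F}) (k : R) : \sum_x k * (x \in X)%:R = k * #|X|%:R.
Proof.
rewrite -mulr_sumr; congr (_ * _); rewrite -sum1_card natr_sum [RHS]big_mkcond.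
by apply: eq_bigr => x _; case: (x \in X).
Qed.

Variables (p : nat).
Hypotheses (pF : p \in [pchar F]) (cF : #|F| = p).

Section OnePiece.
Variables (w al : F -> R) (X A B : {set F}) (u v : R).
Hypotheses (X0 : 0 \notin X) (u0 : 0 <= u) (v0 : 0 <= v).
Hypothesis hw : forall x, x != 0 -> `|w x| <= 2 * u * (x \in X)%:R.
Hypothesis hal : forall b, `|al b| <= 2 * v * (b \in B)%:R.
Local Notation bt := (indic R A).
Local Notation r := (diffconv al bt).
Local Notation n0 := (#|X| * #|A| * #|B|)%N.

Let sum_bt : \sum_b `|bt b| = #|A|%:R.
Proof.
rewrite -[RHS]mul1r -sum_indicator; apply: eq_bigr => b _.
by rewrite /indic mul1r ger0_norm.
Qed.

Let sum_bt2 : \sum_b bt b ^+ 2 = #|A|%:R.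
Proof.
rewrite -[RHS]mul1r -sum_indicator; apply: eq_bigr => b _.
by rewrite /indic mul1r; case: (b \in A); rewrite ?expr1n ?expr0n.
Qed.

Let sum_al : \sum_b `|al b| <= 2 * v * #|B|%:R.
Proof. by rewrite -sum_indicator; exact: ler_sum. Qed.

Let sqr_le (k x : R) (bb : bool) : `|x| <= 2 * k * bb%:R -> x ^+ 2 <= 4 * k ^+ 2 * bb%:R.
Proof.
case: bb; rewrite ?mulr1 ?mulr0 => h; last by move: h; rewrite normr_le0 => /eqP ->; rewrite expr0n.
by rewrite -real_normK ?num_real //; move: (normr_ge0 x) h; move: `|x| => y; nra.
Qed.

Let sum_al2 : \sum_b al b ^+ 2 <= 4 * v ^+ 2 * #|B|%:R.
Proof. by rewrite -sum_indicator; apply: ler_sum => b _; apply: sqr_le. Qed.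

Let nz1_w : nz1 w <= 2 * u * #|X|%:R.
Proof.
rewrite -sum_indicator /nz1 [leRHS](bigID (fun x => x != 0)) /= -[leLHS]addr0.
apply: lerD; first exact: ler_sum.
by apply: sumr_ge0 => x _; rewrite !mulr_ge0.
Qed.

Let nz2_w : nz2 w <= 4 * u ^+ 2 * #|X|%:R.
Proof.
rewrite -sum_indicator /nz2 [leRHS](bigID (fun x => x != 0)) /= -[leLHS]addr0.
apply: lerD; first by apply: ler_sum => x x0; apply/sqr_le/hw.
by apply: sumr_ge0 => x _; rewrite !mulr_ge0 ?sqr_ge0.
Qed.

Let hits l := [set t : F * F * F | [&& t.1.1 \in X, t.1.2 \in B, t.2 \in A & t.1.1 * (t.1.2 - t.2) == l]].

Let conv_le l : l != 0 -> `|conv w r l| <= 4 * (u * v) * #|hits l|%:R.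
Proof.
move=> l0; apply: le_trans (ler_norm_sum _ _ _) _.
apply: le_trans (_ : \sum_(x | x != 0) \sum_b
    4 * (u * v) * ([&& x \in X, b \in B & b - l / x \in A])%:R <= _).
  apply: ler_sum => x x0; rewrite normrM.
  apply: le_trans (ler_wpM2l (normr_ge0 _) (ler_norm_sum _ _ _)) _.
  rewrite mulr_sumr; apply: ler_sum => b _; rewrite normrM.
  have := hw x0; have := hal b; rewrite /indic; case: (x \in X); case: (b \in B); rewrite ?mulr1 ?mulr0 /=.
  - case: (_ \in A); rewrite ?normr1 ?normr0 ?mulr1 ?mulr0 ?mulr0 //.
    by move: (normr_ge0 (w x)) (normr_ge0 (al b)); nra.
  - by rewrite normr_le0 => /eqP ->; rewrite normr0 mul0r mulr0.
  - by move=> _; rewrite normr_le0 => /eqP ->; rewrite normr0 mul0r.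
  by move=> _; rewrite normr_le0 => /eqP ->; rewrite normr0 mul0r.
under eq_bigr do rewrite -mulr_sumr; rewrite -mulr_sumr ler_wpM2l ?mulr_ge0 //.
rewrite pair_big_dep /=.
pose g (w' : F * F) := (w'.1, w'.2, w'.2 - l / w'.1).
have gi : injective g by move=> [x b] [x' b'] [-> ->].
rewrite -sum1_card natr_sum [leRHS]big_mkcond /= .
apply: le_trans (_ : \sum_(t in [set g w' | w' in [set w' : F * F | (w'.1 != 0)]]) (t \in hits l)%:R <= _).
  rewrite big_imset /=; last by move=> x y _ _; exact: gi.
  rewrite le_eqVlt; apply/orP; left; apply/eqP; apply: eq_big => [[x b]|[x b] /= x0].
    by rewrite inE andbT.
  move: x0; rewrite andbT => x0; rewrite inE /=; have -> : x * (b - (b - l / x)) = l.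
    by rewrite opprB addrCA subrr addr0 mulrC mulfVK.
  by rewrite eqxx andbT.
rewrite big_mkcond; apply: ler_sum => t _; case: ifP => _; first by case: (t \in _).
by case: ifP.
Qed.

Let sum_hits : \sum_l (#|hits l|%:R : R) ^+ 2 <= #|solutions X A B|%:R.
Proof.
pose D := [set q : (F * F * F) * (F * F * F) | [&& q.1 \in hits (q.1.1.1 * (q.1.1.2 - q.1.2)) &
   q.2 \in hits (q.1.1.1 * (q.1.1.2 - q.1.2))]].
have -> : \sum_l (#|hits l|%:R : R) ^+ 2 = #|D|%:R.
  rewrite -sum1_card natr_sum.
  have E l : (#|hits l|%:R : R) = \sum_t (t \in hits l)%:R.
    by rewrite -sum1_card natr_sum big_mkcond; apply: eq_bigr => t _; case: ifP.
  transitivity (\sum_l \sum_t \sum_t' (t \in hits l)%:R * (t' \in hits l)%:R : R).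
    apply: eq_bigr => l _; rewrite E expr2 mulr_suml; apply: eq_bigr => t _.
    by rewrite mulr_sumr.
  rewrite exchange_big /=; under eq_bigr do rewrite exchange_big /=; rewrite pair_bigA /=.
  rewrite [RHS]big_mkcond /=;apply: eq_bigr => -[t t'] _ /=; rewrite (bigD1 (t.1.1 * (t.1.2 - t.2))) //= big1 ?addr0.
    have -> : ((t, t') \in D) = (t \in hits (t.1.1 * (t.1.2 - t.2))) &&
        (t' \in hits (t.1.1 * (t.1.2 - t.2))) by rewrite in_set.
    by case: (t \in hits _); case: (t' \in hits _); rewrite ?mulr1 ?mulr0 ?mul0r.
  move=> l /negbTE nl; rewrite [t \in _]inE (eq_sym _ l) nl !andbF mul0r //.
rewrite ler_nat.
pose f (q : (F * F * F) * (F * F * F)) : (F * F * F) * (F * F * F) :=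
  let: ((x, b, a), (x', b', a')) := q in ((b, x', a'), (x, a, b')).
have fi : injective f by move=> [[[x b] a] [[x' b'] a']] [[[y c] d] [[y' c'] d']] [-> -> -> -> -> ->].
rewrite -(card_imset _ fi); apply: subset_leq_card; apply/subsetP => _ /imsetP[q + ->].
case: q => [[[x b] a] [[x' b'] a']]; rewrite !inE /= eqxx andbT.
move=> /andP[/and3P[h1 h2 h3] /and4P[h4 h5 h6 h7]].
by rewrite h1 h2 h3 h4 h5 h6 eq_sym.
Qed.

(** Every regime gives [16 * (u * v) ^ 2 * (n0 * c)] for some [c <= 1008 * s], where 16 is
    [(2 * 2) ^ 2] from the two hypotheses on sizes, and [16 * 1008 <= 20000]. Young's inequality
    covers [|X| > |A||B|] and [|B| > |X||A|]; otherwise [|X|] and [|B|] are at most [s]. *)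
Lemma piece_bound : nz2 (conv (center w) r) <=
  20000 * (u * v) ^+ 2 * (n0%:R * Num.sqrt n0%:R).
Proof.
set s := Num.sqrt n0%:R; have s2 : s ^+ 2 = n0%:R :> R by rewrite sqr_sqrtr ?ler0n.
have s0 : 0 <= s by exact: sqrtr_ge0.
have n0E : n0%:R = #|X|%:R * #|A|%:R * #|B|%:R :> R by rewrite !natrM.
have X0' : 0 <= #|X|%:R :> R by []. have A0' : 0 <= #|A|%:R :> R by []. have B0' : 0 <= #|B|%:R :> R by [].
have uv0 : 0 <= (u * v) ^+ 2 by exact: sqr_ge0.
have suff1 (V c : R) : V <= 16 * (u * v) ^+ 2 * (n0%:R * c) -> c <= 1008 * s ->
    V <= 20000 * (u * v) ^+ 2 * (n0%:R * s).
  move=> /le_trans hV hc; apply: hV.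
  have h : n0%:R * c <= 1008 * (n0%:R * s) by rewrite mulrCA; apply: ler_wpM2l.
  have h2 : 0 <= n0%:R * s by apply: mulr_ge0.
  have := ler_wpM2l uv0 h; have := mulr_ge0 uv0 h2.
  move: ((u * v) ^+ 2) (n0%:R * s) (n0%:R * c) => q y z.
  by lra.
have le_s (x y : R) : 0 <= x -> 0 <= y -> x ^+ 2 <= s ^+ 2 -> x <= 1008 * s.
  move=> x0 y0 h; apply: le_trans (_ : s <= _); last by lra.
  by rewrite -ler_sqr ?nnegrE.
have nz1r := le_trans (nz1_diffconv al bt) (ler_wpM2r _ sum_al).
have {}nz1r : nz1 r <= 2 * v * #|B|%:R * #|A|%:R by move: nz1r; rewrite sum_bt; apply.
have nz2r : nz2 r <= 4 * v ^+ 2 * #|B|%:R * #|A|%:R ^+ 2.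
  apply: le_trans (nz2_diffconv al bt) _; rewrite sum_bt mulrC ler_wpM2r ?sqr_ge0 //.
have [hX|hX] := ltnP (#|A| * #|B|) #|X|.
  apply: (suff1 _ (#|A| * #|B|)%:R).
    apply: le_trans (nz2_conv_center w r) _; apply: le_trans (young2 w r) _.
    have -> : 16 * (u * v) ^+ 2 * (n0%:R * (#|A| * #|B|)%:R) =
      4 * u ^+ 2 * #|X|%:R * (2 * v * #|B|%:R * #|A|%:R) ^+ 2 by rewrite n0E natrM; ring.
    apply: ler_pM => //; [exact: nz2_ge0|exact: sqr_ge0|].
    by rewrite ler_sqr ?nnegrE ?nz1_ge0 // !mulr_ge0.
  apply: (le_s _ 0) => //; rewrite s2 -natrX ler_nat; move: hX; clear; nia.
have [hB|hB] := ltnP (#|X| * #|A|) #|B|.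
  apply: (suff1 _ (#|X| * #|A|)%:R).
    apply: le_trans (nz2_conv_center w r) _; apply: le_trans (young1 w r) _.
    have -> : 16 * (u * v) ^+ 2 * (n0%:R * (#|X| * #|A|)%:R) =
      (2 * u * #|X|%:R) ^+ 2 * (4 * v ^+ 2 * #|B|%:R * #|A|%:R ^+ 2) by rewrite n0E natrM; ring.
    apply: ler_pM => //; [exact: sqr_ge0|exact: nz2_ge0|].
    by rewrite ler_sqr ?nnegrE ?nz1_ge0 // !mulr_ge0.
  apply: (le_s _ 0) => //; rewrite s2 -natrX ler_nat; move: hB; clear; nia.
have [n00|n0p] := posnP n0.
  apply: (suff1 _ (#|X| * #|A|)%:R).
    apply: le_trans (nz2_conv_center w r) _; apply: le_trans (young1 w r) _.
    have -> : 16 * (u * v) ^+ 2 * (n0%:R * (#|X| * #|A|)%:R) =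
      (2 * u * #|X|%:R) ^+ 2 * (4 * v ^+ 2 * #|B|%:R * #|A|%:R ^+ 2) by rewrite n0E natrM; ring.
    apply: ler_pM => //; [exact: sqr_ge0|exact: nz2_ge0|].
    by rewrite ler_sqr ?nnegrE ?nz1_ge0 // !mulr_ge0.
  apply: (le_s _ 0) => //; rewrite s2 -natrX ler_nat; move: hB hX n00; clear.
  by move=> hB hX /eqP; rewrite !muln_eq0 => /orP[/orP[]|] /eqP h; move: hB hX; rewrite h; nia.
have s1 : 1 <= s.
  by rewrite -[leLHS]sqrtr1 ler_sqrt ?ler0n // ler1n.
(* The least [m] admissible in the incidence bound. It is at most [500 * s], because
   [36 * 864 * 2 < 250 ^ 2] and [1 <= s]. *)
have exm : exists m, (36 * 864 * (2 * n0) <= m ^ 2)%N.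
  by exists (36 * 864 * (2 * n0))%N; move: (36 * 864 * (2 * n0))%N => y; clear; nia.
case: (ex_minnP exm) => m hm minm.
have m0 : (0 < m)%N by move: hm n0p; case: (m) => //; clear; lia.
have ms : m%:R <= 500 * s.
  rewrite -ler_sqr ?nnegrE ?mulr_ge0 // exprMn s2 -natrX -natrX -natrM ler_nat.
  have : ~~ (36 * 864 * (2 * n0) <= m.-1 ^ 2)%N.
    by apply/negP => /minm; rewrite leqNgt prednK // leqnn.
  rewrite -ltnNge; move: m0 n0p; clear; case: (m) => // m' _ n0p; rewrite /= => h.
  have : (m'.+1 ^ 2 <= 4 * m' ^ 2 + 4)%N by nia.
  by move: h n0p; move: (n0) => y; rewrite -[500%N]/(50 * 10)%N; nia.
have [mp|mp] := ltnP m p.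
  (* The four summands are at most [s], [s], [2 * s] and [500 * s], whence 1008. *)
  apply: (suff1 _ (2 * (#|X| + #|B| + 2 + m)%:R)).
    apply: le_trans (nz2_conv_center w r) _.
    apply: le_trans (_ : _ <= \sum_l (4 * (u * v) * #|hits l|%:R) ^+ 2) _.
      rewrite /nz2 [leRHS](bigID (fun l => l != 0)) /= -[leLHS]addr0; apply: lerD.
        apply: ler_sum => l l0; rewrite -real_normK ?num_real // ler_sqr ?nnegrE //; first exact: conv_le.
        by rewrite !mulr_ge0.
      by apply: sumr_ge0 => l _; exact: sqr_ge0.
    under eq_bigr do rewrite exprMn; rewrite -mulr_sumr.
    have -> : (4 * (u * v)) ^+ 2 = 16 * (u * v) ^+ 2 by ring.
    apply: ler_wpM2l; first by apply: mulr_ge0.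
    apply: le_trans sum_hits _; rewrite mulrCA mulrA -natrM -natrM ler_nat.
    by apply: (card_solutions_le X0 pF); rewrite ?m0.
  have hX2 : #|X|%:R <= s.
    by rewrite -ler_sqr ?nnegrE // s2 -natrX ler_nat; move: hX; clear; nia.
  have hB2 : #|B|%:R <= s.
    by rewrite -ler_sqr ?nnegrE // s2 -natrX ler_nat; move: hB; clear; nia.
  by rewrite !natrD; lra.
(* Now [p <= m <= 500 * s], so the factor [p] of the spectral bound is small enough. *)
apply: (suff1 _ p%:R); last first.
  by apply: le_trans (_ : m%:R <= _); [rewrite ler_nat|lra].
apply: le_trans (spectral _ _ (sum_center w)) _; rewrite cF sum_bt2.
have -> : 16 * (u * v) ^+ 2 * (n0%:R * p%:R) =
  p%:R * (4 * u ^+ 2 * #|X|%:R) * (4 * v ^+ 2 * #|B|%:R) * #|A|%:R by rewrite n0E; ring.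
apply: ler_wpM2r => //; apply: ler_pM => //.
- by rewrite mulr_ge0 ?nz2_ge0.
- by apply: sumr_ge0 => x _; exact: sqr_ge0.
by apply: ler_wpM2l => //; apply: le_trans (nz2_center w) nz2_w.
Qed.

End OnePiece.
End Pieces.

(** * Dyadic decomposition *)

Section Dyadic.
Variables (R : realType) (F : finFieldType).
Implicit Types (w al bt f : F -> R).

Definition dyadic_piece f (W : R) i x :=
  if (W / 2 ^+ i.+1 < `|f x|) && (`|f x| <= W / 2 ^+ i) then f x else 0.
Definition dyadic_tail f (W : R) i x := if `|f x| <= W / 2 ^+ i then f x else 0.

Lemma dyadic_decomposition f W M x : 0 <= W -> `|f x| <= W ->
  f x = \sum_(i < M) dyadic_piece f W i x + dyadic_tail f W M x.
Proof.
move=> W0 fW; elim: M => [|M IHM].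
  by rewrite big_ord0 add0r /dyadic_tail expr0 divr1 fW.
rewrite {1}IHM big_ord_recr /= -addrA; congr (_ + _).
rewrite /dyadic_tail /dyadic_piece; have [h|h] := leP `|f x| (W / 2 ^+ M.+1).
  have -> : `|f x| <= W / 2 ^+ M.
    apply: le_trans h _; rewrite ler_wpM2l // lef_pV2 ?posrE ?exprn_gt0 //.
    by rewrite exprS ler_peMl ?exprn_ge0 // ler1n.
  by rewrite add0r.
by case: ifP => _; rewrite addr0.
Qed.

Lemma nz2_sum_le n (g : 'I_n -> F -> R) (c : R) :
  (forall i, nz2 (g i) <= c) -> nz2 (fun x => \sum_i g i x) <= n%:R ^+ 2 * c.
Proof.
move=> hg; apply: le_trans (_ : \sum_(x | x != 0) n%:R * \sum_i g i x ^+ 2 <= _).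
  by apply: ler_sum => x _; exact: sqr_sum_le.
rewrite -mulr_sumr exchange_big /= expr2 -mulrA ler_wpM2l ?ler0n //.
apply: le_trans (_ : \sum_(i < n) c <= _).
  by apply: ler_sum => i _; exact: hg.
by rewrite big_const card_ord iter_addr_0 mulr_natl.
Qed.

(** [T] is additive and [f] is a sum of [M.+1] functions, which costs the square of their number:
    the source of all logarithms. *)
Lemma dyadic_operator (T : (F -> R) -> F -> R) f W M c :
    (forall n (g : 'I_n -> F -> R) l, T (fun x => \sum_i g i x) l = \sum_i T (g i) l) ->
    (forall g h, g =1 h -> T g =1 T h) -> 0 <= W -> (forall x, `|f x| <= W) ->
    (forall i, (i < M)%N -> nz2 (T (dyadic_piece f W i)) <= c) ->
    nz2 (T (dyadic_tail f W M)) <= c ->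
  nz2 (T f) <= M.+1%:R ^+ 2 * c.
Proof.
move=> Tadd Text W0 fW hp ht.
pose g (i : 'I_M.+1) := if (i < M)%N then dyadic_piece f W i else dyadic_tail f W M.
have fE : f =1 fun x => \sum_i g i x.
  move=> x; rewrite (dyadic_decomposition M W0 (fW x)) big_ord_recr /= /g ltnn.
  by congr (_ + _); apply: eq_bigr => i _; rewrite /= ltn_ord.
rewrite (@nz2_eq _ _ _ (fun l => \sum_i T (g i) l)); last first.
  by move=> l _; rewrite (Text _ _ fE) Tadd.
apply: nz2_sum_le => i; rewrite /g; case: ifP => h; [exact: hp|exact: ht].
Qed.

Lemma conv_sumr w n (g : 'I_n -> F -> R) bt l :
  conv w (diffconv (fun x => \sum_i g i x) bt) l = \sum_i conv w (diffconv (g i) bt) l.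
Proof.
rewrite exchange_big /=; apply: eq_bigr => x _; rewrite -mulr_sumr; congr (_ * _).
by rewrite exchange_big /=; apply: eq_bigr => b _; rewrite mulr_suml.
Qed.

Lemma conv_center_suml n (g : 'I_n -> F -> R) r l :
  conv (center (fun x => \sum_i g i x)) r l = \sum_i conv (center (g i)) r l.
Proof.
rewrite exchange_big /=; apply: eq_bigr => x _; rewrite -mulr_suml; congr (_ * _).
by rewrite /center exchange_big /= mulr_suml sumrB.
Qed.

Lemma eq_conv_center (g h : F -> R) r : g =1 h -> conv (center g) r =1 conv (center h) r.
Proof.
by move=> gh l; apply: eq_bigr => x _; rewrite /center gh; under eq_bigr do rewrite gh.
Qed.

Lemma eq_conv_diffconv w (g h : F -> R) bt : g =1 h ->
  conv w (diffconv g bt) =1 conv w (diffconv h bt).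
Proof.
by move=> gh l; apply: eq_bigr => x _; congr (_ * _); apply: eq_bigr => b _; rewrite gh.
Qed.

Definition level f (W : R) i := [set x | (W / 2 ^+ i.+1 < `|f x|) && (`|f x| <= W / 2 ^+ i)].

Lemma dyadic_piece_le f W i x :
  `|dyadic_piece f W i x| <= 2 * (W / 2 ^+ i.+1) * (x \in level f W i)%:R.
Proof.
rewrite /dyadic_piece inE; case: ifP => [/andP[_ h]|_]; last by rewrite normr0 mulr0.
rewrite mulr1; suff -> : 2 * (W / 2 ^+ i.+1) = W / 2 ^+ i by [].
by rewrite exprS; field; rewrite expf_neq0 ?pnatr_eq0.
Qed.

(** Used with [n = 1] and [n = 2]: a level of height [u] on a set [X] has [u |X|] below the first
    norm and [u |X|^(1/2)] below the second. *)
Lemma level_sum_le f W i n : 0 <= W ->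
  (W / 2 ^+ i.+1) ^+ n * #|level f W i|%:R <= \sum_x `|f x| ^+ n.
Proof.
move=> W0; rewrite -sum_indicator; apply: ler_sum => x _.
have c0 : 0 <= W / 2 ^+ i.+1 by rewrite mulr_ge0 // invr_ge0 exprn_ge0.
rewrite inE; case: andP => [[h _]|_]; rewrite ?mulr1 ?mulr0 ?exprn_ge0 //.
by apply: lerXn2r; rewrite ?nnegrE // ltW.
Qed.

Lemma dyadic_tail_sqr f W M : 0 <= W ->
  \sum_x dyadic_tail f W M x ^+ 2 <= W / 2 ^+ M * \sum_x `|f x|.
Proof.
move=> W0; rewrite mulr_sumr; apply: ler_sum => x _; rewrite /dyadic_tail.
have c0 : 0 <= W / 2 ^+ M by rewrite mulr_ge0 // invr_ge0 exprn_ge0.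
case: ifP => h; last by rewrite expr0n mulr_ge0.
by rewrite -real_normK ?num_real // expr2 ler_wpM2r.
Qed.

Variables (p : nat) (A : {set F}).
Hypotheses (pF : p \in [pchar F]) (cF : #|F| = p) (A0 : (0 < #|A|)%N).
Local Notation bt := (indic R A).
Local Notation sA := (Num.sqrt (#|A|%:R : R)).

Lemma sum_indic : \sum_b `|bt b| = #|A|%:R.
Proof.
rewrite -[RHS]mul1r -sum_indicator; apply: eq_bigr => b _.
by rewrite /indic mul1r ger0_norm.
Qed.

(** For a level of [w], the estimate [(u v)^2 (|X||A||B|)^(3/2)] splits into [u |X|], [u |X|^(1/2)],
    [v |B|] and [v |B|^(1/2)], each below a norm. The condition on [M] makes the tail small enough
    for Young's inequality. *)
Lemma step_one_level w al (B : {set F}) v (a1 a2 : R) M :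
    \sum_(x | x != 0) w x = 0 -> 0 <= v -> 0 <= a1 -> 0 <= a2 ->
    (forall b, `|al b| <= 2 * v * (b \in B)%:R) ->
    v * #|B|%:R <= a1 -> v ^+ 2 * #|B|%:R <= a2 ^+ 2 -> a1 * sA <= 2 ^+ M * a2 ->
  nz2 (conv w (diffconv al bt)) <=
  M.+1%:R ^+ 2 * (20000 * (nz1 w * Num.sqrt (nz2 w)) * (a1 * a2) * (#|A|%:R * sA)).
Proof.
move=> w0 v0 a10 a20 hal hB1 hB2 hM.
have sA0 : 0 <= sA by exact: sqrtr_ge0.
have sA2 : sA ^+ 2 = #|A|%:R by rewrite sqr_sqrtr.
set W2 := Num.sqrt (nz2 w); have W20 : 0 <= W2 by exact: sqrtr_ge0.
have W2E : W2 ^+ 2 = nz2 w by rewrite sqr_sqrtr ?nz2_ge0.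
(* The value 0 at 0 keeps 0 out of the level sets. *)
pose f x := if x == 0 then 0 else w x.
have fE x : x != 0 -> f x = w x by move=> x0; rewrite /f (negbTE x0).
have sumf (g : R -> R) : g 0 = 0 -> \sum_x g (f x) = \sum_(x | x != 0) g (w x).
  move=> g0; rewrite (bigD1 0) //= /f eqxx g0 add0r; apply: eq_bigr => x /negbTE ->; by [].
have f1 : \sum_x `|f x| = nz1 w by rewrite (sumf (fun y => `|y|)) ?normr0.
have f2 : \sum_x `|f x| ^+ 2 = W2 ^+ 2.
  rewrite (sumf (fun y => `|y| ^+ 2)) ?normr0 ?expr0n // W2E.
  by apply: eq_bigr => x _; rewrite real_normK ?num_real.
rewrite (@nz2_eq _ _ _ (conv (center f) (diffconv al bt))); last first.
  move=> l _; apply: eq_bigr => x x0; rewrite /center fE //.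
  have -> : \sum_(y | y != 0) f y = 0 by rewrite -[RHS]w0; apply: eq_bigr => y /fE.
  by rewrite mul0r subr0.
apply: (@dyadic_operator (fun f => conv (center f) (diffconv al bt)) f W2) => //.
- by move=> n g l; exact: conv_center_suml.
- by move=> g h; exact: eq_conv_center.
- move=> x; rewrite -ler_sqr ?nnegrE // -f2 (bigD1 x) //= lerDl.
  by apply: sumr_ge0 => y _; exact: exprn_ge0.
- move=> i _; set X := level f W2 i; set u := W2 / 2 ^+ i.+1.
  have u0 : 0 <= u by rewrite mulr_ge0 // invr_ge0 exprn_ge0.
  have X0 : 0 \notin X.
    by rewrite inE /f eqxx normr0 ltNge u0.
  apply: le_trans (piece_bound pF cF A X0 u0 v0 (fun x _ => dyadic_piece_le f W2 i x) hal) _.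
  rewrite -/X -/u !natrM.
  have hu1 : u * #|X|%:R <= nz1 w.
    rewrite -f1; have := level_sum_le f i 1 W20; rewrite expr1 => /le_trans; apply.
    by apply: ler_sum => x _; rewrite expr1.
  have hu2 : u ^+ 2 * #|X|%:R <= W2 ^+ 2 by rewrite -f2; exact: level_sum_le.
  have sqr_bd (k x y : R) : 0 <= k -> 0 <= y -> 0 <= x -> k ^+ 2 * x <= y ^+ 2 -> k * Num.sqrt x <= y.
    move=> k0 y0 x0 h; rewrite -ler_sqr ?nnegrE ?mulr_ge0 ?sqrtr_ge0 //.
    by rewrite exprMn sqr_sqrtr.
  have hX := sqr_bd _ _ _ u0 W20 (ler0n _ _) hu2.
  have hB := sqr_bd _ _ _ v0 a20 (ler0n _ _) hB2.
  rewrite !sqrtrM ?mulr_ge0 //; clearbody u.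
  set sX := Num.sqrt #|X|%:R; set sB := Num.sqrt #|B|%:R.
  have sX0 : 0 <= sX by exact: sqrtr_ge0. have sB0 : 0 <= sB by exact: sqrtr_ge0.
  have -> : 20000 * (u * v) ^+ 2 * (#|X|%:R * #|A|%:R * #|B|%:R * (sX * sA * sB)) =
    20000 * ((u * #|X|%:R) * (u * sX)) * ((v * #|B|%:R) * (v * sB)) * (#|A|%:R * sA) by ring.
  apply: ler_wpM2r; first by rewrite mulr_ge0.
  apply: ler_pM; rewrite ?mulr_ge0 //.
    by apply: ler_wpM2l => //; apply: ler_pM; rewrite ?mulr_ge0.
  by apply: ler_pM; rewrite ?mulr_ge0.
apply: le_trans (nz2_conv_center _ _) _; apply: le_trans (young2 _ _) _.
have al1 : \sum_b `|al b| <= 2 * a1.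
  apply: le_trans (_ : 2 * (v * #|B|%:R) <= _); last by rewrite ler_wpM2l.
  by rewrite mulrA -sum_indicator; exact: ler_sum.
have r1 : nz1 (diffconv al bt) <= 2 * a1 * #|A|%:R.
  by apply: le_trans (nz1_diffconv _ _) _; rewrite sum_indic ler_wpM2r.
have ft : nz2 (dyadic_tail f W2 M) <= W2 / 2 ^+ M * nz1 w.
  apply: le_trans (_ : \sum_x dyadic_tail f W2 M x ^+ 2 <= _).
    rewrite [leRHS](bigID (fun x => x != 0)) /= lerDl.
    by apply: sumr_ge0 => x _; exact: sqr_ge0.
  by apply: le_trans (dyadic_tail_sqr f M W20) _; rewrite f1.
apply: le_trans (ler_pM (nz2_ge0 _) (sqr_ge0 _) ft (_ : _ <= (2 * a1 * #|A|%:R) ^+ 2)) _.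
  by rewrite ler_sqr ?nnegrE ?nz1_ge0 ?mulr_ge0.
have e2 : 0 < 2 ^+ M :> R by rewrite exprn_gt0.
have hM' : a1 * sA / 2 ^+ M <= a2 by rewrite ler_pdivrMr // [leRHS]mulrC.
have -> : W2 / 2 ^+ M * nz1 w * (2 * a1 * #|A|%:R) ^+ 2 =
  4 * (nz1 w * W2) * (a1 * (a1 * sA / 2 ^+ M)) * (#|A|%:R * sA).
  by move: sA2; move: (Num.sqrt _) => s <-; ring.
apply: ler_wpM2r; first by rewrite mulr_ge0.
apply: ler_pM; rewrite ?mulr_ge0 ?nz1_ge0 ?invr_ge0 ?(ltW e2) //.
  by apply: ler_wpM2r; rewrite ?mulr_ge0 ?nz1_ge0 // ler_nat.
exact: ler_wpM2l.
Qed.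

(** The tail of [al] is not a level. There the geometric mean of the two Young inequalities yields
    the required product of norms, which is why squares are compared. *)
Lemma step_all_levels w al M (a1 := \sum_b al b) (a2 := Num.sqrt (\sum_b al b ^+ 2)) :
    \sum_(x | x != 0) w x = 0 -> (forall b, 0 <= al b) -> a1 * #|A|%:R <= 2 ^+ M * a2 ->
  nz2 (conv w (diffconv al bt)) <=
  M.+1%:R ^+ 4 * (20000 * (nz1 w * Num.sqrt (nz2 w)) * (a1 * a2) * (#|A|%:R * sA)).
Proof.
move=> w0 al0 hM.
have sA0 : 0 <= sA by exact: sqrtr_ge0.
have sA2 : sA ^+ 2 = #|A|%:R by rewrite sqr_sqrtr.
have sA1 : sA <= #|A|%:R.
  have : 1 <= sA by rewrite -[leLHS]sqrtr1 ler_sqrt ?ler0n // ler1n.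
  by move: sA2; move: (Num.sqrt _) => s <- ?; nra.
have a10 : 0 <= a1 by exact: sumr_ge0.
have a20 : 0 <= a2 by exact: sqrtr_ge0.
have a2E : a2 ^+ 2 = \sum_b al b ^+ 2 by rewrite sqr_sqrtr // sumr_ge0 // => b _; exact: sqr_ge0.
have f1 : \sum_x `|al x| = a1 by apply: eq_bigr => x _; rewrite ger0_norm.
have f2 : \sum_x `|al x| ^+ 2 = a2 ^+ 2.
  by rewrite a2E; apply: eq_bigr => x _; rewrite ger0_norm.
set c := 20000 * _ * _ * _.
have -> : M.+1%:R ^+ 4 * c = M.+1%:R ^+ 2 * (M.+1%:R ^+ 2 * c) by ring.
have W0 : 0 <= nz1 w * Num.sqrt (nz2 w) by rewrite mulr_ge0 ?nz1_ge0 ?sqrtr_ge0.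
apply: (@dyadic_operator (fun g => conv w (diffconv g bt)) al a2) => //.
- by move=> n g l; exact: conv_sumr.
- by move=> g h; exact: eq_conv_diffconv.
- move=> x; rewrite -ler_sqr ?nnegrE // -f2 (bigD1 x) //= lerDl.
  by apply: sumr_ge0 => y _; exact: exprn_ge0.
- move=> i _; apply: (@step_one_level _ _ (level al a2 i) (a2 / 2 ^+ i.+1)) => //.
  + by rewrite mulr_ge0 // invr_ge0 exprn_ge0.
  + by move=> b; exact: dyadic_piece_le.
  + rewrite -f1; have := level_sum_le al i 1 a20; rewrite expr1 => /le_trans; apply.
    by apply: ler_sum => x _; rewrite expr1.
  + by rewrite -f2; exact: level_sum_le.
  by apply: le_trans hM; rewrite ler_wpM2l.
set at_ := dyadic_tail al a2 M; set r := diffconv at_ bt.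
have at1 : \sum_b `|at_ b| <= a1.
  rewrite -f1; apply: ler_sum => x _; rewrite /at_ /dyadic_tail; case: ifP => _ //.
  by rewrite normr0.
have r1 : nz1 r <= a1 * #|A|%:R.
  by apply: le_trans (nz1_diffconv _ _) _; rewrite sum_indic ler_wpM2r.
have e2 : 0 < 2 ^+ M :> R by rewrite exprn_gt0.
have r2 : nz2 r <= #|A|%:R * a2 ^+ 2.
  apply: le_trans (nz2_diffconv _ _) _; rewrite sum_indic.
  apply: le_trans (ler_wpM2l (sqr_ge0 _) (dyadic_tail_sqr al M a20)) _; rewrite f1.
  have -> : #|A|%:R ^+ 2 * (a2 / 2 ^+ M * a1) = #|A|%:R * (a2 * (a1 * #|A|%:R / 2 ^+ M)) :> R by ring.
  by rewrite ler_wpM2l // expr2 ler_wpM2l // ler_pdivrMr // [leRHS]mulrC.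
have V0 := nz2_ge0 (conv w r).
have y1 := young1 w r; have y2 := young2 w r.
have c0 : 0 <= c.
  by apply: mulr_ge0; [apply: mulr_ge0; [apply: mulr_ge0|apply: mulr_ge0]|apply: mulr_ge0].
apply: le_trans (_ : c <= _); last by rewrite ler_peMl // -natrX ler1n expn_gt0.
rewrite -ler_sqr ?nnegrE //.
apply: le_trans (_ : (nz1 w ^+ 2 * nz2 r) * (nz2 w * nz1 r ^+ 2) <= _).
  by rewrite expr2; apply: ler_pM.
have -> : c ^+ 2 = 20000 ^+ 2 * ((nz1 w ^+ 2 * (#|A|%:R * a2 ^+ 2)) * (nz2 w * (a1 * #|A|%:R) ^+ 2)).
  rewrite /c -[X in _ = _ * (_ * (X * _))](sqr_sqrtr (nz2_ge0 w)).
  move: (Num.sqrt (nz2 w)) => s; move: sA2; move: (Num.sqrt #|A|%:R) => s' <-; ring.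
apply: le_trans (_ : (nz1 w ^+ 2 * (#|A|%:R * a2 ^+ 2)) * (nz2 w * (a1 * #|A|%:R) ^+ 2) <= _).
  apply: ler_pM.
  - exact: mulr_ge0 (sqr_ge0 _) (nz2_ge0 _).
  - exact: mulr_ge0 (nz2_ge0 _) (sqr_ge0 _).
  - exact: ler_wpM2l (sqr_ge0 _) _ _ _.
  apply: ler_wpM2l (nz2_ge0 _) _ _ _; apply: lerXn2r => //; rewrite nnegrE ?nz1_ge0 //.
  exact: mulr_ge0.
apply: ler_peMl.
  apply: mulr_ge0; apply: mulr_ge0; rewrite ?sqr_ge0 ?nz2_ge0 //.
  by apply: mulr_ge0 => //; exact: sqr_ge0.
by rewrite -natrX ler1n expn_gt0.
Qed.

End Dyadic.

(** * Representations as products of differences *)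

Section Products.
Variables (R : realType) (F : finFieldType).
Implicit Types (w al bt : F -> R).

Lemma sum_ffun_recl k (f : F -> {ffun 'I_k -> F} -> R) :
  \sum_(z : {ffun 'I_k.+1 -> F}) f (z ord0) [ffun i => z (lift ord0 i)] =
  \sum_x \sum_(z : {ffun 'I_k -> F}) f x z.
Proof.
rewrite pair_bigA /=.
pose h (q : F * {ffun 'I_k -> F}) : {ffun 'I_k.+1 -> F} :=
  [ffun i => if unlift ord0 i is Some j then q.2 j else q.1].
have h0 q : h q ord0 = q.1 by rewrite ffunE unlift_none.
have hS q : [ffun i => h q (lift ord0 i)] = q.2.
  by apply/ffunP => i; rewrite !ffunE liftK.
rewrite (reindex h) /=; last first.
  exists (fun z : {ffun 'I_k.+1 -> F} => (z ord0, [ffun i => z (lift ord0 i)])) => [q|z] _.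
    by rewrite h0 hS; case: q.
  by apply/ffunP => i; rewrite ffunE; case: unliftP => [j ->|-> //]; rewrite ffunE.
by apply: eq_bigr => q _; rewrite h0 hS.
Qed.

Definition product_rep w k l := \sum_(z : {ffun 'I_k -> F} | \prod_i z i == l) \prod_i w (z i).

Lemma product_rep_total w k : \sum_l product_rep w k l = (\sum_z w z) ^+ k.
Proof.
transitivity (\prod_(i < k) \sum_z w z); last by rewrite prodr_const card_ord.
rewrite bigA_distr_bigA /= /product_rep; under eq_bigr do rewrite big_mkcond /=.
rewrite exchange_big; apply: eq_bigr => z _; rewrite (bigD1 (\prod_i z i)) //= eqxx [X in _ + X]big1 ?addr0 //.
by move=> l /negbTE; rewrite eq_sym => ->.
Qed.

Lemma product_repS w k l : product_rep w k.+1 l =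
  \sum_x w x * \sum_(z : {ffun 'I_k -> F} | x * \prod_i z i == l) \prod_i w (z i).
Proof.
rewrite /product_rep big_mkcond /=.
transitivity (\sum_x \sum_(z : {ffun 'I_k -> F})
   if x * \prod_i z i == l then w x * \prod_i w (z i) else 0).
  rewrite -sum_ffun_recl; apply: eq_bigr => z _; rewrite !big_ord_recl.
  set y := [ffun i => z (lift ord0 i)].
  have -> : \prod_(i < k) z (lift ord0 i) = \prod_i y i.
    by apply: eq_bigr => i _; rewrite ffunE.
  have -> // : \prod_(i < k) w (z (lift ord0 i)) = \prod_i w (y i).
  by apply: eq_bigr => i _; rewrite ffunE.
by apply: eq_bigr => x _; rewrite mulr_sumr [RHS]big_mkcond.
Qed.

Lemma product_repS_unit w k l : l != 0 -> product_rep w k.+1 l = conv (product_rep w k) w l.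
Proof.
move=> l0; rewrite convC // product_repS (bigD1 0) //= big1 ?mulr0 ?add0r; last first.
  by move=> z; rewrite mul0r eq_sym (negbTE l0).
apply: eq_bigr => x x0; congr (_ * _); apply: eq_bigl => z.
by rewrite [x * _]mulrC; apply/eqP/eqP => [<-|->]; rewrite ?mulfK ?mulfVK.
Qed.

Lemma product_rep1 w l : l != 0 -> product_rep w 1 l = w l.
Proof.
move=> l0; rewrite product_repS.
have e x : \sum_(z : {ffun 'I_0 -> F} | x * \prod_i z i == l) \prod_i w (z i) = (x == l)%:R.
  under eq_bigr do rewrite big_ord0; under eq_bigl do rewrite big_ord0 mulr1.
  case: (x == l); last by rewrite big_pred0_eq.
  by rewrite big_const card_ffun card_ord expn0 /= addr0.
under eq_bigr do rewrite e; rewrite (bigD1 l) //= eqxx mulr1 [X in _ + X]big1 ?addr0 //.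
by move=> x /negbTE ->; rewrite mulr0.
Qed.

Lemma product_rep_ge0 w k l : (forall x, 0 <= w x) -> 0 <= product_rep w k l.
Proof. by move=> w0; apply: sumr_ge0 => z _; apply: prodr_ge0. Qed.

(** A zero product has a zero factor in one of [k.+1] positions, and the other factors are free. *)
Lemma product_rep_zero w k : (forall x, 0 <= w x) ->
  product_rep w k.+1 0 <= k.+1%:R * w 0 * (\sum_x w x) ^+ k.
Proof.
move=> w0; set S := \sum_x w x; have S0 : 0 <= S by exact: sumr_ge0.
have rec n : product_rep w n.+1 0 <= w 0 * S ^+ n + S * product_rep w n 0.
  rewrite product_repS (bigD1 0) //=; apply: lerD.
    rewrite ler_wpM2l // -product_rep_total /product_rep.
    under [leRHS]eq_bigr do rewrite big_mkcond /=.
    rewrite exchange_big big_mkcond /=; apply: ler_sum => z _; rewrite mul0r eqxx.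
    rewrite (bigD1 (\prod_i z i)) //= eqxx lerDl; apply: sumr_ge0 => l _.
    by case: ifP => _ //; apply: prodr_ge0.
  rewrite /S [leRHS]mulr_suml [leRHS](bigD1 0) //= -[leLHS]add0r; apply: lerD.
    by rewrite mulr_ge0 // product_rep_ge0.
  apply: ler_sum => x x0; rewrite ler_wpM2l // le_eqVlt; apply/orP; left; apply/eqP.
  by apply: eq_bigl => z; rewrite mulf_eq0 (negbTE x0).
elim: k => [|k IHk].
  apply: le_trans (rec 0%N) _; rewrite /product_rep big_pred0 ?mulr0 ?addr0 ?mul1r //.
  by move=> z; rewrite big_ord0 oner_eq0.
apply: le_trans (rec _) _; apply: le_trans (lerD (lexx _) (ler_wpM2l S0 IHk)) _.
rewrite le_eqVlt; apply/orP; left; apply/eqP; rewrite -[k.+2%:R]natr1 exprS; ring.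
Qed.

End Products.

(** * Product energies and variances *)

Section Counting.
Variables (R : realType) (F : finFieldType).
Implicit Types (w al bt : F -> R).

Lemma product_rep_diffconv al bt k l : product_rep (diffconv al bt) k l =
  \sum_(x : {ffun 'I_k -> F}) \sum_(y : {ffun 'I_k -> F} | \prod_i (x i - y i) == l)
    \prod_i (al (x i) * bt (y i)).
Proof.
transitivity (\sum_(x : {ffun 'I_k -> F}) \sum_(z : {ffun 'I_k -> F} | \prod_i z i == l)
    \prod_i (al (x i) * bt (x i - z i))).
  rewrite exchange_big /=; apply: eq_bigr => z _.
  by rewrite /diffconv bigA_distr_bigA.
apply: eq_bigr => x _; rewrite (reindex (fun y : {ffun 'I_k -> F} => [ffun i => x i - y i])) /=.
  apply: eq_big => y.
    by congr (_ == l); apply: eq_bigr => i _; rewrite ffunE.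
  by move=> _; apply: eq_bigr => i _; rewrite ffunE opprB addrC subrK.
by exists (fun y : {ffun 'I_k -> F} => [ffun i => x i - y i]) => y _; apply/ffunP => i;
  rewrite !ffunE opprB addrC subrK.
Qed.

Lemma DtimesF_sum_sqr al bt k :
  DtimesF k al bt = \sum_l product_rep (diffconv al bt) k l ^+ 2.
Proof.
pose P (x y : {ffun 'I_k -> F}) := \prod_i (al (x i) * bt (y i)).
pose D (x y : {ffun 'I_k -> F}) := \prod_i (x i - y i).
transitivity (\sum_x \sum_y P x y * product_rep (diffconv al bt) k (D x y)).
  apply: eq_bigr => x _; apply: eq_bigr => y _; rewrite product_rep_diffconv mulr_sumr.
  apply: eq_bigr => x' _; rewrite mulr_sumr; apply: eq_big => y'; first by rewrite eq_sym.
  by move=> _; rewrite /P -big_split /=; apply: eq_bigr => i _; rewrite mulrA.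
have E l : product_rep (diffconv al bt) k l = \sum_x \sum_y (if D x y == l then P x y else 0).
  by rewrite product_rep_diffconv; apply: eq_bigr => x _; rewrite big_mkcond.
symmetry; transitivity (\sum_l \sum_x \sum_y
   (if D x y == l then P x y else 0) * product_rep (diffconv al bt) k l).
  apply: eq_bigr => l _; rewrite expr2 {1}E mulr_suml; apply: eq_bigr => x _.
  by rewrite mulr_suml.
rewrite exchange_big /=; apply: eq_bigr => x _; rewrite exchange_big /=; apply: eq_bigr => y _.
rewrite (bigD1 (D x y)) //= eqxx [X in _ + X]big1 ?addr0 //.
by move=> l /negbTE h; rewrite eq_sym h mul0r.
Qed.

Lemma sum_diffconv al bt : \sum_z diffconv al bt z = (\sum_b al b) * (\sum_b bt b).
Proof.
rewrite exchange_big /= mulr_suml; apply: eq_bigr => b _; rewrite -mulr_sumr; congr (_ * _).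
rewrite (reindex (fun z => b - z)) /=; last by exists (fun z => b - z) => z _ /=; rewrite opprB addrC subrK.
by apply: eq_bigr => z _; rewrite opprB addrC subrK.
Qed.

(** [EplusF] is defined by sums and [diffconv] by differences. Expanding both squares leaves
    correlations of [bt], which the reflection [x -> b + b' - x] exchanges. *)
Lemma sum_sqr_diffconv al bt : \sum_z diffconv al bt z ^+ 2 = EplusF al bt.
Proof.
have L (f g : F -> F -> R) : (forall b b', \sum_z f z b * f z b' = \sum_x g x b * g x b') ->
    \sum_z (\sum_b al b * f z b) ^+ 2 = \sum_x (\sum_b al b * g x b) ^+ 2.
  move=> h; have E (f' : F -> F -> R) : \sum_z (\sum_b al b * f' z b) ^+ 2 =
      \sum_b \sum_b' al b * al b' * \sum_z f' z b * f' z b'.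
    transitivity (\sum_z \sum_b \sum_b' al b * al b' * (f' z b * f' z b')).
      apply: eq_bigr => z _; rewrite expr2 mulr_suml; apply: eq_bigr => b _.
      by rewrite mulr_sumr; apply: eq_bigr => b' _; ring.
    rewrite exchange_big /=; apply: eq_bigr => b _; rewrite exchange_big /=; apply: eq_bigr => b' _.
    by rewrite mulr_sumr.
  by rewrite !E; apply: eq_bigr => b _; apply: eq_bigr => b' _; rewrite h.
apply: (L (fun z b => bt (b - z)) (fun x b => bt (x - b))) => b b'.
rewrite (reindex (fun x => b + b' - x)) /=; last first.
  by exists (fun x => b + b' - x) => x _ /=; ring.
by apply: eq_bigr => x _; rewrite mulrC; congr (bt _ * bt _); ring.
Qed.

(** The diagonal solutions alone give this much. *)
Lemma EplusF_ge al bt : (forall x, 0 <= al x) -> (forall x, 0 <= bt x) ->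
  (\sum_x al x ^+ 2) * (\sum_x bt x ^+ 2) <= EplusF al bt.
Proof.
move=> al0 bt0; apply: le_trans (_ : \sum_x \sum_y (al y * bt (x - y)) ^+ 2 <= _).
  rewrite exchange_big /= mulr_suml; apply: ler_sum => y _.
  rewrite (reindex (fun x => x - y)) /=; last first.
    by exists (fun x => x + y) => x _ /=; [rewrite subrK|rewrite addrK].
  rewrite le_eqVlt mulr_sumr; apply/orP; left; apply/eqP; apply: eq_bigr => x _.
  by rewrite exprMn.
apply: ler_sum => x _; rewrite [leRHS]expr2 mulr_suml; apply: ler_sum => y _.
rewrite expr2 ler_wpM2l ?mulr_ge0 // (bigD1 y) //= lerDl.
by apply: sumr_ge0 => z _; rewrite mulr_ge0.
Qed.

Lemma nz2_centerE w :
  nz2 w = nz2 (center w) + (\sum_(x | x != 0) w x) ^+ 2 / (#|F|.-1)%:R.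
Proof.
have [c c0] := @card_units R F.
set s := \sum_(x | x != 0) w x; set m := s / (#|F|.-1)%:R.
have -> : s ^+ 2 / (#|F|.-1)%:R = m ^+ 2 * (#|F|.-1)%:R by rewrite /m; field; rewrite gt_eqF.
rewrite -c mulr_sumr /nz2.
transitivity (\sum_(x | x != 0) (center w x ^+ 2 + m ^+ 2 * 1 + 2 * m * center w x)).
  by apply: eq_bigr => x _; rewrite /center -/s -/m; ring.
by rewrite !big_split /= -!mulr_sumr sum_center mulr0 addr0.
Qed.

Lemma nz1_center w : nz1 (center w) <= 2 * nz1 w.
Proof.
have [c c0] := @card_units R F; set s := \sum_(x | x != 0) w x.
apply: le_trans (_ : \sum_(x | x != 0) (`|w x| + `|s| / (#|F|.-1)%:R * 1) <= _).
  apply: ler_sum => x _; apply: le_trans (ler_normB _ _) _.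
  by rewrite mulr1 normrM (ger0_norm (_ : 0 <= _^-1)) // invr_ge0 ltW.
rewrite big_split /= -mulr_sumr c mulfVK ?gt_eqF // mulr2n mulrDl mul1r lerD2l.
exact: ler_norm_sum.
Qed.

Lemma nz1_conv w r : nz1 (conv w r) <= nz1 w * nz1 r.
Proof.
apply: le_trans (_ : \sum_(l | l != 0) \sum_(x | x != 0) `|w x| * `|r (l / x)| <= _).
  by apply: ler_sum => l _; apply: le_trans (ler_norm_sum _ _ _) _;
    apply: ler_sum => x _; rewrite normrM.
rewrite exchange_big /= mulr_suml; apply: ler_sum => x x0.
by rewrite -mulr_sumr (sum_units_divl (fun z => `|r z|)).
Qed.

Lemma center_ext w w' l : (forall x, x != 0 -> w x = w' x) -> l != 0 -> center w l = center w' l.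
Proof. by move=> h l0; rewrite /center (h l l0) (eq_bigr w' h). Qed.

Section Recursion.
Variables (r : F -> R) (S c : R).
Hypotheses (S0 : 0 <= S) (c0 : 0 <= c) (rS : nz1 r <= S).
Hypothesis step : forall w, \sum_(x | x != 0) w x = 0 ->
  nz2 (conv w r) <= c * (nz1 w * Num.sqrt (nz2 w)).

Lemma nz1_product_rep k : nz1 (product_rep r k.+1) <= S ^+ k.+1.
Proof.
elim: k => [|k IHk].
  by rewrite expr1; apply: le_trans rS; apply: ler_sum => l l0; rewrite product_rep1.
apply: le_trans (_ : nz1 (product_rep r k.+1) * nz1 r <= _).
  apply: le_trans (nz1_conv _ _).
  by apply: ler_sum => l l0; rewrite product_repS_unit.
by rewrite exprSr; apply: ler_pM; rewrite ?nz1_ge0.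
Qed.

(** Centering commutes with convolution, so the one-step hypothesis applies to the centered
    representation function; centering at most doubles its first norm, hence the factor 2. *)
Lemma variance_step k : nz2 (center (product_rep r k.+2)) <=
  2 * c * S ^+ k.+1 * Num.sqrt (nz2 (center (product_rep r k.+1))).
Proof.
set N := product_rep r k.+1.
rewrite (@nz2_eq _ _ _ (conv (center N) r)); last first.
  move=> l l0; rewrite (conv_center _ _ l0); apply: center_ext => // x x0.
  by rewrite product_repS_unit.
apply: le_trans (step (sum_center N)) _.
rewrite [2 * c]mulrC -!mulrA ler_wpM2l // mulrA ler_wpM2r ?sqrtr_ge0 //.
apply: le_trans (nz1_center _) _; rewrite ler_wpM2l //; exact: nz1_product_rep.
Qed.

End Recursion.

Section Deviation.
Variables (al bt : F -> R).
Hypotheses (al0 : forall x, 0 <= al x) (bt0 : forall x, 0 <= bt x).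
Local Notation S := ((\sum_x al x) * (\sum_x bt x)).
Local Notation T2 := ((\sum_x al x ^+ 2) * (\sum_x bt x ^+ 2)).
Local Notation r := (diffconv al bt).
Local Notation q := (#|F|%:R : R).

Let r0 z : 0 <= r z. Proof. by apply: sumr_ge0 => b _; rewrite mulr_ge0. Qed.
Let S0 : 0 <= S. Proof. by rewrite mulr_ge0 ?sumr_ge0. Qed.
Let T20 : 0 <= T2. Proof. by apply: mulr_ge0; apply: sumr_ge0 => x _; exact: sqr_ge0. Qed.
Let F1 : (1 < #|F|)%N.
Proof. by have [_] := @card_units R F; rewrite ltr0n; case: #|F| => [|[|]]. Qed.
Let q2 : 2 <= q. Proof. by rewrite ler_nat. Qed.

Lemma sqr_sum_card (w : F -> R) : (\sum_x w x) ^+ 2 <= q * \sum_x w x ^+ 2.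
Proof.
have := cauchy_schwarz xpredT (fun=> 1) w.
under eq_bigr do rewrite mul1r; under [X in _ <= X * _ -> _]eq_bigr do rewrite expr1n.
by rewrite big_const iter_addr_0.
Qed.

(** Besides the variance there are two errors: the zero products, and the use of [q - 1] instead of
    [q] in the mean over nonzero residues. Cauchy-Schwarz bounds both by [S ^ (2 * k) * T2], up to
    the displayed factors, and also shows that the deviation is nonnegative. *)
Lemma DtimesF_deviation k : `|DtimesF k.+1 al bt - S ^+ (2 * k.+1) / q| <=
  nz2 (center (product_rep r k.+1)) + (k.+1%:R ^+ 2 + 2) * (S ^+ (2 * k) * T2).
Proof.
have q0 : 0 < q by apply: lt_le_trans q2.
set G := product_rep r k.+1.
have Gtot : \sum_l G l = S ^+ k.+1 by rewrite product_rep_total sum_diffconv.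
have lower : S ^+ (2 * k.+1) / q <= DtimesF k.+1 al bt.
  rewrite ler_pdivrMr // [leRHS]mulrC DtimesF_sum_sqr mulnC exprM -Gtot.
  exact: sqr_sum_card.
rewrite ger0_norm ?subr_ge0 // DtimesF_sum_sqr (bigD1 0) //= -/(nz2 G) nz2_centerE -/G.
set V := nz2 (center G); set s := \sum_(x | x != 0) G x.
have G0 l : 0 <= G l by exact: product_rep_ge0.
have hz : G 0 ^+ 2 <= k.+1%:R ^+ 2 * (S ^+ (2 * k) * T2).
  apply: le_trans (_ : (k.+1%:R * r 0 * S ^+ k) ^+ 2 <= _).
    apply: lerXn2r; rewrite ?nnegrE //; first by rewrite !mulr_ge0 ?exprn_ge0.
    by have := product_rep_zero k r0; rewrite sum_diffconv.
  have -> : (k.+1%:R * r 0 * S ^+ k) ^+ 2 = k.+1%:R ^+ 2 * (S ^+ (2 * k) * r 0 ^+ 2).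
    by rewrite mulnC exprM; move: (S ^+ k) (r 0) => *; ring.
  rewrite ler_wpM2l ?sqr_ge0 // ler_wpM2l ?exprn_ge0 //.
  rewrite /diffconv; under eq_bigr do rewrite subr0.
  exact: cauchy_schwarz.
have s0 : 0 <= s by exact: sumr_ge0.
have sS : s <= S ^+ k.+1 by rewrite -Gtot (bigD1 0) //= lerDr.
have q1 : (#|F|.-1)%:R = q - 1 :> R.
  by rewrite -[in RHS](prednK (ltnW F1)) -natr1 addrK.
have hs : s ^+ 2 / (#|F|.-1)%:R - S ^+ (2 * k.+1) / q <= 2 * (S ^+ (2 * k) * T2).
  rewrite q1; apply: le_trans (_ : S ^+ (2 * k.+1) / (q - 1) - S ^+ (2 * k.+1) / q <= _).
    rewrite lerD2r; apply: ler_wpM2r; first by rewrite invr_ge0; move: q2; lra.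
    by rewrite mulnC exprM; apply: lerXn2r; rewrite ?nnegrE ?exprn_ge0.
  have -> : S ^+ (2 * k.+1) / (q - 1) - S ^+ (2 * k.+1) / q = S ^+ (2 * k) * (S ^+ 2 / (q * (q - 1))).
    by rewrite mulnS exprD; field; apply/andP; split; apply: lt0r_neq0; move: q2; lra.
  rewrite [leRHS]mulrCA ler_wpM2l ?exprn_ge0 //.
  rewrite ler_pdivrMr; last by rewrite mulr_gt0 //; move: q2; lra.
  apply: le_trans (_ : q ^+ 2 * T2 <= _).
    rewrite exprMn; have -> : q ^+ 2 * T2 = (q * \sum_x al x ^+ 2) * (q * \sum_x bt x ^+ 2) by ring.
    by apply: ler_pM; rewrite ?sqr_ge0 ?sqr_sum_card.
  have -> : 2 * T2 * (q * (q - 1)) = (2 * (q * (q - 1))) * T2 by ring.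
  by apply: ler_wpM2r => //; move: q2; nra.
lra.
Qed.

End Deviation.
End Counting.

(** * Proof of the bounds *)

Section Powers.
Variable R : realType.
Implicit Types x y S T E : R.

Definition eps k : R := (2 ^+ k)^-1.

Lemma epsS k : eps k.+1 = eps k / 2.
Proof. by rewrite /eps exprSr invfM. Qed.

Lemma eps_exponent k : 2 `^ (- k.+1%:R + 2) = 2 * eps k.
Proof.
have -> : - k.+1%:R + 2 = 1 - k%:R :> R by rewrite -natr1; lra.
by rewrite powRB ?pnatr_eq0 ?implybT // powRr1 // powR_mulrn.
Qed.

Lemma powR_addr T x y : 0 < T -> T `^ (x + y) = T `^ x * T `^ y.
Proof. by move=> T0; rewrite powRD // (gt_eqF T0) implybT. Qed.

Lemma eps_interval k : 0 < eps k <= 1.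
Proof. by rewrite invr_gt0 exprn_gt0 //= invf_le1 ?exprn_gt0 // exprn_ege1 // ler1n. Qed.

Lemma powR_half_sqr x y : 0 <= x -> (x `^ (y / 2)) ^+ 2 = x `^ y.
Proof.
move=> x0; rewrite -powR_mulrn ?powR_ge0 // -powRrM; congr (_ `^ _).
by rewrite mulfVK // pnatr_eq0.
Qed.

(** The bound reproduces itself: half of [2 - 2 * eps k], plus 1 for the extra factor [T], is
    [2 - 2 * eps k.+1]; for [S] one has [k + k.+2 = 2 * k.+1]; and [c] times the root of [c ^ 2] is
    again [c ^ 2]. *)
Lemma half_power_recursion S T E c (V : nat -> R) :
    0 <= S -> 0 < T -> 0 <= E -> 1 <= c -> V 0%N <= E ->
    (forall k, V k.+1 <= c * (S * T) * S ^+ k.+1 * Num.sqrt (V k)) ->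
  forall k, V k <= c ^+ 2 * (S ^+ (2 * k) * T `^ (2 - 2 * eps k) * E `^ (eps k)).
Proof.
move=> S0 T0 E0 c1 V0 hV; have c0 : 0 <= c by lra.
elim=> [|k IHk].
  rewrite /eps expr0 invr1 mulr1 subrr powRr0 muln0 expr0 powRr1 // !mul1r.
  by apply: le_trans V0 _; rewrite ler_peMl // expr_ge1.
set Y := c * (S ^+ k * T `^ (1 - eps k) * E `^ (eps k / 2)).
have Y0 : 0 <= Y by rewrite !mulr_ge0 ?exprn_ge0 ?powR_ge0.
have sV : Num.sqrt (V k) <= Y.
  rewrite -[Y](ger0_norm Y0) -sqrtr_sqr ler_sqrt ?sqr_ge0 //; apply: le_trans IHk _.
  rewrite /Y; have -> : 1 - eps k = (2 - 2 * eps k) / 2 by field.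
  rewrite -[T `^ _](powR_half_sqr _ (ltW T0)) -[E `^ _](powR_half_sqr _ E0) mulnC exprM.
  by rewrite le_eqVlt; apply/orP; left; apply/eqP; ring.
apply: le_trans (hV k) _.
apply: le_trans (ler_wpM2l _ sV) _; first by rewrite !mulr_ge0 ?exprn_ge0 // ltW.
have -> : T `^ (2 - 2 * eps k.+1) = T * T `^ (1 - eps k).
  have -> : 2 - 2 * eps k.+1 = 1 + (1 - eps k) by rewrite epsS; field.
  by rewrite powR_addr // powRr1 // ltW.
rewrite epsS /Y mulnS exprD mulnC exprM exprS.
by rewrite le_eqVlt; apply/orP; left; apply/eqP; ring.
Qed.

(** Absorbs the errors from zero products and from the mean into the bound for the variance. *)
Lemma sqr_le_powR T E k : 0 < T -> T ^+ 2 <= E -> T ^+ 2 <= T `^ (2 - 2 * eps k) * E `^ (eps k).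
Proof.
move=> T0 TE; have /andP[e0 e1] := eps_interval k.
have -> : T ^+ 2 = T `^ (2 - 2 * eps k) * (T ^+ 2) `^ (eps k).
  rewrite -[X in X `^ eps k]powR_mulrn ?(ltW T0) // -powRrM -powR_addr //.
  by rewrite subrK powR_mulrn // ltW.
rewrite ler_wpM2l ?powR_ge0 //; apply: ge0_ler_powR => //; rewrite ?nnegrE ?sqr_ge0 ?(ltW e0) //.
exact: le_trans (sqr_ge0 _) TE.
Qed.

Lemma ln2_gt0 : 0 < ln 2 :> R. Proof. by rewrite ln_gt0 // ltr1n. Qed.

Lemma log2_ge1 x : 2 <= x -> 1 <= log2 x.
Proof.
move=> x2; rewrite /log2 ler_pdivlMr ?ln2_gt0 // mul1r ler_ln ?posrE //.
exact: lt_le_trans x2.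
Qed.

Lemma le_expn_log2 x M : 0 < x -> log2 x <= M%:R -> x <= 2 ^+ M.
Proof.
move=> x0; rewrite /log2 ler_pdivrMr ?ln2_gt0 // mulrC mulr_natr -lnXn //.
by rewrite ler_ln ?posrE ?exprn_gt0.
Qed.

(** [M] is the truncated logarithm plus one, so [M.+1 <= log2 x + 2], and [1 <= log2 x] turns this
    into [3 * log2 x]. *)
Lemma log2_levels x : 2 <= x -> exists2 M : nat, x <= 2 ^+ M & M.+1%:R <= 3 * log2 x.
Proof.
move=> x2; have L1 := log2_ge1 x2; have L0 : 0 <= log2 x by lra.
have /andP[t1 t2] := truncn_itv L0.
exists (Num.truncn (log2 x)).+1.
  by apply: le_expn_log2 (ltW t2); apply: lt_le_trans x2.
by rewrite -addn2 natrD; lra.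
Qed.

End Powers.

(** * From the one-step estimate to all k *)

Section Assembly.
Variables (R : realType) (p : nat).
Hypothesis p_pr : prime p.
Local Notation F := 'F_p.
Variables (A : {set F}) (al : F -> R).
Hypotheses (A2 : (2 <= #|A|)%N) (al0 : forall x, 0 <= al x) (aln : exists x, al x != 0).
Local Notation bt := (indic R A).
Local Notation r := (diffconv al bt).
Local Notation sA := (Num.sqrt (#|A|%:R : R)).
Local Notation a1 := (\sum_x al x).
Local Notation a2 := (Num.sqrt (\sum_x al x ^+ 2)).

Lemma indic_ge0 x : 0 <= bt x. Proof. exact: ler0n. Qed.

Lemma sum_bt : \sum_x bt x = #|A|%:R.
Proof. by rewrite -[RHS](sum_indic R A); apply: eq_bigr => x _; rewrite ger0_norm ?indic_ge0. Qed.

Lemma sum_bt2 : \sum_x bt x ^+ 2 = #|A|%:R.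
Proof.
by rewrite -[RHS]sum_bt; apply: eq_bigr => x _; rewrite /indic; case: (x \in A); rewrite ?expr1n ?expr0n.
Qed.

Lemma norm1_al : norm1 al = a1.
Proof. by apply: eq_bigr => x _; rewrite ger0_norm. Qed.

Lemma norm2_al : norm2 al = a2.
Proof. by congr Num.sqrt; apply: eq_bigr => x _; rewrite ger0_norm. Qed.

Lemma norm1_bt : norm1 bt = #|A|%:R.
Proof. exact: sum_indic. Qed.

Lemma norm2_bt : norm2 bt = sA.
Proof. by congr Num.sqrt; rewrite -sum_bt2; apply: eq_bigr => x _; rewrite ger0_norm ?indic_ge0. Qed.

Local Notation S := (a1 * #|A|%:R).
Local Notation T := (a2 * sA).
Local Notation E := (EplusF al bt).
Let V k := nz2 (center (product_rep r k.+1)).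

Lemma a2_gt0 : 0 < a2.
Proof.
rewrite sqrtr_gt0; case: aln => x ax; rewrite (bigD1 x) //=.
apply: ltr_wpDr; first by apply: sumr_ge0 => y _; exact: sqr_ge0.
by rewrite exprn_gt0 // lt_neqAle eq_sym ax al0.
Qed.

Lemma sA_gt0 : 0 < sA.
Proof. by rewrite sqrtr_gt0 ltr0n ltnW. Qed.

Lemma T_gt0 : 0 < T.
Proof. by rewrite mulr_gt0 ?a2_gt0 ?sA_gt0. Qed.

Lemma S_ge0 : 0 <= S. Proof. by rewrite mulr_ge0 ?sumr_ge0. Qed.

Lemma T_sqr : T ^+ 2 = (\sum_x al x ^+ 2) * (\sum_x bt x ^+ 2).
Proof.
rewrite exprMn !sqr_sqrtr ?sum_bt2 //; by apply: sumr_ge0 => x _; exact: sqr_ge0.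
Qed.

Lemma T_sqr_le : T ^+ 2 <= E.
Proof. by rewrite T_sqr; apply: EplusF_ge => //; exact: indic_ge0. Qed.

Lemma a2_le_a1 : a2 <= a1.
Proof.
have a10 : 0 <= a1 by exact: sumr_ge0.
rewrite -[leRHS](ger0_norm a10) -sqrtr_sqr ler_sqrt ?sqr_ge0 // [leRHS]expr2 mulr_suml.
apply: ler_sum => x _; rewrite expr2 ler_wpM2l // (bigD1 x) //= lerDl.
by apply: sumr_ge0 => y _.
Qed.

Lemma V0_le : V 0 <= E.
Proof.
rewrite /V -sum_sqr_diffconv [leRHS](bigID (fun z => z != 0)) /=.
apply: le_trans (nz2_center _) _; rewrite (nz2_eq (fun l => @product_rep1 R F r l)).
by rewrite lerDl; apply: sumr_ge0 => z _; exact: sqr_ge0.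
Qed.

Section WithConstant.
Variable c : R.
Hypothesis c1 : 1 <= c.
Hypothesis step : forall w : F -> R, \sum_(x | x != 0) w x = 0 ->
  nz2 (conv w r) <= c / 2 * (S * T) * (nz1 w * Num.sqrt (nz2 w)).

Lemma V_step k : V k.+1 <= c * (S * T) * S ^+ k.+1 * Num.sqrt (V k).
Proof.
have rS : nz1 r <= S.
  apply: le_trans (nz1_diffconv _ _) _; rewrite (sum_indic R A) ler_wpM2r //.
  by apply: ler_sum => x _; rewrite ger0_norm.
have cS : 0 <= c / 2 * (S * T).
  have c0 : 0 <= c := le_trans ler01 c1.
  by rewrite !mulr_ge0 ?invr_ge0 ?sumr_ge0 // sqrtr_ge0.
have := variance_step cS rS step k.
by rewrite -/(V k.+1) -/(V k); congr (_ <= _ * _ * _); field.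
Qed.

Lemma deviation_le k : `|DtimesF k.+1 al bt - S ^+ (2 * k.+1) / p%:R| <=
  (c ^+ 2 + (k.+1%:R ^+ 2 + 2)) * (S ^+ (2 * k) * T `^ (2 - 2 * eps R k) * E `^ (eps R k)).
Proof.
have := DtimesF_deviation al0 indic_ge0 k; rewrite sum_bt card_Fp //.
move=> /le_trans; apply; rewrite -/(V k) [leRHS]mulrDl; apply: lerD.
  have E0 : 0 <= E by apply: le_trans T_sqr_le; exact: sqr_ge0.
  exact: (half_power_recursion S_ge0 T_gt0 E0 c1 V0_le V_step).
rewrite -mulrA ler_wpM2l ?addr_ge0 ?sqr_ge0 // ler_wpM2l ?exprn_ge0 ?S_ge0 //.
by rewrite -T_sqr; exact: sqr_le_powR T_gt0 T_sqr_le.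
Qed.

(** A single step of the recursion starting from [V 0 <= E], so [c] enters to the first power and
    not squared. *)
Lemma deviation_two_le : `|DtimesF 2 al bt - S ^+ 4 / p%:R| <= (c + 6) * (S ^+ 2 * T * Num.sqrt E).
Proof.
have := DtimesF_deviation al0 indic_ge0 1; rewrite sum_bt card_Fp // !mul2n.
move=> /le_trans; apply; rewrite -/(V 1) [leRHS]mulrDl; apply: lerD.
  apply: le_trans (V_step 0) _; rewrite expr1.
  have -> : c * (S ^+ 2 * T * Num.sqrt E) = c * (S * T) * S * Num.sqrt E by ring.
  have c0 : 0 <= c := le_trans ler01 c1.
  have cST := mulr_ge0 (mulr_ge0 c0 (mulr_ge0 S_ge0 (ltW T_gt0))) S_ge0.
  by apply: ler_wpM2l cST _ _ (ler_wsqrtr V0_le).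
have -> : 2 ^+ 2 + 2 = 6 :> R by ring.
rewrite ler_wpM2l // -mulrA ler_wpM2l ?sqr_ge0 // -T_sqr expr2 ler_wpM2l ?(ltW T_gt0) //.
by rewrite -[leLHS](ger0_norm (ltW T_gt0)) -sqrtr_sqr ler_wsqrtr ?T_sqr_le.
Qed.

End WithConstant.
End Assembly.

Section Counting.
Variables (R : realType) (F : finFieldType) (A : {set F}).
Local Notation bt := (indic R A).

Lemma prod_bool (I : finType) (P : pred I) : \prod_i (P i)%:R = [forall i, P i]%:R :> R.
Proof.
case: forallP => [h|/forallP]; first by rewrite big1 // => i _; rewrite h.
rewrite negb_forall => /existsP[i Pi].
by rewrite (bigD1 i) //= (negbTE Pi) mul0r.
Qed.

Lemma Dtimes_indic k : (Dtimes k A)%:R = DtimesF k bt bt.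
Proof.
rewrite /Dtimes -sum1dep_card natr_sum big_mkcond /DtimesF 2!pair_bigA /=.
under [RHS]eq_bigr do rewrite big_mkcond.
rewrite pair_bigA /=; apply: eq_bigr => -[[[a b] a'] b'] _ /=.
rewrite andbC; case: eqP => // _ /=.
rewrite -[LHS]/(if _ then 1 else 0) -[LHS]mulrb -prod_bool.
by apply: eq_bigr => i _; rewrite /indic -!natrM !mulnb -!andbA.
Qed.

Lemma Eplus_indic : (Eplus A)%:R = EplusF bt bt.
Proof.
rewrite /Eplus -sum1dep_card natr_sum big_mkcond /EplusF.
transitivity (\sum_a1 \sum_a2 \sum_a3 \sum_a4
    (if a1 + a2 == a3 + a4 then bt a1 * bt a2 * bt a3 * bt a4 else 0)).
  rewrite 3!pair_bigA /=; apply: eq_bigr => -[[[a b] c] d] _ /=.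
  rewrite /indic -!natrM !mulnb !andbA andbC.
  by case: eqP => //= _; rewrite -mulrb.
transitivity (\sum_a1 \sum_x \sum_a3 bt a1 * bt (x - a1) * (bt a3 * bt (x - a3))).
  apply: eq_bigr => a1 _; rewrite [RHS](reindex_inj (addrI a1)) /=.
  apply: eq_bigr => a2 _; apply: eq_bigr => a3 _.
  rewrite -big_mkcond (big_pred1 (a1 + a2 - a3)) => [|a4 /=]; last first.
    by rewrite [RHS]eq_sym subr_eq [a4 + _]addrC.
  by rewrite [a1 + a2 - a1]addrAC subrr add0r !mulrA.
rewrite exchange_big; apply: eq_bigr => x _.
rewrite expr2 mulr_suml; apply: eq_bigr => a1 _.
by rewrite mulr_sumr.
Qed.

End Counting.

(* Locked: unification would otherwise unfold the unary numeral. *)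
Definition step_const (R : realType) : R := locked 20000.

Lemma step_constE (R : realType) : 20000 = step_const R.
Proof. by rewrite /step_const -lock. Qed.

Lemma step_const_ge1 (R : realType) : 1 <= step_const R.
Proof. by rewrite -step_constE ler1n. Qed.

Section Bounds.
Variables (R : realType) (p : nat).
Hypothesis p_pr : prime p.
Local Notation F := 'F_p.
Variables (A : {set F}).
Hypotheses (A2 : (2 <= #|A|)%N).
Local Notation bt := (indic R A).
Local Notation n := (#|A|%:R : R).
Local Notation sA := (Num.sqrt n).

Let K : R := step_const R.
Let K1 : 1 <= K := step_const_ge1 R.

Let K0 : 0 < 2 * K. Proof. by have := K1; lra. Qed.

Let n2 : 2 <= n. Proof. by rewrite (ler_nat R 2). Qed.

Let sAn : n = sA ^+ 2. Proof. by rewrite sqr_sqrtr. Qed.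

Let sA1 : 1 <= sA. Proof. by rewrite -[X in X <= _]sqrtr1 ler_wsqrtr // ler1n ltnW. Qed.

Lemma levels_const_sqr M (x k : R) m : 0 <= k -> M.+1%:R <= 3 * log2 x ->
  (k * M.+1%:R ^+ m) ^+ 2 <= (k ^+ 2 * 3 ^+ (2 * m)) * log2 x ^+ (2 * m).
Proof.
move=> k0 h; rewrite exprMn -exprM mulnC -mulrA ler_wpM2l ?sqr_ge0 // -exprMn.
by apply: lerXn2r; rewrite ?nnegrE //; apply: le_trans h.
Qed.

Lemma one_le_const M m : 1 <= 2 * K * M.+1%:R ^+ m :> R.
Proof.
have M1 : 1 <= M.+1%:R ^+ m :> R by rewrite exprn_ege1 // ler1n.
have K2 : 1 <= 2 * K by have := K1; lra.
exact: mulr_ege1.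
Qed.

Lemma deviation_general al (a1 := \sum_x al x) (a2 := Num.sqrt (\sum_x al x ^+ 2)) k :
    (forall x, 0 <= al x) -> (exists x, al x != 0) ->
  `|DtimesF k.+1 al bt - (a1 * n) ^+ (2 * k.+1) / p%:R| <=
  ((2 * K) ^+ 2 * 3 ^+ 8 + (k.+1%:R ^+ 2 + 2)) *
  (log2 (a1 * n * n / (a2 * sA)) ^+ 8 *
   ((a1 * n) ^+ (2 * k) * (a2 * sA) `^ (2 - 2 * eps R k) * EplusF al bt `^ (eps R k))).
Proof.
move=> al0 aln; set x := _ / (a2 * sA); set B := _ * EplusF al bt `^ _.
have T0 : 0 < a2 * sA := T_gt0 A2 al0 aln.
have a12 : a2 <= a1 := a2_le_a1 al0.
have a20 : 0 <= a2 by exact: sqrtr_ge0.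
have x2 : 2 <= x.
  rewrite /x ler_pdivlMr //.
  have h : sA * 2 <= n * n.
    by apply: ler_pM; rewrite ?sqrtr_ge0 // {2}sAn expr2 ler_peMr ?sqrtr_ge0.
  have s20 : 0 <= sA * 2 by rewrite mulr_ge0 ?sqrtr_ge0.
  by rewrite -mulrA [2 * _]mulrC -mulrA; exact: ler_pM.
have [M xM ML] := log2_levels x2; have L1 := log2_ge1 x2.
set c := 2 * K * M.+1%:R ^+ 4.
have M1 : 1 <= M.+1%:R ^+ 4 :> R by rewrite exprn_ege1 // ler1n.
have c1 : 1 <= c := one_le_const M 4.
have step w : \sum_(l | l != 0) w l = 0 ->
    nz2 (conv w (diffconv al bt)) <= c / 2 * (a1 * n * (a2 * sA)) * (nz1 w * Num.sqrt (nz2 w)).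
  move=> w0.
  (* The argument [x] of the logarithm exceeds the ratio needed for the decompositions by the factor
     [sA], which is at least 1. *)
  have hM : a1 * n <= 2 ^+ M * a2.
    apply: le_trans (_ : x * a2 <= _); last by rewrite ler_wpM2r.
    have -> : x * a2 = a1 * n * sA.
      rewrite /x {2}sAn; field; rewrite !gt_eqF ?(lt_le_trans ltr01 sA1) //.
      by rewrite lt_neqAle a20 andbT; apply: contraTneq T0 => <-; rewrite mul0r ltxx.
    by rewrite ler_peMr // mulr_ge0 // (le_trans a20).
  have := step_all_levels (pchar_Fp p_pr) (card_Fp p_pr) (ltnW A2) w0 al0 hM.
  rewrite (step_constE R) -/K.
  move/le_trans; apply; rewrite -/a1 -/a2 /c le_eqVlt; apply/orP; left; apply/eqP.
  by field.
have B0 : 0 <= B.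
  by rewrite !mulr_ge0 ?exprn_ge0 ?powR_ge0 // mulr_ge0 // (le_trans a20).
apply: le_trans (deviation_le p_pr A2 al0 aln c1 step k) _.
rewrite -/a1 -/a2 -/B mulrA ler_wpM2r // [leRHS]mulrDl; apply: lerD.
  exact: (@levels_const_sqr M _ (2 * K) 4 (ltW K0) ML).
by rewrite ler_peMr ?addr_ge0 ?sqr_ge0 // exprn_ege1.
Qed.

Lemma bt_nonzero : exists x, bt x != 0.
Proof.
have /card_gt0P[x xA] : (0 < #|A|)%N by exact: ltnW.
by exists x; rewrite /indic xA oner_eq0.
Qed.

(** An indicator is a single level, with [v = 1] and [B = A]. Only [w] has to be decomposed, so the
    power of [M.+1] is 2 instead of 4. *)
Lemma step_indic M w : n <= 2 ^+ M -> \sum_(l | l != 0) w l = 0 ->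
  nz2 (conv w (diffconv bt bt)) <=
  2 * K * M.+1%:R ^+ 2 / 2 * ((\sum_x bt x) * n * (Num.sqrt (\sum_x bt x ^+ 2) * sA)) *
  (nz1 w * Num.sqrt (nz2 w)).
Proof.
move=> nM w0; rewrite sum_bt sum_bt2.
have := @step_one_level R _ _ A (pchar_Fp p_pr) (card_Fp p_pr) w bt A 1 n sA M w0 ler01.
rewrite (step_constE R) -/K => h.
apply: le_trans (h _ _ _ _ _ _) _; rewrite ?mul1r ?expr1n ?mul1r -?sAn ?sqrtr_ge0 //.
- by move=> b; rewrite mulr1 /indic ger0_norm // ler_peMl // ler1n.
- by rewrite ler_wpM2r ?sqrtr_ge0.
by rewrite le_eqVlt; apply/orP; left; apply/eqP; field.
Qed.

Lemma deviation_indic k :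
  `|(Dtimes k.+1 A)%:R - n ^+ (4 * k.+1) / p%:R| <=
  ((2 * K) ^+ 2 * 3 ^+ 4 + (k.+1%:R ^+ 2 + 2)) *
  (log2 n ^+ 4 * (n ^+ (4 * k) * n `^ (2 - 2 * eps R k) * (Eplus A)%:R `^ (eps R k))).
Proof.
have [M xM ML] := log2_levels n2; have L1 := log2_ge1 n2.
have step w := @step_indic M w xM.
have := deviation_le p_pr A2 (@indic_ge0 R p A) bt_nonzero (one_le_const M 2) step k.
rewrite sum_bt sum_bt2 -!expr2 -sAn -!exprM !mulnA -Dtimes_indic -Eplus_indic.
move=> /le_trans; apply; rewrite [leRHS]mulrA; apply: ler_wpM2r.
  by rewrite !mulr_ge0 ?exprn_ge0 ?powR_ge0.
rewrite [leRHS]mulrDl; apply: lerD.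
  exact: (@levels_const_sqr M _ (2 * K) 2 (ltW K0) ML).
by rewrite ler_peMr ?addr_ge0 ?sqr_ge0 // exprn_ege1.
Qed.

Lemma deviation_two_indic :
  `|(Dtimes 2 A)%:R - n ^+ 8 / p%:R| <=
  (2 * K * 9 + 6) * (log2 n ^+ 2 * n ^+ 5 * Num.sqrt (Eplus A)%:R).
Proof.
have [M xM ML] := log2_levels n2; have L1 := log2_ge1 n2.
have step w := @step_indic M w xM.
have := deviation_two_le p_pr A2 (@indic_ge0 R p A) bt_nonzero (one_le_const M 2) step.
rewrite sum_bt sum_bt2 -!expr2 -sAn -!exprM -exprSr -Dtimes_indic -Eplus_indic.
move=> /le_trans; apply; rewrite -[log2 n ^+ 2 * _ * _]mulrA [leRHS]mulrA; apply: ler_wpM2r.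
  by rewrite mulr_ge0 ?exprn_ge0 ?sqrtr_ge0.
rewrite [leRHS]mulrDl; apply: lerD; last by rewrite ler_peMr // exprn_ege1.
have -> : 2 * K * 9 * log2 n ^+ 2 = 2 * K * (3 * log2 n) ^+ 2 by ring.
by apply: ler_wpM2l (ltW K0) _ _ _; apply: lerXn2r; rewrite ?nnegrE //; apply: le_trans ML.
Qed.

End Bounds.

Theorem theorem30 (R : realType) :
  (exists2 C : R, 0 < C &
    forall (p : nat) (A : {set 'F_p}),
      prime p -> odd p -> (2 <= #|A|)%N ->
      `| (Dtimes 2 A)%:R - #|A|%:R ^+ 8 / p%:R |
        <= C * (log2 (#|A|%:R : R) ^+ 2 * #|A|%:R ^+ 5
                * (Eplus A)%:R `^ (1 / 2)))
  /\
  (forall k : nat, (2 <= k)%N -> exists2 C : R, 0 < C &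
    forall (p : nat) (A : {set 'F_p}),
      prime p -> odd p -> (2 <= #|A|)%N ->
      `| (Dtimes k A)%:R - #|A|%:R ^+ (4 * k) / p%:R |
        <= C * (log2 (#|A|%:R : R) ^+ 4
                * #|A|%:R `^ (4 * k%:R - 2 - 2 `^ (- k%:R + 2))
                * (Eplus A)%:R `^ (1 / 2 ^+ (k - 1))))
  /\
  (forall k : nat, (2 <= k)%N -> exists2 C : R, 0 < C &
    forall (p : nat) (A : {set 'F_p}) (alpha : 'F_p -> R),
      prime p -> odd p -> (2 <= #|A|)%N ->
      (forall x, 0 <= alpha x) -> (exists x, alpha x != 0) ->
      let beta : 'F_p -> R := indic R A in
      let L : R := log2 (norm1 alpha * norm1 beta * #|A|%:R
                         / (norm2 alpha * norm2 beta)) in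
      `| DtimesF k alpha beta
         - norm1 alpha ^+ (2 * k) * norm1 beta ^+ (2 * k) / p%:R |
        <= C * (L ^+ 8
                * (norm1 alpha * norm1 beta) ^+ (2 * k - 2)
                * (norm2 alpha * norm2 beta) `^ (2 - 2 `^ (- k%:R + 2))
                * EplusF alpha beta `^ (1 / 2 ^+ (k - 1)))).
Proof.
have K0 : 0 < step_const R := lt_le_trans ltr01 (step_const_ge1 R).
have eps_inv k : 1 / 2 ^+ (k.+1 - 1) = eps R k by rewrite subn1 div1r.
split; last split.
- exists (2 * step_const R * 9 + 6).
    by rewrite !addr_gt0 ?mulr_gt0.
  move=> p A p_pr _ A2; rewrite div1r powR12_sqrt ?ler0n //.
  exact: deviation_two_indic.
- case=> // k _; exists ((2 * step_const R) ^+ 2 * 3 ^+ 4 + (k.+1%:R ^+ 2 + 2)).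
    by rewrite !addr_gt0 ?mulr_gt0 ?exprn_gt0 ?ltr0Sn.
  move=> p A p_pr _ A2; rewrite eps_inv eps_exponent.
  have n0 : 0 < #|A|%:R :> R by rewrite ltr0n ltnW.
  have -> : 4 * k.+1%:R - 2 - 2 * eps R k = (4 * k)%:R + (2 - 2 * eps R k) :> R.
    by rewrite natrM -[k.+1%:R]natr1; ring.
  rewrite powR_addr // powR_mulrn ?(ltW n0) //.
  by have := deviation_indic R p_pr A2 k; congr (_ <= _ * _); ring.
case=> // k _; exists ((2 * step_const R) ^+ 2 * 3 ^+ 8 + (k.+1%:R ^+ 2 + 2)).
  by rewrite !addr_gt0 ?mulr_gt0 ?exprn_gt0 ?ltr0Sn.
move=> p A al p_pr _ A2 al0 aln /=; rewrite eps_inv eps_exponent.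
rewrite norm1_al // norm2_al // norm1_bt norm2_bt -exprMn.
rewrite (_ : 2 * k.+1 - 2 = 2 * k)%N; last by rewrite mulnS addKn.
by have := deviation_general p_pr A2 k al0 aln; congr (_ <= _ * _); ring.
Qed.
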